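(* Let $\overline{D}=\{z\in\mathbb{C}:|z|\le 1\}$. The set of all functions $f:\overline{D}\to\overline{\mathbb{C}}$ that are uniform limits on $\overline{D}$, with respect to the metric $d$ on $\overline{\mathbb{C}}$, of sequences of polynomials with complex coefficients (restricted to $\overline{D}$), coincides with the class $\overline{A}(D)$.
   Context: Compactification: $\overline{\mathbb{C}}=\mathbb{C}\cup\mathbb{C}^{\infty}$, where $\mathbb{C}^{\infty}=\{\infty e^{i\theta}:\theta\in\mathbb{R}\}$ is a set of points at infinity in bijection with the unit circle ($\infty e^{i\theta}$ corresponds to $e^{i\theta}$). Define $G:\overline{\mathbb{C}}\to\{w\in\mathbb{C}:|w|\le1\}$ by $G(z)=\frac{z}{1+|z|}$ for $z\in\mathbb{C}$ and $G(\infty e^{i\theta})=e^{i\theta}$; $G$ is a bijection, and $d(z_1,z_2)=|G(z_1)-G(z_2)|$ is a metric on $\overline{\mathbb{C}}$. The space $\overline{\mathbb{C}}$ carries the topology of $d$. Let $D=\{z\in\mathbb{C}:|z|<1\}$. The class $\overline{A}(D)$ consists of the continuous functions $f:\overline{D}\to\overline{\mathbb{C}}$ of the following two types. (a) Finite type: continuous $f:\overline{D}\to\overline{\mathbb{C}}$ such that $f(D)\subset\mathbb{C}$ and $f|_D$ is holomorphic. (b) Infinite type: continuous $f:\overline{D}\to\mathbb{C}^{\infty}\subset\overline{\mathbb{C}}$ of the form $f(z)=\infty e^{i\theta(z)}$, $z\in\overline{D}$, where $\theta:\overline{D}\to\mathbb{R}$ is continuous on $\overline{D}$ and harmonic in $D$.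 *)

(* Defs.v *)
From Stdlib Require Import Reals Lra.
From Coquelicot Require Import Coquelicot.
Open Scope R_scope.

(** A function on the closed disc is represented by a total function on [C];
    every predicate below involves only its values on the closed disc. *)

Definition Disc (z : C) : Prop := Cmod z < 1.
Definition Disc_bar (z : C) : Prop := Cmod z <= 1.

Definition unit_circle : Type := {u : C | Cmod u = 1}.

Lemma Cmod_cos_sin (t : R) : Cmod (cos t, sin t) = 1.
Proof.
  unfold Cmod; simpl fst; simpl snd.
  rewrite <- sqrt_1; f_equal.
  rewrite <- (sin2_cos2 t); unfold Rsqr; ring.
Qed.

(** [expi t] is e^(it). *)
Definition expi (t : R) : unit_circle :=
  exist _ (cos t, sin t) (Cmod_cos_sin t).

(** [Infty u] is the point at infinity in the direction [u]. *)
Inductive Cbar : Type :=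
  | Fin (z : C)
  | Infty (u : unit_circle).

Definition G (p : Cbar) : C :=
  match p with
  | Fin z => Cdiv z (RtoC (1 + Cmod z))
  | Infty u => proj1_sig u
  end.

Definition d (p q : Cbar) : R := Cmod (Cminus (G p) (G q)).

Lemma d_refl (p : Cbar) : d p p = 0.
Proof.
  unfold d; replace (Cminus (G p) (G p)) with (RtoC 0) by ring.
  exact Cmod_0.
Qed.

Lemma d_sym (p q : Cbar) : d p q = d q p.
Proof.
  unfold d; rewrite <- Cmod_opp; f_equal; ring.
Qed.

Lemma d_triangle (p q r : Cbar) : d p r <= d p q + d q r.
Proof.
  unfold d.
  replace (Cminus (G p) (G r))
    with (Cplus (Cminus (G p) (G q)) (Cminus (G q) (G r))) by ring.
  apply Cmod_triangle.
Qed.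

Definition Cbar_ball (p : Cbar) (e : R) (q : Cbar) : Prop := d p q < e.

Lemma Cbar_ball_center (p : Cbar) (e : posreal) : Cbar_ball p e p.
Proof.
  unfold Cbar_ball; rewrite d_refl; apply cond_pos.
Qed.

Lemma Cbar_ball_sym (p q : Cbar) (e : R) : Cbar_ball p e q -> Cbar_ball q e p.
Proof.
  unfold Cbar_ball; rewrite d_sym; trivial.
Qed.

Lemma Cbar_ball_triangle (p q r : Cbar) (e1 e2 : R) :
  Cbar_ball p e1 q -> Cbar_ball q e2 r -> Cbar_ball p (e1 + e2) r.
Proof.
  unfold Cbar_ball; intros H1 H2; pose proof (d_triangle p q r); lra.
Qed.

Definition Cbar_UniformSpace_mixin :=
  UniformSpace.Mixin Cbar (Fin (RtoC 0)) Cbar_ball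
    Cbar_ball_center Cbar_ball_sym Cbar_ball_triangle.

Canonical Cbar_UniformSpace : UniformSpace :=
  UniformSpace.Pack Cbar Cbar_UniformSpace_mixin Cbar.

Definition holomorphic_on (U : C -> Prop) (g : C -> C) : Prop :=
  forall z : C, U z -> @ex_derive C_AbsRing C_NormedModule g z.

(** [ex_diff_n _ 2] at every point of the open set [U] says that the function
    is of class C^2 on [U]. *)
Definition harmonic_on (U : C -> Prop) (theta : C -> R) : Prop :=
  forall x y : R, U (x, y) ->
    let h := fun s t : R => theta (s, t) in
    ex_diff_n h 2 x y /\
    partial_derive 2 0 h x y + partial_derive 0 2 h x y = 0.

Definition finite_type (f : C -> Cbar) : Prop :=
  continuous_on Disc_bar f /\
  exists g : C -> C,
    (forall z : C, Disc z -> f z = Fin (g z)) /\ holomorphic_on Disc g.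

Definition infinite_type (f : C -> Cbar) : Prop :=
  continuous_on Disc_bar f /\
  exists theta : C -> R,
    (forall z : C, Disc_bar z -> f z = Infty (expi (theta z))) /\
    continuous_on Disc_bar theta /\ harmonic_on Disc theta.

Definition class_Abar (f : C -> Cbar) : Prop :=
  finite_type f \/ infinite_type f.

Definition is_polynomial (p : C -> C) : Prop :=
  exists (n : nat) (a : nat -> C),
    forall z : C, p z = sum_n (fun k => Cmult (a k) (Cpow z k)) n.

Definition uniform_limit_on (E : C -> Prop) (F : nat -> C -> Cbar)
    (f : C -> Cbar) : Prop :=
  forall eps : R, 0 < eps ->
    exists N : nat, forall n : nat, (N <= n)%nat ->
      forall z : C, E z -> d (F n z) (f z) < eps.

Definition uniform_limit_of_polynomials (f : C -> Cbar) : Prop :=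
  exists p : nat -> C -> C,
    (forall n : nat, is_polynomial (p n)) /\
    uniform_limit_on Disc_bar (fun n z => Fin (p n z)) f.

(* Main.v *)
Require Import Defs.
From Stdlib Require Import Reals Arith Lra Lia Classical ClassicalEpsilon Eqdep_dec.
From Coquelicot Require Import Coquelicot.
Open Scope R_scope.

(** Everything rests on one fact: a function holomorphic in the disc has a Taylor expansion,
    hence is a locally uniform limit of polynomials.  By Goursat's theorem for
    [g (exp w) exp (- k w)] on rectangles of height [2 PI], the Fourier coefficients of [g] on the
    circle of radius [r] are [c k * r ^ k] for [k >= 0] and vanish for [k < 0]; Fejer's theorem
    then identifies [g] with the sum of its Taylor series, and bounding the coefficients by [Re g]
    gives the Cauchy estimates and Harnack's inequality.

    If [f] is of finite type, [f (r z)] is close to [f z] by uniform continuity of [G o f], and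
    is a uniform limit of its Taylor polynomials.  If [f = Infty (exp (i theta))], then
    [theta_x - i theta_y] is holomorphic; integrating its Taylor polynomials gives polynomials
    [P] with [Re P] close to [theta (r z)], and a large multiple of [exp (i P)] is close to [f].

    Conversely, let polynomials [p n] tend to [f].  If [f] is infinite at an interior point,
    [ln |p n|] is eventually a positive harmonic function nearby, so by Harnack [f] is infinite
    nearby; by connectedness [f] is finite on all of [Disc] (Weierstrass' theorem applies) or
    infinite on all of it.  In the latter case [p N] has a logarithm [h] on a larger disc for large [N],
    and [Im (h + Log (p n / p N))] tends uniformly to an argument [theta] of [f]. *)

(** * Complex derivatives *)

(** Rectangles suffice for Cauchy's theorem because [z = exp w] unrolls an annulus into a rectangle;
    the factor [exp (- k w)] then isolates one Fourier mode, which replaces Cauchy's integral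
    formula. The vanishing of the negative modes is what lets the real part control everything:
    [Cconj g] contributes nothing to a positive mode, so that mode is the same for [g] and for
    [2 Re g]. A bound on [Re g], or its mere positivity, is all that is available for [ln |p n|] and
    for arguments. Two obstacles come from the boundary. A function of finite type may be infinite
    on the circle, so only [G o f] is uniformly continuous there, while [f (r z)] is finite on the
    whole closed disc. In the infinite case [theta] must be single valued and continuous up to the
    circle: the logarithm of one fixed [p N], defined beyond the closed disc, carries the bulk of
    the argument, and [p n / p N] stays in the right half-plane, where the principal [Log] is
    unambiguous. *)

Definition cderiv (g : C -> C) (z l : C) : Prop :=
  forall eps : R, 0 < eps -> exists delta : R, 0 < delta /\
    forall w : C, Cmod (w - z) < delta ->
      Cmod (g w - g z - l * (w - z)) <= eps * Cmod (w - z).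

Definition cball (w : C) (r : R) (z : C) : Prop := Cmod (z - w) < r.

Definition holo (U : C -> Prop) (g : C -> C) : Prop :=
  forall z : C, U z -> exists l : C, cderiv g z l.

Definition ccont (g : C -> C) (z : C) : Prop :=
  forall eps : R, 0 < eps -> exists delta : R, 0 < delta /\
    forall w : C, Cmod (w - z) < delta -> Cmod (g w - g z) < eps.

Lemma is_derive_eps {K : AbsRing} {V : NormedModule K} (g : K -> V) (z : K) (l : V) :
  is_derive g z l <->
  forall eps : R, 0 < eps -> exists delta : R, 0 < delta /\
    forall w : K, abs (minus w z) < delta ->
      norm (minus (minus (g w) (g z)) (scal (minus w z) l)) <= eps * abs (minus w z).
Proof.
  split.
  - intros [_ H] eps He.
    destruct (H z (fun P HP => HP) (mkposreal eps He)) as [dl Hd].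
    exists dl; split; [apply cond_pos|]; intros w Hw; exact (Hd w Hw).
  - intros H; split; [apply is_linear_scal_l|].
    intros x Hx.
    (* The library's derivative asks for the estimate at every limit point [x] of the filter at [z];
       limits are unique, so [x] is [z]. *)
    assert (E : z = x) by exact (is_filter_lim_locally_unique (V := AbsRing_NormedModule K) z x Hx).
    subst x; intros eps; destruct (H eps (cond_pos eps)) as [dl [Hd Hw]].
    exists (mkposreal dl Hd); intros w Hlt; exact (Hw w Hlt).
Qed.

Lemma cderiv_comm (g : C -> C) (z l : C) :
  cderiv g z l <->
  forall eps : R, 0 < eps -> exists delta : R, 0 < delta /\
    forall w : C, Cmod (w - z) < delta ->
      Cmod (g w - g z - (w - z) * l) <= eps * Cmod (w - z).
Proof.
  split; intros H eps He; destruct (H eps He) as [dl [Hd Hw]]; exists dl;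
    (split; [exact Hd|]); intros w Hlt; specialize (Hw w Hlt);
    rewrite Cmult_comm; exact Hw.
Qed.

(** [C] carries two normed module structures over itself: the product rule lives in
    [AbsRing_NormedModule], whereas [holomorphic_on] speaks of [C_NormedModule]. [cderiv] is the
    common epsilon-delta form through which results pass from one to the other. *)
Lemma cderiv_is_derive_abs (g : C -> C) (z l : C) :
  cderiv g z l <-> @is_derive C_AbsRing (AbsRing_NormedModule C_AbsRing) g z l.
Proof.
  rewrite cderiv_comm; symmetry.
  exact (is_derive_eps (K := C_AbsRing) (V := AbsRing_NormedModule C_AbsRing) g z l).
Qed.

Lemma cderiv_is_derive (g : C -> C) (z l : C) :
  cderiv g z l <-> @is_derive C_AbsRing C_NormedModule g z l.
Proof.
  rewrite cderiv_comm; symmetry.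
  exact (is_derive_eps (K := C_AbsRing) (V := C_NormedModule) g z l).
Qed.

Lemma holo_holomorphic_on (U : C -> Prop) (g : C -> C) :
  holo U g <-> holomorphic_on U g.
Proof.
  split; intros H z Hz; destruct (H z Hz) as [l Hl]; exists l;
    apply cderiv_is_derive; exact Hl.
Qed.

Lemma cderiv_eq (g : C -> C) (z l l' : C) : cderiv g z l -> l = l' -> cderiv g z l'.
Proof. intros H <-; exact H. Qed.

Lemma cderiv_const (c z : C) : cderiv (fun _ => c) z 0.
Proof.
  intros eps He; exists 1; split; [lra|]; intros w _.
  replace (c - c - 0 * (w - z))%C with (RtoC 0) by ring.
  rewrite Cmod_0; apply Rmult_le_pos; [lra|apply Cmod_ge_0].
Qed.

Lemma cderiv_id (z : C) : cderiv (fun w => w) z 1.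
Proof.
  intros eps He; exists 1; split; [lra|]; intros w _.
  replace (w - z - 1 * (w - z))%C with (RtoC 0) by ring.
  rewrite Cmod_0; apply Rmult_le_pos; [lra|apply Cmod_ge_0].
Qed.

Lemma cderiv_plus (f g : C -> C) (z a b : C) :
  cderiv f z a -> cderiv g z b -> cderiv (fun w => f w + g w)%C z (a + b)%C.
Proof.
  intros Hf Hg; apply cderiv_is_derive_abs; apply cderiv_is_derive_abs in Hf, Hg.
  exact (is_derive_plus _ _ _ _ _ Hf Hg).
Qed.

Lemma cderiv_mult (f g : C -> C) (z a b : C) :
  cderiv f z a -> cderiv g z b ->
  cderiv (fun w => f w * g w)%C z (a * g z + f z * b)%C.
Proof.
  intros Hf Hg; apply cderiv_is_derive_abs; apply cderiv_is_derive_abs in Hf, Hg.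
  exact (is_derive_mult _ _ _ _ _ Hf Hg Cmult_comm).
Qed.

Lemma cderiv_comp (f g : C -> C) (z a b : C) :
  cderiv f (g z) a -> cderiv g z b -> cderiv (fun w => f (g w)) z (a * b)%C.
Proof.
  intros Hf Hg; apply cderiv_is_derive_abs; apply cderiv_is_derive_abs in Hf, Hg.
  rewrite Cmult_comm.
  exact (is_derive_comp _ _ _ _ _ Hf Hg).
Qed.

Lemma cderiv_scal (c : C) (g : C -> C) (z l : C) :
  cderiv g z l -> cderiv (fun w => c * g w)%C z (c * l)%C.
Proof.
  intros H.
  refine (cderiv_eq _ _ _ _ (cderiv_mult _ _ _ _ _ (cderiv_const c z) H) _); ring.
Qed.

Lemma cderiv_minus (f g : C -> C) (z a b : C) :
  cderiv f z a -> cderiv g z b -> cderiv (fun w => f w - g w)%C z (a - b)%C.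
Proof.
  intros Hf Hg; apply cderiv_is_derive_abs; apply cderiv_is_derive_abs in Hf, Hg.
  exact (is_derive_minus _ _ _ _ _ Hf Hg).
Qed.

Lemma cderiv_ext (f g : C -> C) (z l : C) (r : R) :
  0 < r -> (forall w, cball z r w -> f w = g w) -> cderiv f z l -> cderiv g z l.
Proof.
  intros Hr E H eps He; destruct (H eps He) as [dl [Hd Hw]].
  exists (Rmin dl r); split; [apply Rmin_pos; assumption|]; intros w Hlt.
  rewrite <- (E w), <- (E z).
  - apply Hw; eapply Rlt_le_trans; [exact Hlt|apply Rmin_l].
  - unfold cball; replace (z - z)%C with (RtoC 0) by ring; rewrite Cmod_0; exact Hr.
  - eapply Rlt_le_trans; [exact Hlt|apply Rmin_r].
Qed.

Lemma cderiv_ccont (g : C -> C) (z l : C) : cderiv g z l -> ccont g z.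
Proof.
  intros H eps He; destruct (H 1 Rlt_0_1) as [dl [Hd Hw]].
  assert (HK : 0 < 1 + Cmod l) by (pose proof (Cmod_ge_0 l); lra).
  exists (Rmin dl (eps / (1 + Cmod l))); split.
  { apply Rmin_pos; [exact Hd|]; apply Rdiv_lt_0_compat; assumption. }
  intros w Hlt.
  assert (H1 := Hw w (Rlt_le_trans _ _ _ Hlt (Rmin_l _ _))).
  assert (H2 := Rlt_le_trans _ _ _ Hlt (Rmin_r _ _)).
  replace (g w - g z)%C with ((g w - g z - l * (w - z)) + l * (w - z))%C by ring.
  eapply Rle_lt_trans; [apply Cmod_triangle|].
  rewrite Cmod_mult.
  apply (Rmult_lt_compat_r _ _ _ HK) in H2.
  replace (eps / (1 + Cmod l) * (1 + Cmod l)) with eps in H2 by (field; lra).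
  lra.
Qed.

Lemma Cmod_minus_sym (a b : C) : Cmod (a - b) = Cmod (b - a).
Proof. rewrite <- Cmod_opp; f_equal; ring. Qed.

Lemma Cmod_rev_triangle (a b : C) : Cmod a - Cmod b <= Cmod (a - b).
Proof.
  pose proof (Cmod_triangle (a - b) b) as H.
  replace (a - b + b)%C with a in H by ring; lra.
Qed.

Lemma cderiv_inv (z : C) : z <> 0 -> cderiv (fun w => / w)%C z (- / (z * z))%C.
Proof.
  intros Hz eps He.
  assert (Hm : 0 < Cmod z) by (apply Cmod_gt_0; exact Hz).
  (* The error is [(w - z)^2 / (z^2 w)]. The first bound keeps [|w| > |z| / 2]; the second then
     makes [|w - z| / (|z|^2 |w|)] at most [eps]. *)
  exists (Rmin (Cmod z / 2) (eps * (Cmod z ^ 3) / 2)); split.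
  { apply Rmin_pos; [lra|].
    assert (0 < Cmod z ^ 3) by (apply pow_lt; exact Hm).
    apply Rdiv_lt_0_compat; [apply Rmult_lt_0_compat|]; lra. }
  intros w Hlt.
  assert (H1 := Rlt_le_trans _ _ _ Hlt (Rmin_l _ _)).
  assert (H2 := Rlt_le_trans _ _ _ Hlt (Rmin_r _ _)).
  assert (Hw : Cmod z / 2 < Cmod w).
  { pose proof (Cmod_rev_triangle z w) as H; rewrite Cmod_minus_sym in H; lra. }
  assert (Hw0 : w <> 0) by (apply Cmod_gt_0; lra).
  replace (/ w - / z - - / (z * z) * (w - z))%C
    with ((w - z) * ((w - z) * / (z * z * w)))%C by (field; auto).
  rewrite (Cmod_mult (w - z)), Rmult_comm.
  apply Rmult_le_compat_r; [apply Cmod_ge_0|].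
  rewrite Cmod_mult, Cmod_inv by (repeat apply Cmult_neq_0; assumption).
  rewrite !Cmod_mult.
  assert (Hp : 0 < Cmod z * Cmod z) by (apply Rmult_lt_0_compat; exact Hm).
  apply (Rmult_le_reg_r (Cmod z * Cmod z * Cmod w)); [apply Rmult_lt_0_compat; lra|].
  rewrite Rmult_assoc, Rinv_l by (apply Rgt_not_eq; apply Rmult_lt_0_compat; lra).
  assert (eps * (Cmod z ^ 3) / 2 <= eps * (Cmod z * Cmod z * Cmod w)); [|lra].
  replace (eps * (Cmod z ^ 3) / 2) with (eps * (Cmod z * Cmod z) * (Cmod z / 2)) by field.
  replace (eps * (Cmod z * Cmod z * Cmod w)) with (eps * (Cmod z * Cmod z) * Cmod w) by ring.
  apply Rmult_le_compat_l; [apply Rmult_le_pos|]; lra.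
Qed.

Lemma cderiv_unique (g : C -> C) (z a b : C) : cderiv g z a -> cderiv g z b -> a = b.
Proof.
  intros Ha Hb; apply cderiv_is_derive in Ha, Hb.
  apply is_C_derive_unique in Ha, Hb; congruence.
Qed.

Lemma Cmod_le_abs (z : C) : Cmod z <= Rabs (Re z) + Rabs (Im z).
Proof.
  destruct z as [x y].
  replace ((x, y) : C) with (RtoC x + RtoC y * Ci)%C
    by (apply injective_projections; simpl; ring).
  eapply Rle_trans; [apply Cmod_triangle|].
  rewrite Cmod_mult, Cmod_Ci, !Cmod_R, Rmult_1_r; simpl.
  apply Req_le; f_equal; f_equal; ring.
Qed.

Lemma im_le_Cmod (z : C) : Rabs (Im z) <= Cmod z.
Proof.
  eapply Rle_trans; [|apply Rmax_Cmod]; apply Rmax_r.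
Qed.

(** The partials [a, - b] of [u] and [b, a] of [v] are the Cauchy-Riemann equations. Real
    differentiability bounds each component of the error by [eps / 2] times the maximum norm of the
    increment, which is at most its [Cmod]. *)
Lemma cderiv_of_CR (u v : R -> R -> R) (x y a b : R) :
  differentiable_pt_lim u x y a (- b) -> differentiable_pt_lim v x y b a ->
  cderiv (fun z => (u (fst z) (snd z), v (fst z) (snd z))) (x, y) (a, b).
Proof.
  intros Hu Hv eps He.
  assert (He2 : 0 < eps / 2) by lra.
  destruct (Hu (mkposreal _ He2)) as [d1 H1]; destruct (Hv (mkposreal _ He2)) as [d2 H2].
  exists (Rmin d1 d2); split; [apply Rmin_pos; apply cond_pos|].
  intros [s t] Hlt; simpl in H1, H2.
  assert (Hs : Rabs (s - x) <= Cmod ((s, t) - (x, y)))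
    by exact (re_le_Cmod ((s, t) - (x, y))).
  assert (Ht : Rabs (t - y) <= Cmod ((s, t) - (x, y)))
    by exact (im_le_Cmod ((s, t) - (x, y))).
  pose proof (Rmin_l d1 d2); pose proof (Rmin_r d1 d2).
  specialize (H1 s t ltac:(lra) ltac:(lra)); specialize (H2 s t ltac:(lra) ltac:(lra)).
  eapply Rle_trans; [apply Cmod_le_abs|].
  assert (Hm : Rmax (Rabs (s - x)) (Rabs (t - y)) <= Cmod ((s, t) - (x, y)))
    by (apply Rmax_lub; assumption).
  apply (Rmult_le_compat_l (eps / 2)) in Hm; [|lra].
  replace (Re _) with (u s t - u x y - (a * (s - x) + - b * (t - y))) by (simpl; ring).
  replace (Im _) with (v s t - v x y - (b * (s - x) + a * (t - y))) by (simpl; ring).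
  lra.
Qed.

(** * Integrals of complex-valued functions of a real variable *)

Definition CInt (f : R -> C) (a b : R) : C := @RInt C_R_CompleteNormedModule f a b.
Definition ccurve (f : R -> C) (t : R) : Prop := @continuous R_UniformSpace C_UniformSpace f t.

(** Balls of the uniform structure on [C] are squares, hence a factor [sqrt 2], rounded up to
    [2]. *)
Lemma Cmod_lt_of_ball (z w : C) (r : posreal) : ball z r w -> Cmod (w - z) < 2 * r.
Proof.
  intros H; apply C_NormedModule_mixin_compat2 in H.
  change (Cmod (w - z) < sqrt 2 * r) in H.
  assert (sqrt 2 < 2).
  { replace 2 with (sqrt (2 * 2)) at 2 by (apply sqrt_square; lra).
    apply sqrt_lt_1; lra. }
  pose proof (cond_pos r); nra.
Qed.

Lemma ccont_continuous (g : C -> C) (z : C) :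
  ccont g z <-> @continuous C_UniformSpace C_UniformSpace g z.
Proof.
  split.
  - intros H; apply filterlim_locally; intros eps.
    destruct (H eps (cond_pos eps)) as [dl [Hd Hw]].
    assert (Hd2 : 0 < dl / 2) by lra.
    exists (mkposreal _ Hd2); intros w Hb.
    apply C_NormedModule_mixin_compat1; apply Hw.
    apply Cmod_lt_of_ball in Hb; simpl in Hb; lra.
  - intros H eps He.
    assert (He2 : 0 < eps / 2) by lra.
    apply filterlim_locally with (eps := mkposreal _ He2) in H; destruct H as [dl Hd].
    exists dl; split; [apply cond_pos|]; intros w Hw.
    specialize (Hd w (C_NormedModule_mixin_compat1 z w dl Hw)).
    apply Cmod_lt_of_ball in Hd; simpl in Hd; lra.
Qed.

Lemma ccurve_pair (u v : R -> R) (t : R) :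
  continuous u t -> continuous v t -> ccurve (fun s => (u s, v s)) t.
Proof.
  intros Hu Hv; apply filterlim_locally; intros eps.
  assert (Hu' := proj1 (filterlim_locally _ _) Hu eps).
  assert (Hv' := proj1 (filterlim_locally _ _) Hv eps).
  generalize (filter_and _ _ Hu' Hv'); apply filter_imp; intros s [A B]; split; assumption.
Qed.

Lemma ccurve_re (f : R -> C) (t : R) : ccurve f t -> continuous (fun s => Re (f s)) t.
Proof.
  intros H; apply filterlim_locally; intros eps.
  generalize (proj1 (filterlim_locally _ _) H eps); apply filter_imp; intros s [A B]; exact A.
Qed.

Lemma ccurve_im (f : R -> C) (t : R) : ccurve f t -> continuous (fun s => Im (f s)) t.
Proof.
  intros H; apply filterlim_locally; intros eps.
  generalize (proj1 (filterlim_locally _ _) H eps); apply filter_imp; intros s [A B]; exact B.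
Qed.

Lemma ccurve_comp (g : C -> C) (f : R -> C) (t : R) :
  ccurve f t -> ccont g (f t) -> ccurve (fun s => g (f s)) t.
Proof.
  intros Hf Hg; apply ccont_continuous in Hg.
  exact (continuous_comp (U := R_UniformSpace) (V := C_UniformSpace) (W := C_UniformSpace)
    f g t Hf Hg).
Qed.

Lemma ccurve_mult (f g : R -> C) (t : R) :
  ccurve f t -> ccurve g t -> ccurve (fun s => f s * g s)%C t.
Proof.
  intros Hf Hg; apply ccurve_pair.
  - apply (continuous_minus (V := R_NormedModule) (fun s => Re (f s) * Re (g s)) (fun s => Im (f s) * Im (g s)));
      apply (continuous_mult (K := R_AbsRing)); auto using ccurve_re, ccurve_im.
  - apply (continuous_plus (V := R_NormedModule) (fun s => Re (f s) * Im (g s)) (fun s => Im (f s) * Re (g s)));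
      apply (continuous_mult (K := R_AbsRing)); auto using ccurve_re, ccurve_im.
Qed.

Lemma ccurve_plus (f g : R -> C) (t : R) :
  ccurve f t -> ccurve g t -> ccurve (fun s => f s + g s)%C t.
Proof.
  intros Hf Hg; exact (continuous_plus (V := C_R_NormedModule) f g t Hf Hg).
Qed.

Lemma ccurve_minus (f g : R -> C) (t : R) :
  ccurve f t -> ccurve g t -> ccurve (fun s => f s - g s)%C t.
Proof.
  intros Hf Hg; exact (continuous_minus (V := C_R_NormedModule) f g t Hf Hg).
Qed.

Lemma ccurve_const (c : C) (t : R) : ccurve (fun _ => c) t.
Proof. apply continuous_const. Qed.

Lemma ccurve_RtoC (u : R -> R) (t : R) : continuous u t -> ccurve (fun s => RtoC (u s)) t.
Proof. intros H; apply ccurve_pair; [exact H|apply continuous_const]. Qed.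

Lemma ccurve_conj (f : R -> C) (t : R) : ccurve f t -> ccurve (fun s => Cconj (f s)) t.
Proof.
  intros H; apply ccurve_pair; [exact (ccurve_re f t H)|].
  apply (continuous_opp (V := R_NormedModule)); exact (ccurve_im f t H).
Qed.

Lemma ex_CInt (f : R -> C) (a b : R) :
  a <= b -> (forall t, a <= t <= b -> ccurve f t) -> @ex_RInt C_R_NormedModule f a b.
Proof.
  intros Hab H; apply (ex_RInt_continuous (V := C_R_CompleteNormedModule)).
  intros t; rewrite Rmin_left, Rmax_right by assumption; intros Ht.
  apply H; exact Ht.
Qed.

Lemma is_CInt (f : R -> C) (a b : R) :
  a <= b -> (forall t, a <= t <= b -> ccurve f t) ->
  @is_RInt C_R_NormedModule f a b (CInt f a b).
Proof.
  intros Hab H; apply (RInt_correct (V := C_R_CompleteNormedModule)).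
  apply ex_CInt; assumption.
Qed.

Lemma is_RInt_pair (f : R -> C) (a b : R) (l : C) :
  @is_RInt C_R_NormedModule f a b l <->
  is_RInt (fun t => Re (f t)) a b (Re l) /\ is_RInt (fun t => Im (f t)) a b (Im l).
Proof.
  split.
  - intros H; split.
    + exact (is_RInt_fct_extend_fst (U := R_NormedModule) (V := R_NormedModule) f a b l H).
    + exact (is_RInt_fct_extend_snd (U := R_NormedModule) (V := R_NormedModule) f a b l H).
  - intros [H1 H2]. destruct l as [l1 l2].
    exact (is_RInt_fct_extend_pair (U := R_NormedModule) (V := R_NormedModule) f a b l1 l2 H1 H2).
Qed.

Lemma CInt_unique (f : R -> C) (a b : R) (l : C) :
  @is_RInt C_R_NormedModule f a b l -> CInt f a b = l.
Proof. exact (is_RInt_unique (V := C_R_CompleteNormedModule) f a b l). Qed.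

Lemma CInt_re_im (f : R -> C) (a b : R) :
  a <= b -> (forall t, a <= t <= b -> ccurve f t) ->
  CInt f a b = (RInt (fun t => Re (f t)) a b, RInt (fun t => Im (f t)) a b).
Proof.
  intros Hab H; pose proof (is_CInt f a b Hab H) as I; apply is_RInt_pair in I.
  destruct I as [I1 I2].
  apply (is_RInt_unique (V := R_CompleteNormedModule)) in I1, I2.
  rewrite I1, I2; apply surjective_pairing.
Qed.

Lemma CInt_ext (f g : R -> C) (a b : R) :
  a <= b -> (forall t, a <= t <= b -> f t = g t) -> CInt f a b = CInt g a b.
Proof.
  intros Hab H; apply (RInt_ext (V := C_R_CompleteNormedModule)).
  intros t; rewrite Rmin_left, Rmax_right by assumption; intros Ht; apply H; lra.
Qed.

Lemma CInt_plus (f g : R -> C) (a b : R) :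
  a <= b -> (forall t, a <= t <= b -> ccurve f t) -> (forall t, a <= t <= b -> ccurve g t) ->
  CInt (fun t => f t + g t)%C a b = (CInt f a b + CInt g a b)%C.
Proof.
  intros Hab Hf Hg; apply (RInt_plus (V := C_R_CompleteNormedModule)); apply ex_CInt; assumption.
Qed.

Lemma CInt_minus (f g : R -> C) (a b : R) :
  a <= b -> (forall t, a <= t <= b -> ccurve f t) -> (forall t, a <= t <= b -> ccurve g t) ->
  CInt (fun t => f t - g t)%C a b = (CInt f a b - CInt g a b)%C.
Proof.
  intros Hab Hf Hg; apply (RInt_minus (V := C_R_CompleteNormedModule)); apply ex_CInt; assumption.
Qed.

(** The integral takes values in a real module, so linearity over complex scalars has to be
    recovered from the components. *)
Lemma CInt_scal (c : C) (f : R -> C) (a b : R) :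
  a <= b -> (forall t, a <= t <= b -> ccurve f t) ->
  CInt (fun t => c * f t)%C a b = (c * CInt f a b)%C.
Proof.
  intros Hab Hf; apply CInt_unique, is_RInt_pair.
  pose proof (is_CInt f a b Hab Hf) as I; apply is_RInt_pair in I; destruct I as [I1 I2].
  split.
  - exact (is_RInt_minus _ _ _ _ _ _ (is_RInt_scal _ _ _ (Re c) _ I1) (is_RInt_scal _ _ _ (Im c) _ I2)).
  - exact (is_RInt_plus _ _ _ _ _ _ (is_RInt_scal _ _ _ (Re c) _ I2) (is_RInt_scal _ _ _ (Im c) _ I1)).
Qed.

Lemma CInt_conj (f : R -> C) (a b : R) :
  a <= b -> (forall t, a <= t <= b -> ccurve f t) ->
  CInt (fun t => Cconj (f t)) a b = Cconj (CInt f a b).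
Proof.
  intros Hab Hf; apply CInt_unique, is_RInt_pair.
  pose proof (is_CInt f a b Hab Hf) as I; apply is_RInt_pair in I; destruct I as [I1 I2].
  split; [exact I1|exact (is_RInt_opp _ _ _ _ I2)].
Qed.

Lemma CInt_Chasles (f : R -> C) (a b c : R) :
  a <= b <= c -> (forall t, a <= t <= c -> ccurve f t) ->
  CInt f a c = (CInt f a b + CInt f b c)%C.
Proof.
  intros [Hab Hbc] H; symmetry; apply (RInt_Chasles (V := C_R_CompleteNormedModule));
    apply ex_CInt; auto; intros t Ht; apply H; lra.
Qed.

Lemma CInt_RtoC (u : R -> R) (a b : R) :
  a <= b -> (forall t, a <= t <= b -> continuous u t) ->
  CInt (fun t => RtoC (u t)) a b = RtoC (RInt u a b).
Proof.
  intros Hab H; rewrite CInt_re_im; [|exact Hab|intros t Ht; apply ccurve_RtoC, H, Ht].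
  unfold RtoC; f_equal.
  change (RInt (fun _ => 0) a b = 0); rewrite RInt_const; exact (Rmult_0_r _).
Qed.

Lemma Cmod_norm_R (z : C) : @norm R_AbsRing C_R_NormedModule z = Cmod z.
Proof.
  change (sqrt (Rabs (fst z) ^ 2 + Rabs (snd z) ^ 2) = Cmod z).
  unfold Cmod; rewrite !pow2_abs; reflexivity.
Qed.

Lemma CInt_norm (f : R -> C) (phi : R -> R) (a b : R) :
  a <= b -> (forall t, a <= t <= b -> ccurve f t) -> ex_RInt phi a b ->
  (forall t, a <= t <= b -> Cmod (f t) <= phi t) -> Cmod (CInt f a b) <= RInt phi a b.
Proof.
  intros Hab Hf [l Hl] H.
  rewrite (is_RInt_unique _ _ _ _ Hl).
  rewrite <- Cmod_norm_R.
  refine (norm_RInt_le (V := C_R_NormedModule) f phi a b _ _ Hab _ (is_CInt f a b Hab Hf) Hl).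
  intros x Hx; rewrite Cmod_norm_R; exact (H x Hx).
Qed.

Lemma CInt_norm_const (f : R -> C) (M a b : R) :
  a <= b -> (forall t, a <= t <= b -> ccurve f t) ->
  (forall t, a <= t <= b -> Cmod (f t) <= M) -> Cmod (CInt f a b) <= M * (b - a).
Proof.
  intros Hab Hf H.
  pose proof (CInt_norm f (fun _ => M) a b Hab Hf (ex_RInt_const a b M) H) as H1.
  rewrite RInt_const in H1; change (scal (b - a) M) with ((b - a) * M) in H1; lra.
Qed.

Lemma CInt_affine (p q : C) (a b : R) :
  a <= b ->
  CInt (fun x => p + q * RtoC x)%C a b = (p * RtoC (b - a) + q * RtoC ((b * b - a * a) / 2))%C.
Proof.
  intros Hab.
  assert (Hc : forall t, a <= t <= b -> continuous (fun x : R => x) t) by (intros; apply continuous_id).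
  rewrite CInt_plus; auto.
  2: intros; apply ccurve_const.
  2: intros; apply ccurve_mult; [apply ccurve_const|apply ccurve_RtoC, continuous_id].
  rewrite CInt_scal; auto.
  2: intros; apply ccurve_RtoC, continuous_id.
  rewrite CInt_RtoC by auto.
  f_equal.
  - unfold CInt; rewrite (RInt_const (V := C_R_CompleteNormedModule)).
    transitivity (RtoC (b - a) * p)%C; [exact (scal_R_Cmult (b - a) p)|ring].
  - do 2 f_equal; apply is_RInt_unique.
    replace ((b * b - a * a) / 2) with (minus (b * b / 2) (a * a / 2))
      by (unfold minus, plus, opp; simpl; field).
    apply (is_RInt_derive (V := R_CompleteNormedModule) (fun x => x * x / 2)).
    + intros x _; auto_derive; [trivial|field].
    + intros x _; apply continuous_id.
Qed.

(** * Goursat's theorem on rectangles *)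

(* The integral of [F dz] along the boundary of [a,b] x [c,d], counterclockwise. *)
Definition rect_int (F : C -> C) (a b c d : R) : C :=
  (CInt (fun x => F (x, c)) a b - CInt (fun x => F (x, d)) a b
   + Ci * (CInt (fun y => F (b, y)) c d - CInt (fun y => F (a, y)) c d))%C.

Definition rect_cont (F : C -> C) (a b c d : R) : Prop :=
  forall x y, a <= x <= b -> c <= y <= d -> ccont F (x, y).

Lemma ccurve_hor (F : C -> C) (x y : R) : ccont F (x, y) -> ccurve (fun s => F (s, y)) x.
Proof.
  intros H; apply (ccurve_comp F (fun s => (s, y))); [|exact H].
  apply ccurve_pair; [apply continuous_id|apply continuous_const].
Qed.

Lemma ccurve_ver (F : C -> C) (x y : R) : ccont F (x, y) -> ccurve (fun s => F (x, s)) y.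
Proof.
  intros H; apply (ccurve_comp F (fun s => (x, s))); [|exact H].
  apply ccurve_pair; [apply continuous_const|apply continuous_id].
Qed.

(** Each inner edge is traversed twice in opposite directions and cancels; only the outer edges have
    to be cut. *)
Lemma rect_int_split (F : C -> C) (a m b c n d : R) :
  a <= m <= b -> c <= n <= d -> rect_cont F a b c d ->
  rect_int F a b c d =
    (rect_int F a m c n + rect_int F m b c n + rect_int F a m n d + rect_int F m b n d)%C.
Proof.
  intros Hm Hn H; unfold rect_int.
  rewrite (CInt_Chasles (fun x => F (x, c)) a m b), (CInt_Chasles (fun x => F (x, d)) a m b),
    (CInt_Chasles (fun y => F (a, y)) c n d), (CInt_Chasles (fun y => F (b, y)) c n d); auto.
  - ring.
  - intros; apply ccurve_ver, H; lra.
  - intros; apply ccurve_ver, H; lra.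
  - intros; apply ccurve_hor, H; lra.
  - intros; apply ccurve_hor, H; lra.
Qed.

Lemma rect_int_affine (p q : C) (a b c d : R) :
  a <= b -> c <= d -> rect_int (fun z => p + q * z)%C a b c d = 0.
Proof.
  intros Hab Hcd; unfold rect_int.
  assert (Hh : forall y, CInt (fun x => p + q * (x, y))%C a b
    = CInt (fun x => (p + q * (Ci * RtoC y)) + q * RtoC x)%C a b).
  { intros y; apply CInt_ext; [exact Hab|]; intros x _.
    replace ((x, y) : C) with (RtoC x + Ci * RtoC y)%C
      by (apply injective_projections; simpl; ring); ring. }
  assert (Hv : forall x, CInt (fun y => p + q * (x, y))%C c d
    = CInt (fun y => (p + q * RtoC x) + (q * Ci) * RtoC y)%C c d).
  { intros x; apply CInt_ext; [exact Hcd|]; intros y _.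
    replace ((x, y) : C) with (RtoC x + Ci * RtoC y)%C
      by (apply injective_projections; simpl; ring); ring. }
  rewrite !Hh, !Hv, !CInt_affine by assumption.
  rewrite !RtoC_minus; ring.
Qed.

Lemma ccont_affine (p q z : C) : ccont (fun w => p + q * w)%C z.
Proof.
  refine (cderiv_ccont _ _ _ (cderiv_plus (fun _ => p) (fun w => q * w)%C _ _ _ (cderiv_const p z) _)).
  apply cderiv_scal, cderiv_id.
Qed.

Lemma ccont_minus (f g : C -> C) (z : C) :
  ccont f z -> ccont g z -> ccont (fun w => f w - g w)%C z.
Proof.
  intros Hf Hg; apply ccont_continuous in Hf, Hg; apply ccont_continuous.
  exact (continuous_minus (U := C_UniformSpace) (V := C_R_NormedModule) f g z Hf Hg).
Qed.

Lemma rect_int_minus (F A : C -> C) (a b c d : R) :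
  a <= b -> c <= d -> rect_cont F a b c d -> rect_cont A a b c d ->
  rect_int (fun z => F z - A z)%C a b c d = (rect_int F a b c d - rect_int A a b c d)%C.
Proof.
  intros Hab Hcd HF HA; unfold rect_int.
  rewrite (CInt_minus (fun x => F (x, c)) (fun x => A (x, c))),
    (CInt_minus (fun x => F (x, d)) (fun x => A (x, d))),
    (CInt_minus (fun y => F (a, y)) (fun y => A (a, y))),
    (CInt_minus (fun y => F (b, y)) (fun y => A (b, y))); auto.
  ring.
  all: intros; (apply ccurve_ver || apply ccurve_hor); (apply HF || apply HA); lra.
Qed.

Lemma rect_int_norm (F : C -> C) (M a b c d : R) :
  a <= b -> c <= d -> rect_cont F a b c d ->
  (forall x y, a <= x <= b -> c <= y <= d -> Cmod (F (x, y)) <= M) ->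
  Cmod (rect_int F a b c d) <= 2 * M * ((b - a) + (d - c)).
Proof.
  intros Hab Hcd H HM; unfold rect_int.
  eapply Rle_trans; [apply Cmod_triangle|].
  rewrite Cmod_mult, Cmod_Ci, Rmult_1_l.
  assert (T : forall u v : C, Cmod (u - v) <= Cmod u + Cmod v).
  { intros u v; rewrite <- (Cmod_opp v); apply Cmod_triangle. }
  pose proof (T (CInt (fun x => F (x, c)) a b) (CInt (fun x => F (x, d)) a b)).
  pose proof (T (CInt (fun y => F (b, y)) c d) (CInt (fun y => F (a, y)) c d)).
  assert (Cmod (CInt (fun x => F (x, c)) a b) <= M * (b - a))
    by (apply CInt_norm_const; auto; intros; [apply ccurve_hor, H|apply HM]; lra).
  assert (Cmod (CInt (fun x => F (x, d)) a b) <= M * (b - a))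
    by (apply CInt_norm_const; auto; intros; [apply ccurve_hor, H|apply HM]; lra).
  assert (Cmod (CInt (fun y => F (a, y)) c d) <= M * (d - c))
    by (apply CInt_norm_const; auto; intros; [apply ccurve_ver, H|apply HM]; lra).
  assert (Cmod (CInt (fun y => F (b, y)) c d) <= M * (d - c))
    by (apply CInt_norm_const; auto; intros; [apply ccurve_ver, H|apply HM]; lra).
  lra.
Qed.

(** Subtracting the affine approximation at [z] leaves the integral unchanged. What remains is at
    most [eps] times the half perimeter pointwise, and it is integrated over twice the half
    perimeter. *)
Lemma rect_int_small (F : C -> C) (z l : C) (eps delta a b c d : R) :
  0 <= eps -> a <= fst z <= b -> c <= snd z <= d -> rect_cont F a b c d ->
  (forall w, Cmod (w - z) < delta -> Cmod (F w - F z - l * (w - z)) <= eps * Cmod (w - z)) ->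
  (b - a) + (d - c) < delta ->
  Cmod (rect_int F a b c d) <= 2 * eps * ((b - a) + (d - c)) ^ 2.
Proof.
  intros He Hx Hy HF H Hd.
  set (A := fun w => ((F z - l * z) + l * w)%C).
  assert (HA : rect_cont A a b c d) by (intros x y _ _; apply ccont_affine).
  replace (rect_int F a b c d) with (rect_int (fun w => F w - A w)%C a b c d).
  2: { rewrite rect_int_minus by (auto; lra).
       unfold A; rewrite rect_int_affine by lra; ring. }
  replace (2 * eps * ((b - a) + (d - c)) ^ 2)
    with (2 * (eps * ((b - a) + (d - c))) * ((b - a) + (d - c))) by ring.
  apply rect_int_norm; try lra.
  - intros x y H1 H2; apply ccont_minus; auto.
  - intros x y H1 H2.
    assert (Hm : Cmod ((x, y) - z) <= (b - a) + (d - c)).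
    { eapply Rle_trans; [apply Cmod_le_abs|].
      apply Rplus_le_compat; apply Rabs_le; destruct z; simpl in *; lra. }
    replace (F (x, y) - A (x, y))%C with (F (x, y) - F z - l * ((x, y) - z))%C
      by (unfold A; ring).
    eapply Rle_trans; [apply H; lra|].
    apply Rmult_le_compat_l; assumption.
Qed.

Lemma nested_intervals (x w : nat -> R) :
  (forall n, 0 <= w n) -> (forall n, x n <= x (S n)) ->
  (forall n, x (S n) + w (S n) <= x n + w n) ->
  exists l, forall n, x n <= l <= x n + w n.
Proof.
  intros Hw Hx Hy.
  assert (Mx : forall n k, x n <= x (n + k)%nat).
  { intros n k; induction k as [|k IH]; [rewrite Nat.add_0_r; lra|].
    rewrite Nat.add_succ_r; specialize (Hx (n + k)%nat); lra. }
  assert (My : forall n k, x (n + k)%nat + w (n + k)%nat <= x n + w n).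
  { intros n k; induction k as [|k IH]; [rewrite Nat.add_0_r; lra|].
    rewrite Nat.add_succ_r; specialize (Hy (n + k)%nat); lra. }
  assert (B : forall n m, x n <= x m + w m).
  { intros n m; specialize (Mx n m); specialize (My m n).
    rewrite Nat.add_comm in My; specialize (Hw (n + m)%nat); lra. }
  destruct (completeness (fun r => exists n, r = x n)) as [l [H1 H2]].
  - exists (x O + w O); intros r [n ->]; apply B.
  - exists (x O), O; reflexivity.
  - exists l; intros n; split; [apply H1; exists n; reflexivity|].
    apply H2; intros r [m ->]; apply B.
Qed.

Lemma goursat_rectangle (F : C -> C) (a b c d : R) :
  a <= b -> c <= d ->
  (forall x y, a <= x <= b -> c <= y <= d -> exists l, cderiv F (x, y) l) ->
  rect_int F a b c d = 0.
Proof.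
  intros Hab Hcd HF.
  assert (HC : rect_cont F a b c d).
  { intros x y Hx Hy; destruct (HF x y Hx Hy) as [l Hl]; exact (cderiv_ccont _ _ _ Hl). }
  destruct (Ceq_dec (rect_int F a b c d) 0) as [E|NE]; [exact E|exfalso].
  set (K := Cmod (rect_int F a b c d)).
  assert (HK : 0 < K) by (apply Cmod_gt_0; exact NE).
  set (W := fun n => (b - a) * (/ 2) ^ n); set (V := fun n => (d - c) * (/ 2) ^ n).
  assert (Hp : forall n, 0 < (/ 2) ^ n) by (intros n; apply pow_lt; lra).
  assert (HW : forall n, 0 <= W n)
    by (intros n; apply Rmult_le_pos; [lra|apply Rlt_le, Hp]).
  assert (HV : forall n, 0 <= V n)
    by (intros n; apply Rmult_le_pos; [lra|apply Rlt_le, Hp]).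
  assert (SW : forall n, W n = 2 * W (S n)) by (intros n; unfold W; simpl; field).
  assert (SV : forall n, V n = 2 * V (S n)) by (intros n; unfold V; simpl; field).
  (* The state is the lower left corner [p] of the current rectangle, whose sides [W n] and [V n]
     depend on [n] only; its integral keeps at least the share [4^(-n)] of [K]. *)
  set (inv := fun n (p : R * R) =>
    (a <= fst p /\ fst p + W n <= b /\ c <= snd p /\ snd p + V n <= d) /\
    K * (/ 4) ^ n <= Cmod (rect_int F (fst p) (fst p + W n) (snd p) (snd p + V n))).
  assert (step : forall n (s : {p | inv n p}), exists s' : {p | inv (S n) p},
    (fst (proj1_sig s) <= fst (proj1_sig s') /\
     fst (proj1_sig s') + W (S n) <= fst (proj1_sig s) + W n) /\
    (snd (proj1_sig s) <= snd (proj1_sig s') /\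
     snd (proj1_sig s') + V (S n) <= snd (proj1_sig s) + V n)).
  { intros n [[x y] [[I1 [I2 [I3 I4]]] I5]]; simpl in I1, I2, I3, I4, I5; simpl.
    pose proof (HW (S n)) as w0; pose proof (HV (S n)) as v0.
    rewrite (SW n) in I2, I5; rewrite (SV n) in I4, I5.
    rewrite (SW n), (SV n).
    rewrite (rect_int_split F x (x + W (S n)) (x + 2 * W (S n)) y (y + V (S n)) (y + 2 * V (S n)))
      in I5; try lra.
    2: { intros u v Hu Hv; apply HC; lra. }
    set (I00 := rect_int F x (x + W (S n)) y (y + V (S n))) in *.
    set (I10 := rect_int F (x + W (S n)) (x + 2 * W (S n)) y (y + V (S n))) in *.
    set (I01 := rect_int F x (x + W (S n)) (y + V (S n)) (y + 2 * V (S n))) in *.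
    set (I11 := rect_int F (x + W (S n)) (x + 2 * W (S n)) (y + V (S n)) (y + 2 * V (S n))) in *.
    assert (T := Cmod_triangle (I00 + I10 + I01) I11).
    assert (T2 := Cmod_triangle (I00 + I10) I01).
    assert (T3 := Cmod_triangle I00 I10).
    assert (E4 : K * (/ 4) ^ n = 4 * (K * (/ 4) ^ S n)) by (simpl; field).
    rewrite E4 in I5.
    set (k := K * (/ 4) ^ S n) in *.
    assert (ex_W : x + W (S n) + W (S n) = x + 2 * W (S n)) by ring.
    assert (ex_V : y + V (S n) + V (S n) = y + 2 * V (S n)) by ring.
    (* If three quarters fall below [k], the triangle inequality forces the fourth to reach it. *)
    destruct (Rle_dec k (Cmod I00)) as [D|D].
    { assert (J : inv (S n) (x, y)) by (split; simpl; [repeat split; lra|exact D]).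
      exists (exist _ _ J); cbn [fst snd proj1_sig]; repeat split; lra. }
    destruct (Rle_dec k (Cmod I10)) as [D1|D1].
    { assert (J : inv (S n) (x + W (S n), y)).
      { split; cbn [fst snd]; [repeat split; lra|]. rewrite ex_W; exact D1. }
      exists (exist _ _ J); cbn [fst snd proj1_sig]; repeat split; lra. }
    destruct (Rle_dec k (Cmod I01)) as [D2|D2].
    { assert (J : inv (S n) (x, y + V (S n))).
      { split; cbn [fst snd]; [repeat split; lra|]. rewrite ex_V; exact D2. }
      exists (exist _ _ J); cbn [fst snd proj1_sig]; repeat split; lra. }
    assert (J : inv (S n) (x + W (S n), y + V (S n))).
    { split; cbn [fst snd]; [repeat split; lra|]. rewrite ex_V, ex_W. fold I11 k. lra. }
    exists (exist _ _ J); cbn [fst snd proj1_sig]; repeat split; lra. }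
  assert (J0 : inv O (a, c)).
  { unfold inv, W, V; simpl; split; [repeat split; lra|].
    rewrite !Rmult_1_r; replace (a + (b - a)) with b by ring.
    replace (c + (d - c)) with d by ring; apply Rle_refl. }
  set (nxt := fun n s => proj1_sig (constructive_indefinite_description _ (step n s))).
  set (sq := fix sq n : {p | inv n p} :=
    match n with O => exist _ _ J0 | S n => nxt n (sq n) end).
  assert (Hsq : forall n,
    (fst (proj1_sig (sq n)) <= fst (proj1_sig (sq (S n))) /\
     fst (proj1_sig (sq (S n))) + W (S n) <= fst (proj1_sig (sq n)) + W n) /\
    (snd (proj1_sig (sq n)) <= snd (proj1_sig (sq (S n))) /\
     snd (proj1_sig (sq (S n))) + V (S n) <= snd (proj1_sig (sq n)) + V n)).
  { intros n; exact (proj2_sig (constructive_indefinite_description _ (step n (sq n)))). }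
  destruct (nested_intervals (fun n => fst (proj1_sig (sq n))) W HW) as [lx Hlx];
    [intros n; apply Hsq|intros n; apply Hsq|].
  destruct (nested_intervals (fun n => snd (proj1_sig (sq n))) V HV) as [ly Hly];
    [intros n; apply Hsq|intros n; apply Hsq|].
  assert (Rlx : a <= lx <= b).
  { pose proof (Hlx O); destruct (proj2_sig (sq O)) as [[? [? _]] _]; simpl in *; lra. }
  assert (Rly : c <= ly <= d).
  { pose proof (Hly O); destruct (proj2_sig (sq O)) as [[? [? [? ?]]] _]; simpl in *; lra. }
  destruct (HF lx ly Rlx Rly) as [l Hl].
  set (D := (b - a) + (d - c)).
  assert (HD : 0 <= D) by (unfold D; lra).
  assert (HD2 : 0 < 4 * (D ^ 2 + 1)) by (pose proof (pow2_ge_0 D); lra).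
  (* The upper bound [2 eps (D / 2^n)^2] and the lower bound [K / 4^n] decay at the same rate, so
     [2 eps D^2 < K] is a contradiction for any [n] with a small enough rectangle. The [+ 1] covers
     [D = 0]. *)
  assert (He : 0 < K / (4 * (D ^ 2 + 1))) by (apply Rdiv_lt_0_compat; assumption).
  destruct (Hl _ He) as [delta [Hdl Hw]].
  destruct (pow_lt_1_zero (/ 2) ltac:(rewrite Rabs_right; lra) (delta / (D + 1))) as [n Hn].
  { apply Rdiv_lt_0_compat; lra. }
  specialize (Hn n (le_n n)); rewrite Rabs_right in Hn by (apply Rle_ge, Rlt_le, Hp).
  assert (Hn' : D * (/ 2) ^ n < delta).
  { apply (Rmult_lt_compat_r (D + 1)) in Hn; [|lra].
    replace (delta / (D + 1) * (D + 1)) with delta in Hn by (field; lra).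
    pose proof (Hp n); lra. }
  specialize (Hlx n); specialize (Hly n).
  destruct (sq n) as [[x y] [[I1 [I2 [I3 I4]]] I5]]; simpl in *.
  assert (Q : Cmod (rect_int F x (x + W n) y (y + V n))
    <= 2 * (K / (4 * (D ^ 2 + 1))) * ((x + W n - x) + (y + V n - y)) ^ 2).
  { apply (rect_int_small F (lx, ly) l _ delta); auto; simpl; try lra.
    - intros u v Hu Hv; apply HC; lra.
    - unfold W, V; unfold D in Hn'; lra. }
  replace ((x + W n - x) + (y + V n - y)) with (D * (/ 2) ^ n) in Q
    by (unfold W, V, D; ring).
  replace ((D * (/ 2) ^ n) ^ 2) with (D ^ 2 * (/ 4) ^ n) in Q.
  2: { rewrite Rpow_mult_distr, <- pow_mult, Nat.mul_comm, pow_mult; do 2 f_equal; field. }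
  assert (P4 : 0 < (/ 4) ^ n) by (apply pow_lt; lra).
  assert (2 * (K / (4 * (D ^ 2 + 1))) * (D ^ 2 * (/ 4) ^ n) < K * (/ 4) ^ n); [|lra].
  replace (2 * (K / (4 * (D ^ 2 + 1))) * (D ^ 2 * (/ 4) ^ n))
    with (K * (/ 4) ^ n * (D ^ 2 / (2 * (D ^ 2 + 1)))) by (field; lra).
  rewrite <- (Rmult_1_r (K * (/ 4) ^ n)) at 2.
  apply Rmult_lt_compat_l; [apply Rmult_lt_0_compat; assumption|].
  apply (Rmult_lt_reg_r (2 * (D ^ 2 + 1))); [lra|].
  unfold Rdiv; rewrite Rmult_assoc, Rinv_l by lra; lra.
Qed.

(** * Fourier coefficients of a holomorphic function on circles *)

Lemma differentiable_of_partials (f fx : R -> R -> R) (x y fy : R) :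
  locally_2d (fun u v => is_derive (fun s => f s v) u (fx u v)) x y ->
  is_derive (fun s => f x s) y fy -> continuity_2d_pt fx x y ->
  differentiable_pt_lim f x y (fx x y) fy.
Proof.
  intros H1 H2 H3; apply filterdiff_differentiable_pt_lim.
  apply (is_derive_filterdiff f x y fx fy).
  - apply locally_2d_locally in H1; exact H1.
  - exact H2.
  - apply continuity_2d_pt_filterlim; exact H3.
Qed.

Definition cis (t : R) : C := (cos t, sin t).
Definition Cexp (w : C) : C := (exp (fst w) * cos (snd w), exp (fst w) * sin (snd w)).

Lemma Cmod_cis (t : R) : Cmod (cis t) = 1.
Proof. exact (Cmod_cos_sin t). Qed.

Lemma cis_plus (s t : R) : cis (s + t) = (cis s * cis t)%C.
Proof. unfold cis; rewrite cos_plus, sin_plus; apply injective_projections; simpl; ring. Qed.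

Lemma cis_0 : cis 0 = 1.
Proof. unfold cis; rewrite cos_0, sin_0; reflexivity. Qed.

Lemma cis_opp (t : R) : cis (- t) = Cconj (cis t).
Proof. unfold cis; rewrite cos_neg, sin_antisym; reflexivity. Qed.

Lemma cis_period (k : nat) : cis (INR k * (2 * PI)) = 1.
Proof.
  replace (INR k * (2 * PI)) with (0 + 2 * INR k * PI) by ring.
  unfold cis; rewrite cos_period, sin_period, cos_0, sin_0; reflexivity.
Qed.

Lemma Cexp_cis (s t : R) : Cexp (s, t) = (RtoC (exp s) * cis t)%C.
Proof. apply injective_projections; simpl; ring. Qed.

Lemma Cexp_plus (a b : C) : Cexp (a + b) = (Cexp a * Cexp b)%C.
Proof.
  destruct a as [a1 a2], b as [b1 b2].
  change ((a1, a2) + (b1, b2))%C with ((a1 + b1, a2 + b2) : C).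
  rewrite !Cexp_cis, cis_plus, exp_plus, RtoC_mult; ring.
Qed.

Lemma Cmod_Cexp (w : C) : Cmod (Cexp w) = exp (Re w).
Proof.
  destruct w as [a b]; rewrite Cexp_cis, Cmod_mult, Cmod_cis, Cmod_R; simpl.
  rewrite Rabs_right; [ring|apply Rle_ge, Rlt_le, exp_pos].
Qed.

Lemma Cexp_neq_0 (w : C) : Cexp w <> 0.
Proof. apply Cmod_gt_0; rewrite Cmod_Cexp; apply exp_pos. Qed.

Lemma continuity_2d_exp_mult (f : R -> R) (x y : R) :
  continuity_pt f y -> continuity_2d_pt (fun u v => exp u * f v) x y.
Proof.
  intros H; apply continuity_2d_pt_mult.
  - apply (continuity_1d_2d_pt_comp exp (fun u _ => u)); [|apply continuity_2d_pt_id1].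
    apply derivable_continuous_pt, derivable_pt_exp.
  - apply (continuity_1d_2d_pt_comp f (fun _ v => v)); [exact H|apply continuity_2d_pt_id2].
Qed.

Lemma cderiv_Cexp (z : C) : cderiv Cexp z (Cexp z).
Proof.
  destruct z as [x y].
  apply (cderiv_of_CR (fun u v => exp u * cos v) (fun u v => exp u * sin v)).
  - apply (differentiable_of_partials (fun u v => exp u * cos v) (fun u v => exp u * cos v)).
    + apply locally_2d_forall; intros u v; auto_derive; [trivial|ring].
    + auto_derive; [trivial|simpl; ring].
    + apply continuity_2d_exp_mult, derivable_continuous_pt, derivable_pt_cos.
  - apply (differentiable_of_partials (fun u v => exp u * sin v) (fun u v => exp u * sin v)).
    + apply locally_2d_forall; intros u v; auto_derive; [trivial|ring].
    + auto_derive; [trivial|simpl; ring].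
    + apply continuity_2d_exp_mult, derivable_continuous_pt, derivable_pt_sin.
Qed.

Lemma ccurve_cis (u : R -> R) (t : R) : continuous u t -> ccurve (fun s => cis (u s)) t.
Proof.
  intros H; apply ccurve_pair; apply (continuous_comp u); auto;
    apply (ex_derive_continuous (V := R_NormedModule)); auto_derive; trivial.
Qed.

Lemma continuous_mult_l (a t : R) : continuous (fun s : R => a * s) t.
Proof. apply (ex_derive_continuous (V := R_NormedModule)); auto_derive; trivial. Qed.

Lemma ccurve_circle (g : C -> C) (r t : R) :
  ccont g (r * cis t)%C -> ccurve (fun s => g (r * cis s)%C) t.
Proof.
  intros H; apply (ccurve_comp g (fun s => r * cis s)%C); [|exact H].
  apply ccurve_mult; [apply ccurve_const|apply ccurve_cis, continuous_id].
Qed.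

Lemma Cmod_circle (r t : R) : 0 <= r -> Cmod (r * cis t) = r.
Proof. intros H; rewrite Cmod_mult, Cmod_cis, Cmod_R, Rabs_right; lra. Qed.

Lemma holo_ccont (U : C -> Prop) (g : C -> C) (z : C) : holo U g -> U z -> ccont g z.
Proof. intros H Hz; destruct (H z Hz) as [l Hl]; exact (cderiv_ccont _ _ _ Hl). Qed.

Lemma exp_lt_1 (s : R) : s < 0 -> exp s < 1.
Proof. intros H; rewrite <- exp_0; apply exp_increasing; exact H. Qed.

(* Goursat's theorem for [g (exp w) * exp (- a w)] on a rectangle of height [2 PI]:
   the horizontal sides cancel by periodicity. *)
Lemma circle_int_invariant (g : C -> C) (a s1 s2 : R) :
  holo Disc g -> cis (a * (2 * PI)) = 1 -> s1 <= s2 -> s2 < 0 ->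
  (RtoC (exp (- a * s1)) * CInt (fun t => g (exp s1 * cis t) * cis (- a * t))%C 0 (2 * PI)
   = RtoC (exp (- a * s2)) * CInt (fun t => g (exp s2 * cis t) * cis (- a * t))%C 0 (2 * PI))%C.
Proof.
  intros Hg Ha H12 H2.
  pose proof PI_RGT_0 as HPI.
  set (F := fun w => (g (Cexp w) * Cexp (RtoC (- a) * w))%C).
  assert (EF : forall s t, F (s, t) = (RtoC (exp (- a * s)) * (g (exp s * cis t) * cis (- a * t)))%C).
  { intros s t; unfold F.
    replace (RtoC (- a) * (s, t))%C with ((- a * s, - a * t) : C)
      by (apply injective_projections; simpl; ring).
    rewrite !Cexp_cis; ring. }
  assert (E : rect_int F s1 s2 0 (2 * PI) = 0).
  { apply goursat_rectangle; [lra|lra|]; intros x y Hx Hy.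
    destruct (Hg (Cexp (x, y))) as [l Hl].
    { unfold Disc; rewrite Cmod_Cexp; apply exp_lt_1; simpl; lra. }
    eexists; apply (cderiv_mult (fun w => g (Cexp w)) (fun w => Cexp (RtoC (- a) * w)%C)).
    - apply cderiv_comp; [exact Hl|apply cderiv_Cexp].
    - apply (cderiv_comp Cexp (fun w => RtoC (- a) * w)%C); [apply cderiv_Cexp|].
      apply cderiv_scal, cderiv_id. }
  unfold rect_int in E.
  assert (V : forall s, s < 0 -> CInt (fun y => F (s, y)) 0 (2 * PI)
    = (RtoC (exp (- a * s)) * CInt (fun t => g (exp s * cis t) * cis (- a * t))%C 0 (2 * PI))%C).
  { intros s Hs; rewrite <- CInt_scal; [|lra|].
    - apply CInt_ext; [lra|]; intros t _; apply EF.
    - intros t _; apply ccurve_mult; [|apply ccurve_cis, continuous_mult_l].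
      apply ccurve_circle, (holo_ccont Disc); [exact Hg|].
      unfold Disc; rewrite Cmod_circle; [apply exp_lt_1, Hs|apply Rlt_le, exp_pos]. }
  rewrite (CInt_ext (fun x => F (x, 0)) (fun x => F (x, 2 * PI))) in E; [|lra|].
  2: { intros x _; rewrite !EF.
       assert (C1 : cis (2 * PI) = 1) by (rewrite <- (cis_period 1); f_equal; simpl; ring).
       replace (- a * (2 * PI)) with (- (a * (2 * PI))) by ring.
       rewrite Rmult_0_r, cis_0, C1, cis_opp, Ha.
       do 2 f_equal; apply injective_projections; simpl; ring. }
  rewrite !V in E by lra.
  set (A := (RtoC (exp (- a * s1)) * _)%C) in *; set (B := (RtoC (exp (- a * s2)) * _)%C) in *.
  assert (E' : (Ci * (B - A) = 0)%C) by (rewrite <- E; ring).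
  destruct (Ceq_dec (B - A) 0) as [D|D].
  - symmetry; apply Ceq_minus; exact D.
  - exfalso; exact (Cmult_neq_0 _ _ Ci_nz D E').
Qed.

Lemma exp_INR_mult (k : nat) (s : R) : exp (INR k * s) = exp s ^ k.
Proof.
  induction k as [|k IH]; [simpl; rewrite Rmult_0_l; apply exp_0|].
  rewrite S_INR, Rmult_plus_distr_r, exp_plus, IH, Rmult_1_l; simpl; ring.
Qed.

Lemma ccurve_fourier (g : C -> C) (r a t : R) :
  holo Disc g -> 0 <= r < 1 -> ccurve (fun s => g (r * cis s) * cis (a * s))%C t.
Proof.
  intros Hg Hr; apply ccurve_mult; [|apply ccurve_cis, continuous_mult_l].
  apply ccurve_circle, (holo_ccont Disc); [exact Hg|].
  unfold Disc; rewrite Cmod_circle; lra.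
Qed.

(** With [s = ln r], the invariant [exp (- k s)] times the integral is constant in [s], so the
    integral itself is proportional to [exp (k s) = r ^ k]. *)
Lemma circle_int_positive (g : C -> C) (k : nat) :
  holo Disc g -> exists c : C, forall r, 0 < r < 1 ->
    CInt (fun t => g (r * cis t) * cis (- INR k * t))%C 0 (2 * PI)
    = (RtoC (2 * PI) * (c * RtoC (r ^ k)))%C.
Proof.
  intros Hg; pose proof PI_RGT_0 as HPI.
  set (J := fun s => (RtoC (exp (- INR k * s)) * CInt (fun t => g (exp s * cis t) * cis (- INR k * t))%C 0 (2 * PI))%C).
  (* The point [-1] is an arbitrary base point in [s < 0]. *)
  exists (J (-1) / RtoC (2 * PI))%C; intros r [Hr0 Hr1].
  assert (Hs : ln r < 0) by (rewrite <- ln_1; apply ln_increasing; assumption).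
  assert (E : J (ln r) = J (-1)).
  { destruct (Rle_dec (ln r) (-1)) as [L|L].
    - apply (circle_int_invariant g (INR k) (ln r) (-1) Hg (cis_period k)); lra.
    - symmetry; apply (circle_int_invariant g (INR k) (-1) (ln r) Hg (cis_period k)); lra. }
  rewrite <- E; unfold J; rewrite exp_ln by exact Hr0.
  replace (- INR k * ln r) with (- (INR k * ln r)) by ring.
  rewrite exp_Ropp, exp_INR_mult, exp_ln by exact Hr0.
  assert (Hp : r ^ k <> 0) by (apply pow_nonzero; lra).
  rewrite RtoC_inv by exact Hp.
  field; split; intros D; [|apply Hp]; apply RtoC_inj in D; lra.
Qed.

(** For a negative mode the invariant is [r ^ S k] times the integral. It tends to [0] with [r],
    since [g] is bounded near the centre; being constant, it is [0]. *)
Lemma circle_int_negative (g : C -> C) (k : nat) (r : R) :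
  holo Disc g -> 0 < r < 1 ->
  CInt (fun t => g (r * cis t) * cis (INR (S k) * t))%C 0 (2 * PI) = 0.
Proof.
  intros Hg [Hr0 Hr1]; pose proof PI_RGT_0 as HPI.
  set (I := CInt _ 0 (2 * PI)).
  assert (Hs : ln r < 0) by (rewrite <- ln_1; apply ln_increasing; assumption).
  assert (Ha : cis (- INR (S k) * (2 * PI)) = 1).
  { replace (- INR (S k) * (2 * PI)) with (- (INR (S k) * (2 * PI))) by ring.
    rewrite cis_opp, cis_period; apply injective_projections; simpl; ring. }
  destruct (Ceq_dec I 0) as [E|N]; [exact E|exfalso].
  apply Cmod_gt_0 in N.
  assert (C0 : ccont g 0) by (apply (holo_ccont Disc); [exact Hg|unfold Disc; rewrite Cmod_0; lra]).
  destruct (C0 1 Rlt_0_1) as [dl [Hd Hw]].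
  set (M := Cmod (g 0) + 1).
  assert (HM : 0 < M) by (unfold M; pose proof (Cmod_ge_0 (g 0)); lra).
  set (A := r ^ S k * Cmod I).
  assert (HA : 0 < A) by (apply Rmult_lt_0_compat; [apply pow_lt|]; assumption).
  (* [dl / 2] keeps the circle where [|g| <= M], [r] puts it inside the given circle, and the last
     bound forces the invariant below [A / 2], although it equals [A]. *)
  set (q := Rmin (Rmin (dl / 2) r) (A / (M * (2 * PI)) / 2)).
  assert (HMP : 0 < M * (2 * PI)) by (apply Rmult_lt_0_compat; lra).
  assert (Hq0 : 0 < q).
  { repeat apply Rmin_pos; try lra.
    apply Rdiv_lt_0_compat; [apply Rdiv_lt_0_compat; assumption|lra]. }
  assert (Hq1 : q <= dl / 2) by (unfold q; eapply Rle_trans; apply Rmin_l).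
  assert (Hq2 : q <= r) by (unfold q; eapply Rle_trans; [apply Rmin_l|apply Rmin_r]).
  assert (Hq3 : q <= A / (M * (2 * PI)) / 2) by (unfold q; apply Rmin_r).
  assert (Hlq : ln q <= ln r).
  { destruct (Req_dec q r) as [->|NE]; [lra|]; apply Rlt_le, ln_increasing; lra. }
  pose proof (circle_int_invariant g (- INR (S k)) (ln q) (ln r) Hg Ha Hlq Hs) as E.
  rewrite Ropp_involutive, !exp_INR_mult, !exp_ln in E by assumption.
  fold I in E.
  assert (E2 := f_equal Cmod E).
  rewrite !Cmod_mult, !Cmod_R, !Rabs_right in E2
    by (apply Rle_ge, pow_le; lra).
  fold A in E2.
  assert (B : Cmod (CInt (fun t => g (q * cis t) * cis (INR (S k) * t))%C 0 (2 * PI)) <= M * (2 * PI - 0)).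
  { apply CInt_norm_const; [lra| |].
    - intros t _; apply ccurve_fourier; [exact Hg|lra].
    - intros t _; rewrite Cmod_mult, Cmod_cis, Rmult_1_r.
      assert (Cmod (g (q * cis t)%C - g 0) < 1).
      { apply Hw; replace (q * cis t - 0)%C with (q * cis t)%C by ring.
        rewrite Cmod_circle; lra. }
      pose proof (Cmod_rev_triangle (g (q * cis t)%C) (g 0)); unfold M; lra. }
  assert (Hqk : q ^ S k <= q).
  { assert (q ^ k <= 1) by (rewrite <- (pow1 k); apply pow_incr; lra).
    simpl; nra. }
  assert (A <= q * (M * (2 * PI))).
  { rewrite <- E2. replace (2 * PI - 0) with (2 * PI) in B by ring.
    apply Rmult_le_compat; auto; [apply pow_le; lra|apply Cmod_ge_0]. }
  assert (q * (M * (2 * PI)) <= A / 2).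
  { apply (Rmult_le_compat_r (M * (2 * PI))) in Hq3; [|lra].
    replace (A / (M * (2 * PI)) / 2 * (M * (2 * PI))) with (A / 2) in Hq3 by (field; lra).
    exact Hq3. }
  lra.
Qed.

(** One sequence [c] serves all radii: these are the Taylor coefficients of [g] at [0], read off
    from its Fourier modes. *)
Definition fourier (g : C -> C) (c : nat -> C) : Prop :=
  forall (k : nat) (r : R), 0 < r < 1 ->
    CInt (fun t => g (r * cis t) * cis (- INR k * t))%C 0 (2 * PI)
    = (RtoC (2 * PI) * (c k * RtoC (r ^ k)))%C.

Lemma fourier_exists (g : C -> C) : holo Disc g -> exists c : nat -> C, fourier g c.
Proof.
  intros Hg; exists (fun k => proj1_sig (constructive_indefinite_description _ (circle_int_positive g k Hg))).
  intros k; exact (proj2_sig (constructive_indefinite_description _ (circle_int_positive g k Hg))).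
Qed.

(** * Fejer means *)

Fixpoint csum (u : nat -> C) (n : nat) : C :=
  match n with O => 0 | S n => (csum u n + u n)%C end.

Definition psum (c : nat -> C) (m : nat) (z : C) : C := csum (fun k => c k * z ^ k)%C m.

Lemma Cmod_csum_tail (u : nat -> C) (B : R) (m j : nat) :
  (forall l, (m <= l)%nat -> Cmod (u l) <= B) ->
  Cmod (csum u (m + j)) <= Cmod (csum u m) + INR j * B.
Proof.
  intros H; induction j as [|j IH]; [rewrite Nat.add_0_r; simpl; lra|].
  rewrite Nat.add_succ_r, S_INR; simpl.
  pose proof (Cmod_triangle (csum u (m + j)) (u (m + j)%nat)).
  specialize (H (m + j)%nat ltac:(lia)); lra.
Qed.

(** The constant [A] absorbs the terms before index [m]; it disappears once the sum is divided by
    [N]. *)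
Lemma Cmod_csum_eventually (u : nat -> C) (B : R) (m : nat) :
  0 <= B -> (forall l, (m <= l)%nat -> Cmod (u l) <= B) ->
  exists A, forall N, Cmod (csum u N) <= A + INR N * B.
Proof.
  intros HB H.
  assert (F : forall m, exists A, 0 <= A /\ forall N, (N <= m)%nat -> Cmod (csum u N) <= A).
  { clear; intros m; induction m as [|m [A [HA IH]]].
    - exists 0; split; [lra|]; intros N HN; replace N with O by lia; simpl; rewrite Cmod_0; lra.
    - pose proof (Cmod_ge_0 (csum u (S m))).
      exists (A + Cmod (csum u (S m))); split; [lra|]; intros N HN.
      destruct (Nat.eq_dec N (S m)) as [->|D]; [lra|]; specialize (IH N ltac:(lia)); lra. }
  destruct (F m) as [A [HA HF]]; exists A; intros N.
  destruct (le_lt_dec N m) as [L|L].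
  - specialize (HF N L); pose proof (pos_INR N); nra.
  - replace N with (m + (N - m))%nat by lia.
    eapply Rle_trans; [apply Cmod_csum_tail; exact H|].
    specialize (HF m (le_n m)); rewrite plus_INR; pose proof (pos_INR m); nra.
Qed.

Lemma csum_geometric_tail (u : nat -> C) (K q : R) (m j : nat) :
  0 <= K -> 0 <= q < 1 -> (forall k, (m <= k)%nat -> Cmod (u k) <= K * q ^ k) ->
  Cmod (csum u (m + j) - csum u m) <= K * q ^ m / (1 - q).
Proof.
  intros HK Hq H.
  assert (I : Cmod (csum u (m + j) - csum u m) <= K * q ^ m * (1 - q ^ j) / (1 - q)).
  { induction j as [|j IH].
    - rewrite Nat.add_0_r; replace (csum u m - csum u m)%C with (RtoC 0) by ring.
      rewrite Cmod_0; simpl; apply Req_le; field; lra.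
    - rewrite Nat.add_succ_r; simpl csum.
      replace (csum u (m + j) + u (m + j)%nat - csum u m)%C
        with ((csum u (m + j) - csum u m) + u (m + j)%nat)%C by ring.
      eapply Rle_trans; [apply Cmod_triangle|].
      specialize (H (m + j)%nat ltac:(lia)); rewrite pow_add in H.
      replace (K * q ^ m * (1 - q ^ S j) / (1 - q))
        with (K * q ^ m * (1 - q ^ j) / (1 - q) + K * (q ^ m * q ^ j)) by (simpl; field; lra).
      lra. }
  eapply Rle_trans; [exact I|].
  unfold Rdiv; apply Rmult_le_compat_r; [apply Rlt_le, Rinv_0_lt_compat; lra|].
  rewrite <- (Rmult_1_r (K * q ^ m)) at 2; apply Rmult_le_compat_l.
  - apply Rmult_le_pos; [exact HK|apply pow_le; lra].
  - pose proof (pow_le q j ltac:(lra)); lra.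
Qed.

(** This is the passage to the limit in a Cesaro mean, written without division by [N]. *)
Lemma le_of_linear_bound (a b A : R) :
  (forall N : nat, INR N * a <= INR N * b + A) -> a <= b.
Proof.
  intros H; destruct (Rle_dec a b) as [L|L]; [exact L|exfalso].
  destruct (INR_archimed (a - b) A ltac:(lra)) as [N HN]; specialize (H N); lra.
Qed.

(** The Dirichlet kernel contains the modes from [- m] to [m]. Below, [fejer N] is [N] times the
    usual Fejer kernel, which avoids dividing by [N]; its integral over a period is [2 PI N]. *)
Fixpoint dirichlet (m : nat) (x : R) : R :=
  match m with O => 1 | S n => dirichlet n x + 2 * cos (INR (S n) * x) end.

Fixpoint fejer (N : nat) (x : R) : R :=
  match N with O => 0 | S n => fejer n x + dirichlet n x end.

(** Multiplying by [1 - cos x] makes the sum telescope and keeps the closed form valid where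
    [cos x = 1]; summing once more telescopes again and gives [fejer_cos]. *)
Lemma dirichlet_cos (m : nat) (x : R) :
  (1 - cos x) * dirichlet m x = cos (INR m * x) - cos (INR (S m) * x).
Proof.
  induction m as [|m IH].
  - simpl; rewrite Rmult_0_l, cos_0, !Rmult_1_l; ring.
  - cbn [dirichlet]; rewrite Rmult_plus_distr_l, IH.
    replace (INR m * x) with (INR (S m) * x - x) by (rewrite S_INR; ring).
    replace (INR (S (S m)) * x) with (INR (S m) * x + x) by (rewrite (S_INR (S m)); ring).
    rewrite cos_plus, cos_minus; ring.
Qed.

Lemma fejer_cos (N : nat) (x : R) : (1 - cos x) * fejer N x = 1 - cos (INR N * x).
Proof.
  induction N as [|N IH]; [simpl; rewrite Rmult_0_l, cos_0; ring|].
  cbn [fejer]; rewrite Rmult_plus_distr_l, IH, dirichlet_cos; ring.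
Qed.

(** Off the zeros of [1 - cos x] the closed form has the sign of [1 - cos (N x)]; at these zeros
    every cosine equals [1] and each Dirichlet kernel is positive. *)
Lemma fejer_ge_0 (N : nat) (x : R) : 0 <= fejer N x.
Proof.
  destruct (Req_dec (cos x) 1) as [E|E].
  - assert (S0 : sin x = 0).
    { pose proof (sin2_cos2 x) as H; rewrite E in H; unfold Rsqr in H.
      apply Rsqr_0_uniq; unfold Rsqr; lra. }
    assert (P : forall k, cos (INR k * x) = 1).
    { assert (Q : forall k, cos (INR k * x) = 1 /\ sin (INR k * x) = 0).
      { induction k as [|k [H1 H2]].
        - simpl; rewrite Rmult_0_l; split; [apply cos_0|apply sin_0].
        - rewrite S_INR, Rmult_plus_distr_r, Rmult_1_l, cos_plus, sin_plus, H1, H2, E, S0.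
          split; ring. }
      intros k; apply Q. }
    assert (Dp : forall m, 0 <= dirichlet m x).
    { induction m as [|m IH]; [simpl; lra|].
      cbn [dirichlet]; rewrite P; lra. }
    induction N as [|N IH]; [simpl; lra|]; simpl; specialize (Dp N); lra.
  - pose proof (COS_bound x); pose proof (COS_bound (INR N * x)).
    pose proof (fejer_cos N x) as F.
    apply (Rmult_le_reg_l (1 - cos x)); lra.
Qed.

Lemma continuous_dirichlet (m : nat) (t s : R) : continuous (fun s => dirichlet m (t - s)) s.
Proof.
  induction m as [|m IH]; [apply continuous_const|].
  cbn [dirichlet]; apply (continuous_plus (V := R_NormedModule)); [exact IH|].
  apply (ex_derive_continuous (V := R_NormedModule)); auto_derive; trivial.
Qed.

Lemma continuous_fejer (m : nat) (t s : R) : continuous (fun s => fejer m (t - s)) s.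
Proof.
  induction m as [|m IH]; [apply continuous_const|].
  cbn [fejer]; apply (continuous_plus (V := R_NormedModule)); [exact IH|].
  apply continuous_dirichlet.
Qed.

Lemma is_RInt_dirichlet (m : nat) (t : R) :
  is_RInt (fun s => dirichlet m (t - s)) 0 (2 * PI) (2 * PI).
Proof.
  induction m as [|m IH].
  - replace (2 * PI) with (scal (2 * PI - 0) 1) at 2 by (unfold scal; simpl; unfold mult; simpl; ring).
    apply (is_RInt_const (V := R_NormedModule)).
  - cbn [dirichlet]; rewrite <- (Rplus_0_r (2 * PI)) at 2.
    apply (is_RInt_plus (V := R_NormedModule)); [exact IH|].
    assert (Hn : INR (S m) <> 0) by (apply not_0_INR; lia).
    set (n := INR (S m)) in *.
    set (F := fun s => - 2 * sin (n * (t - s)) / n).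
    replace 0 with (minus (F (2 * PI)) (F 0)) at 2.
    + apply (is_RInt_derive (V := R_CompleteNormedModule)).
      * intros s _; unfold F; auto_derive; [trivial|]. unfold Rminus; field; exact Hn.
      * intros s _; apply (ex_derive_continuous (V := R_NormedModule)); auto_derive; trivial.
    + unfold minus, plus, opp, F; simpl.
      replace (n * (t - 0)) with (n * (t - 2 * PI) + 2 * n * PI) by ring.
      unfold n at 4; rewrite sin_period; field; exact Hn.
Qed.

Lemma is_RInt_fejer (N : nat) (t : R) :
  is_RInt (fun s => fejer N (t - s)) 0 (2 * PI) (INR N * (2 * PI)).
Proof.
  induction N as [|N IH].
  - cbn [fejer]; replace (INR 0 * (2 * PI)) with (scal (2 * PI - 0) 0)
      by (unfold scal; simpl; unfold mult; simpl; ring).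
    apply (is_RInt_const (V := R_NormedModule)).
  - cbn [fejer]; rewrite S_INR, Rmult_plus_distr_r, Rmult_1_l.
    apply (is_RInt_plus (V := R_NormedModule)); [exact IH|apply is_RInt_dirichlet].
Qed.

Lemma cis_pow (t : R) (k : nat) : (cis t ^ k)%C = cis (INR k * t).
Proof.
  induction k as [|k IH]; [simpl; rewrite Rmult_0_l; symmetry; apply cis_0|].
  rewrite Cpow_S, IH, S_INR, Rmult_plus_distr_r, cis_plus, Rmult_1_l; ring.
Qed.

Lemma circle_pow (r t : R) (k : nat) :
  ((r * cis t) ^ k)%C = (RtoC (r ^ k) * cis (INR k * t))%C.
Proof. rewrite Cpow_mult_l, cis_pow, RtoC_pow; reflexivity. Qed.

Lemma ccurve_holo_circle (g : C -> C) (r t : R) :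
  holo Disc g -> 0 <= r < 1 -> ccurve (fun s => g (r * cis s)%C) t.
Proof.
  intros Hg Hr; apply ccurve_circle, (holo_ccont Disc); [exact Hg|].
  unfold Disc; rewrite Cmod_circle; lra.
Qed.

(** Each [2 cos (n (t - s))] splits into two exponentials: one extracts [c n z ^ n], the other a
    negative mode, which vanishes. Degrees [0] to [m] occur, hence [S m] terms. *)
Lemma CInt_dirichlet (g : C -> C) (c : nat -> C) (r t : R) (m : nat) :
  holo Disc g -> fourier g c -> 0 < r < 1 ->
  CInt (fun s => g (r * cis s) * RtoC (dirichlet m (t - s)))%C 0 (2 * PI)
  = (RtoC (2 * PI) * psum c (S m) (r * cis t))%C.
Proof.
  intros Hg Hc Hr; pose proof PI_RGT_0 as HPI.
  induction m as [|m IH].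
  - unfold psum; simpl.
    transitivity (CInt (fun s => g (r * cis s) * cis (- INR 0 * s))%C 0 (2 * PI)).
    + apply CInt_ext; [lra|]; intros s _; simpl.
      replace (- 0 * s) with 0 by ring; rewrite cis_0; reflexivity.
    + rewrite Hc by exact Hr; simpl; ring.
  - set (n := S m) in *.
    change (psum c (S n) (r * cis t)) with (psum c n (r * cis t) + c n * (r * cis t) ^ n)%C.
    rewrite Cmult_plus_distr_l, <- IH.
    transitivity (CInt (fun s => g (r * cis s) * RtoC (dirichlet m (t - s))
      + (cis (INR n * t) * (g (r * cis s) * cis (- INR n * s))
         + cis (- (INR n * t)) * (g (r * cis s) * cis (INR n * s))))%C 0 (2 * PI)).
    { apply CInt_ext; [lra|]; intros s _; unfold n; cbn [dirichlet]; fold n.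
      replace (RtoC (dirichlet m (t - s) + 2 * cos (INR n * (t - s))))
        with (RtoC (dirichlet m (t - s))
              + (cis (INR n * t) * cis (- INR n * s) + cis (- (INR n * t)) * cis (INR n * s)))%C.
      - ring.
      - rewrite <- !cis_plus, RtoC_plus; f_equal.
        replace (INR n * t + - INR n * s) with (INR n * (t - s)) by ring.
        replace (- (INR n * t) + INR n * s) with (- (INR n * (t - s))) by ring.
        rewrite cis_opp; apply injective_projections; simpl; ring. }
    assert (K0 : forall s, 0 <= s <= 2 * PI -> ccurve (fun s => g (r * cis s) * RtoC (dirichlet m (t - s)))%C s).
    { intros s _; apply ccurve_mult; [apply ccurve_holo_circle; [exact Hg|lra]|].
      apply ccurve_RtoC, continuous_dirichlet. }
    assert (K1 : forall a s, 0 <= s <= 2 * PI -> ccurve (fun s => g (r * cis s) * cis (a * s))%C s)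
      by (intros a s _; apply ccurve_fourier; [exact Hg|lra]).
    assert (K2 : forall a b s, 0 <= s <= 2 * PI -> ccurve (fun s => b * (g (r * cis s) * cis (a * s)))%C s)
      by (intros a b s Hs; apply ccurve_mult; [apply ccurve_const|apply K1, Hs]).
    rewrite CInt_plus; [|lra|exact K0|].
    2: { intros s Hs; apply ccurve_plus; apply K2, Hs. }
    rewrite CInt_plus; [|lra|apply K2|apply K2].
    rewrite !CInt_scal; [|lra|apply K1|lra|apply K1].
    rewrite Hc by exact Hr.
    pose proof (circle_int_negative g m r Hg Hr) as N0; fold n in N0; rewrite N0.
    rewrite circle_pow; ring.
Qed.

(** The sum, not the mean, of the first [N] nonempty partial sums; it is therefore compared with [N]
    times the value of [g]. *)
Definition cesaro (c : nat -> C) (N : nat) (z : C) : C := csum (fun m => psum c (S m) z) N.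

Lemma CInt_fejer (g : C -> C) (c : nat -> C) (r t : R) (N : nat) :
  holo Disc g -> fourier g c -> 0 < r < 1 ->
  CInt (fun s => g (r * cis s) * RtoC (fejer N (t - s)))%C 0 (2 * PI)
  = (RtoC (2 * PI) * cesaro c N (r * cis t))%C.
Proof.
  intros Hg Hc Hr; pose proof PI_RGT_0 as HPI.
  assert (Kg : forall s, 0 <= s <= 2 * PI -> ccurve (fun s => g (r * cis s)%C) s)
    by (intros s _; apply ccurve_holo_circle; [exact Hg|lra]).
  induction N as [|N IH].
  - unfold cesaro; simpl; rewrite Cmult_0_r.
    transitivity (CInt (fun s => 0 * g (r * cis s))%C 0 (2 * PI)).
    + apply CInt_ext; [lra|]; intros; ring.
    + rewrite CInt_scal; [ring|lra|exact Kg].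
  - cbn [fejer]; unfold cesaro; cbn [csum]; fold (cesaro c N (r * cis t)).
    rewrite Cmult_plus_distr_l, <- IH, <- CInt_dirichlet with (g := g) by assumption.
    rewrite <- CInt_plus; [|lra| |].
    + apply CInt_ext; [lra|]; intros s _; rewrite RtoC_plus; ring.
    + intros s Hs; apply ccurve_mult; [apply Kg, Hs|apply ccurve_RtoC, continuous_fejer].
    + intros s Hs; apply ccurve_mult; [apply Kg, Hs|apply ccurve_RtoC, continuous_dirichlet].
Qed.

Lemma continuous_Cmod (z : R -> C) (t : R) : ccurve z t -> continuous (fun s => Cmod (z s)) t.
Proof.
  intros H.
  apply (continuous_comp (V := C_R_NormedModule) z (fun w => Cmod w) t H).
  apply (continuous_ext (fun w : C_R_NormedModule => norm w)); [exact Cmod_norm_R|].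
  apply filterlim_norm.
Qed.

Lemma bounded_on_circle (g : C -> C) (r : R) :
  holo Disc g -> 0 <= r < 1 ->
  exists M, 0 <= M /\ forall t, 0 <= t <= 2 * PI -> Cmod (g (r * cis t)%C) <= M.
Proof.
  intros Hg Hr; pose proof PI_RGT_0 as HPI.
  destruct (continuity_ab_maj (fun t => Cmod (g (r * cis t)%C)) 0 (2 * PI) ltac:(lra)) as [x [Hx _]].
  - intros t _; apply continuity_pt_filterlim, continuous_Cmod, ccurve_holo_circle; assumption.
  - exists (Cmod (g (r * cis x)%C)); split; [apply Cmod_ge_0|exact Hx].
Qed.

(** The squared chord is expressed through [1 - cos], exactly the factor that collapses the Fejer
    kernel. *)
Lemma circle_dist (r s t : R) :
  Cmod (r * cis s - r * cis t) ^ 2 = r ^ 2 * (2 * (1 - cos (t - s))).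
Proof.
  rewrite Cmod2_alt, cos_minus.
  pose proof (sin2_cos2 s) as Hs; pose proof (sin2_cos2 t) as Ht; unfold Rsqr in Hs, Ht.
  replace (Re _) with (r * cos s - r * cos t) by (simpl; ring).
  replace (Im _) with (r * sin s - r * sin t) by (simpl; ring).
  transitivity (r ^ 2 * ((sin s * sin s + cos s * cos s) + (sin t * sin t + cos t * cos t)
    - 2 * (cos t * cos s + sin t * sin s))); [ring|rewrite Hs, Ht; ring].
Qed.

(* Korovkin's argument: away from [s = t] the oscillation of [g] is dominated by
   [1 - cos (t - s)], whose integral against the Fejer kernel is at most [4 PI]
   independently of [N]. *)
Lemma cesaro_convergence (g : C -> C) (c : nat -> C) (r t eps : R) :
  holo Disc g -> fourier g c -> 0 < r < 1 -> 0 < eps ->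
  exists A, forall N,
    Cmod (cesaro c N (r * cis t) - RtoC (INR N) * g (r * cis t)%C) <= INR N * eps + A.
Proof.
  intros Hg Hc Hr He; pose proof PI_RGT_0 as HPI.
  set (z0 := (r * cis t)%C).
  assert (Kg : forall s, 0 <= s <= 2 * PI -> ccurve (fun s => g (r * cis s)%C) s)
    by (intros s _; apply ccurve_holo_circle; [exact Hg|lra]).
  destruct (bounded_on_circle g r Hg ltac:(lra)) as [M [HM HB]].
  assert (C0 : ccont g z0).
  { apply (holo_ccont Disc); [exact Hg|]; unfold Disc, z0; rewrite Cmod_circle; lra. }
  destruct (C0 eps He) as [dl [Hd Hw]].
  set (L := M + Cmod (g z0)).
  assert (HL : 0 <= L) by (unfold L; pose proof (Cmod_ge_0 (g z0)); lra).
  (* [L] bounds the oscillation of [g]. Where the chord is at least [dl], [circle_dist] gives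
     [dl^2 <= 2 (1 - cos (t - s))], so [A (1 - cos (t - s))] is at least [L]. *)
  set (A := L * 2 / dl ^ 2).
  assert (Hd2 : 0 < dl ^ 2) by (apply pow_lt; exact Hd).
  assert (HA : 0 <= A) by (apply Rmult_le_pos; [lra|apply Rlt_le, Rinv_0_lt_compat, Hd2]).
  assert (P : forall s, 0 <= s <= 2 * PI -> Cmod (g (r * cis s)%C - g z0) <= eps + A * (1 - cos (t - s))).
  { intros s Hs; pose proof (COS_bound (t - s)) as Hcos.
    assert (0 <= A * (1 - cos (t - s))) by (apply Rmult_le_pos; lra).
    destruct (Rlt_dec (Cmod (r * cis s - z0)) dl) as [D|D].
    - specialize (Hw _ D); lra.
    - assert (T : Cmod (g (r * cis s)%C - g z0) <= L).
      { unfold Cminus; eapply Rle_trans; [apply Cmod_triangle|]; rewrite Cmod_opp.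
        specialize (HB s Hs); unfold L; lra. }
      assert (E : dl ^ 2 <= r ^ 2 * (2 * (1 - cos (t - s)))).
      { rewrite <- circle_dist; apply pow_incr; fold z0; lra. }
      assert (r ^ 2 <= 1) by (rewrite <- (pow1 2); apply pow_incr; lra).
      assert (E2 : dl ^ 2 <= 2 * (1 - cos (t - s))) by nra.
      assert (L <= A * (1 - cos (t - s))); [|lra].
      replace L with (L / dl ^ 2 * dl ^ 2) at 1 by (field; lra).
      replace (A * (1 - cos (t - s))) with (L / dl ^ 2 * (2 * (1 - cos (t - s)))) by (unfold A; field; lra).
      apply Rmult_le_compat_l; [|exact E2].
      apply Rmult_le_pos; [exact HL|apply Rlt_le, Rinv_0_lt_compat, Hd2]. }
  exists (A * 2); intros N.
  assert (KF : forall s, 0 <= s <= 2 * PI -> ccurve (fun s => RtoC (fejer N (t - s))) s)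
    by (intros s _; apply ccurve_RtoC, continuous_fejer).
  assert (E : (RtoC (2 * PI) * (cesaro c N z0 - RtoC (INR N) * g z0))%C
    = CInt (fun s => (g (r * cis s) - g z0) * RtoC (fejer N (t - s)))%C 0 (2 * PI)).
  { transitivity (CInt (fun s => g (r * cis s) * RtoC (fejer N (t - s)) - g z0 * RtoC (fejer N (t - s)))%C 0 (2 * PI)).
    - rewrite CInt_minus, CInt_scal, CInt_fejer with (c := c); auto; try lra.
      + rewrite CInt_RtoC; [|lra|intros; apply continuous_fejer].
        rewrite (is_RInt_unique _ _ _ _ (is_RInt_fejer N t)); fold z0.
        rewrite (RtoC_mult (INR N)); ring.
      + intros s Hs; apply ccurve_mult; auto.
      + intros s Hs; apply ccurve_mult; [apply ccurve_const|auto].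
    - apply CInt_ext; [lra|]; intros; ring. }
  (* By [fejer_cos], [(1 - cos) * fejer N] is [1 - cos (N (t - s))], at most [2] whatever [N] is. *)
  set (phi := fun s => eps * fejer N (t - s) + A * (1 - cos (INR N * (t - s)))).
  assert (Kphi : ex_RInt phi 0 (2 * PI)).
  { apply (ex_RInt_plus (V := R_NormedModule)).
    - apply (ex_RInt_scal (V := R_NormedModule)); eexists; apply is_RInt_fejer.
    - apply (ex_RInt_continuous (V := R_CompleteNormedModule)); intros s _.
      apply (ex_derive_continuous (V := R_NormedModule)); auto_derive; trivial. }
  assert (Q1 : Cmod (CInt (fun s => (g (r * cis s) - g z0) * RtoC (fejer N (t - s)))%C 0 (2 * PI))
    <= RInt phi 0 (2 * PI)).
  { apply CInt_norm; [lra| |exact Kphi|].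
    - intros s Hs; apply ccurve_mult; [|auto]; apply ccurve_minus; [auto|apply ccurve_const].
    - intros s Hs; rewrite Cmod_mult, Cmod_R, Rabs_right by (apply Rle_ge, fejer_ge_0).
      unfold phi; rewrite <- fejer_cos, <- Rmult_assoc, <- Rmult_plus_distr_r.
      apply Rmult_le_compat_r; [apply fejer_ge_0|apply P, Hs]. }
  assert (Q2 : RInt phi 0 (2 * PI) <= (INR N * eps + A * 2) * (2 * PI)).
  { assert (Iu : is_RInt (fun s => eps * fejer N (t - s) + A * 2) 0 (2 * PI)
      (eps * (INR N * (2 * PI)) + (2 * PI - 0) * (A * 2))).
    { exact (is_RInt_plus (V := R_NormedModule) _ _ _ _ _ _
        (is_RInt_scal (V := R_NormedModule) _ _ _ eps _ (is_RInt_fejer N t))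
        (is_RInt_const (V := R_NormedModule) 0 (2 * PI) (A * 2))). }
    replace ((INR N * eps + A * 2) * (2 * PI))
      with (eps * (INR N * (2 * PI)) + (2 * PI - 0) * (A * 2)) by ring.
    rewrite <- (is_RInt_unique _ _ _ _ Iu).
    apply RInt_le; [lra|exact Kphi|eexists; exact Iu|].
    intros s _; unfold phi.
    pose proof (COS_bound (INR N * (t - s))); apply Rplus_le_compat_l, Rmult_le_compat_l; lra. }
  rewrite <- E, Cmod_mult, Cmod_R, Rabs_right in Q1 by lra.
  fold z0; apply (Rmult_le_reg_l (2 * PI)); lra.
Qed.

(** * Taylor expansion and coefficient bounds *)

Lemma polar (z : C) : exists t : R, z = (RtoC (Cmod z) * cis t)%C.
Proof.
  destruct (Ceq_dec z 0) as [->|NZ].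
  { exists 0; rewrite Cmod_0; ring. }
  pose proof (proj1 (Cmod_gt_0 z) NZ) as Hm; pose proof (Cmod2_alt z) as E.
  set (m := Cmod z) in *; set (x := Re z) in *; set (y := Im z) in *.
  assert (Hx : -1 <= x / m <= 1).
  { pose proof (re_le_Cmod z) as L; fold x m in L; apply Rabs_le_between in L.
    split; apply (Rmult_le_reg_r m); try exact Hm; unfold Rdiv; rewrite Rmult_assoc, Rinv_l by lra; lra. }
  assert (Es : 1 - Rsqr (x / m) = Rsqr (y / m)).
  { unfold Rsqr; replace 1 with (m ^ 2 / m ^ 2) by (field; lra); rewrite E at 1; field; lra. }
  assert (Z : z = ((x, y) : C)) by apply surjective_pairing.
  destruct (Rle_dec 0 y) as [Hy|Hy].
  - exists (acos (x / m)).
    assert (Sy : sin (acos (x / m)) = y / m).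
    { rewrite sin_acos by exact Hx; rewrite Es; apply sqrt_Rsqr.
      apply Rmult_le_pos; [exact Hy|apply Rlt_le, Rinv_0_lt_compat, Hm]. }
    unfold cis; rewrite cos_acos by exact Hx; rewrite Sy, Z.
    apply injective_projections; simpl; field; lra.
  - exists (- acos (x / m)).
    assert (Sy : sin (acos (x / m)) = - y / m).
    { rewrite sin_acos by exact Hx; rewrite Es, Rsqr_neg.
      replace (- (y / m)) with (- y / m) by (field; lra); apply sqrt_Rsqr.
      apply Rmult_le_pos; [lra|apply Rlt_le, Rinv_0_lt_compat, Hm]. }
    unfold cis; rewrite cos_neg, sin_antisym, cos_acos by exact Hx; rewrite Sy, Z.
    apply injective_projections; simpl; field; lra.
Qed.

(** The zeroth mode is the mean of [g] over a circle. It is the same for all radii, and by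
    continuity it is close to [g 0] on small circles. *)
Lemma fourier_0 (g : C -> C) (c : nat -> C) : holo Disc g -> fourier g c -> c O = g 0.
Proof.
  intros Hg Hc; pose proof PI_RGT_0 as HPI.
  apply Ceq_minus, Cmod_eq_0, Rle_antisym; [|apply Cmod_ge_0].
  apply le_epsilon; intros eps He; rewrite Rplus_0_l.
  assert (C0 : ccont g 0) by (apply (holo_ccont Disc); [exact Hg|unfold Disc; rewrite Cmod_0; lra]).
  destruct (C0 eps He) as [dl [Hd Hw]].
  set (r := Rmin (dl / 2) (1 / 2)).
  assert (Hr0 : 0 < r) by (apply Rmin_pos; lra).
  assert (Hr1 : r <= dl / 2) by apply Rmin_l.
  assert (Hr2 : r <= 1 / 2) by apply Rmin_r.
  assert (Kg : forall s, 0 <= s <= 2 * PI -> ccurve (fun s => g (r * cis s)%C) s)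
    by (intros s _; apply ccurve_holo_circle; [exact Hg|lra]).
  assert (E : (RtoC (2 * PI) * (c O - g 0))%C = CInt (fun s => g (r * cis s) - g 0)%C 0 (2 * PI)).
  { rewrite CInt_minus; [|lra|exact Kg|intros; apply ccurve_const].
    assert (I0 : CInt (fun s => g (r * cis s)%C) 0 (2 * PI) = (RtoC (2 * PI) * c O)%C).
    { transitivity (CInt (fun s => g (r * cis s) * cis (- INR 0 * s))%C 0 (2 * PI)).
      - apply CInt_ext; [lra|]; intros s _; simpl.
        replace (- 0 * s) with 0 by ring; rewrite cis_0; ring.
      - rewrite Hc by lra; simpl; ring. }
    rewrite I0.
    replace (CInt (fun _ => g 0) 0 (2 * PI)) with (RtoC (2 * PI) * g 0)%C; [ring|].
    transitivity (CInt (fun x => g 0 + 0 * RtoC x)%C 0 (2 * PI)).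
    - rewrite CInt_affine by lra; rewrite Rminus_0_r; ring.
    - apply CInt_ext; [lra|]; intros; ring. }
  apply (Rmult_le_reg_l (2 * PI)); [lra|].
  assert (E2 := f_equal Cmod E); rewrite Cmod_mult, Cmod_R, Rabs_right in E2 by lra.
  rewrite E2.
  replace (2 * PI * eps) with (eps * (2 * PI - 0)) by ring.
  apply CInt_norm_const; [lra| |].
  - intros s Hs; apply ccurve_minus; [auto|apply ccurve_const].
  - intros s _; apply Rlt_le, Hw.
    replace (r * cis s - 0)%C with (r * cis s)%C by ring; rewrite Cmod_circle; lra.
Qed.

Lemma coefficient_bound (g : C -> C) (c : nat -> C) (r : R) :
  holo Disc g -> fourier g c -> 0 < r < 1 ->
  exists K, 0 <= K /\ forall k, Cmod (c k) * r ^ k <= K.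
Proof.
  intros Hg Hc Hr; pose proof PI_RGT_0 as HPI.
  destruct (bounded_on_circle g r Hg ltac:(lra)) as [M [HM HB]].
  exists M; split; [exact HM|]; intros k.
  apply (Rmult_le_reg_l (2 * PI)); [lra|].
  assert (E := f_equal Cmod (Hc k r Hr)).
  rewrite !Cmod_mult, !Cmod_R, Rabs_right in E by lra.
  rewrite (Rabs_right (r ^ k)) in E by (apply Rle_ge, pow_le; lra).
  rewrite <- E.
  replace (2 * PI * M) with (M * (2 * PI - 0)) by ring.
  apply CInt_norm_const; [lra| |].
  - intros s Hs; apply ccurve_fourier; [exact Hg|lra].
  - intros s Hs; rewrite Cmod_mult, Cmod_cis, Rmult_1_r; apply HB, Hs.
Qed.

(** Mode [S k] of [Cconj g] is the conjugate of mode [- S k] of [g], which is [0]. Adding it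
    replaces [g] by [2 Re g] under the integral. The index starts at [1] because the constant mode
    has no such partner. *)
Lemma coefficient_re (g : C -> C) (c : nat -> C) (r : R) (k : nat) :
  holo Disc g -> fourier g c -> 0 < r < 1 ->
  Cmod (c (S k)) * r ^ S k * (2 * PI) <= RInt (fun t => 2 * Rabs (Re (g (r * cis t)%C))) 0 (2 * PI).
Proof.
  intros Hg Hc Hr; pose proof PI_RGT_0 as HPI.
  set (n := INR (S k)).
  assert (K1 : forall a s, 0 <= s <= 2 * PI -> ccurve (fun s => g (r * cis s) * cis (a * s))%C s)
    by (intros a s _; apply ccurve_fourier; [exact Hg|lra]).
  assert (Kg : forall s, 0 <= s <= 2 * PI -> ccurve (fun s => g (r * cis s)%C) s)
    by (intros s _; apply ccurve_holo_circle; [exact Hg|lra]).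
  assert (Kr : forall s, 0 <= s <= 2 * PI -> continuous (fun s => Re (g (r * cis s)%C)) s)
    by (intros s Hs; apply ccurve_re, Kg, Hs).
  assert (E : CInt (fun s => RtoC (2 * Re (g (r * cis s)%C)) * cis (- n * s))%C 0 (2 * PI)
    = (RtoC (2 * PI) * (c (S k) * RtoC (r ^ S k)))%C).
  { rewrite <- Hc by exact Hr; fold n.
    transitivity (CInt (fun s => g (r * cis s) * cis (- n * s) + Cconj (g (r * cis s) * cis (n * s)))%C 0 (2 * PI)).
    - apply CInt_ext; [lra|]; intros s _.
      replace (- n * s) with (- (n * s)) by ring; rewrite cis_opp, Cmult_conj, <- Cmult_plus_distr_r.
      f_equal; apply injective_projections; simpl; unfold Re; ring.
    - rewrite CInt_plus; [|lra|apply K1|intros s Hs; apply ccurve_conj, K1, Hs].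
      rewrite CInt_conj by (auto; lra).
      unfold n at 2; rewrite circle_int_negative by assumption.
      apply injective_projections; simpl; ring. }
  assert (E2 := f_equal Cmod E).
  rewrite !Cmod_mult, !Cmod_R, (Rabs_right (2 * PI)) in E2 by lra.
  rewrite (Rabs_right (r ^ S k)) in E2 by (apply Rle_ge, pow_le; lra).
  rewrite Rmult_comm, <- E2.
  assert (K2 : forall s, 0 <= s <= 2 * PI -> continuous (fun s => 2 * Re (g (r * cis s)%C)) s).
  { intros s Hs; apply (continuous_scal_r (V := R_NormedModule) 2 (fun s => Re (g (r * cis s)%C))), Kr, Hs. }
  apply CInt_norm; [lra| | |].
  - intros s Hs; apply ccurve_mult; [apply ccurve_RtoC, K2, Hs|apply ccurve_cis, continuous_mult_l].
  - apply (ex_RInt_continuous (V := R_CompleteNormedModule)); intros s Hs.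
    rewrite Rmin_left, Rmax_right in Hs by lra.
    apply (continuous_scal_r (V := R_NormedModule) 2 (fun s => Rabs (Re (g (r * cis s)%C)))).
    apply (continuous_comp (fun s => Re (g (r * cis s)%C)) Rabs); [apply Kr, Hs|apply continuous_Rabs].
  - intros s _; rewrite Cmod_mult, Cmod_cis, Cmod_R, Rabs_mult, (Rabs_right 2); lra.
Qed.

Lemma coefficient_re_bound (g : C -> C) (c : nat -> C) (r M : R) (k : nat) :
  holo Disc g -> fourier g c -> 0 < r < 1 ->
  (forall z, Disc z -> Rabs (Re (g z)) <= M) -> Cmod (c (S k)) * r ^ S k <= 2 * M.
Proof.
  intros Hg Hc Hr HM; pose proof PI_RGT_0 as HPI.
  pose proof (coefficient_re g c r k Hg Hc Hr) as H.
  apply (Rmult_le_reg_r (2 * PI)); [lra|].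
  eapply Rle_trans; [exact H|].
  eapply Rle_trans; [apply Rle_abs|].
  replace (2 * M * (2 * PI)) with ((2 * PI - 0) * (2 * M)) by ring.
  apply abs_RInt_le_const; [lra| |].
  - apply (ex_RInt_continuous (V := R_CompleteNormedModule)); intros s Hs.
    apply (continuous_scal_r (V := R_NormedModule) 2 (fun s => Rabs (Re (g (r * cis s)%C)))).
    apply (continuous_comp (fun s => Re (g (r * cis s)%C)) Rabs); [|apply continuous_Rabs].
    apply ccurve_re, ccurve_holo_circle; [exact Hg|lra].
  - intros s _; rewrite Rabs_mult, Rabs_Rabsolu, (Rabs_right 2) by lra.
    apply Rmult_le_compat_l; [lra|]; apply HM; unfold Disc; rewrite Cmod_circle; lra.
Qed.

(** For a nonnegative real part the absolute value drops out of [coefficient_re], and the mean of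
    [Re g] over the circle is its value at the centre. *)
Lemma coefficient_re_positive (g : C -> C) (c : nat -> C) (r : R) (k : nat) :
  holo Disc g -> fourier g c -> 0 < r < 1 ->
  (forall z, Disc z -> 0 <= Re (g z)) -> Cmod (c (S k)) * r ^ S k <= 2 * Re (g 0).
Proof.
  intros Hg Hc Hr HM; pose proof PI_RGT_0 as HPI.
  pose proof (coefficient_re g c r k Hg Hc Hr) as H.
  apply (Rmult_le_reg_r (2 * PI)); [lra|].
  eapply Rle_trans; [exact H|]; apply Req_le.
  assert (Kg : forall s, 0 <= s <= 2 * PI -> ccurve (fun s => g (r * cis s)%C) s)
    by (intros s _; apply ccurve_holo_circle; [exact Hg|lra]).
  assert (I := is_CInt _ 0 (2 * PI) ltac:(lra) Kg).
  apply is_RInt_pair in I; destruct I as [I _].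
  assert (I0 : CInt (fun s => g (r * cis s)%C) 0 (2 * PI) = (RtoC (2 * PI) * g 0)%C).
  { transitivity (CInt (fun s => g (r * cis s) * cis (- INR 0 * s))%C 0 (2 * PI)).
    - apply CInt_ext; [lra|]; intros s _; simpl.
      replace (- 0 * s) with 0 by ring; rewrite cis_0; ring.
    - rewrite Hc by exact Hr; rewrite (fourier_0 g c Hg Hc); simpl; ring. }
  rewrite I0, re_scal_l in I.
  apply (is_RInt_scal (V := R_NormedModule) _ _ _ 2) in I.
  apply is_RInt_unique.
  replace (2 * Re (g 0) * (2 * PI)) with (2 * (2 * PI * Re (g 0))) by ring.
  refine (is_RInt_ext _ _ _ _ _ _ I).
  intros s _; rewrite Rabs_right; [reflexivity|].
  apply Rle_ge, HM; unfold Disc; rewrite Cmod_circle; lra.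
Qed.

(** Every later partial sum lies within the geometric tail of [psum c m z], hence so do the Cesaro
    means, and these tend to [g z]. The coefficient bound is asked from index [m] on only, so that
    bounds through [Re g], silent about [c 0], can be used. *)
Lemma taylor_remainder (g : C -> C) (c : nat -> C) (K r q : R) (m : nat) (z : C) :
  holo Disc g -> fourier g c -> 0 < r < 1 -> 0 <= K -> 0 <= q < 1 ->
  (forall k, (m <= k)%nat -> Cmod (c k) * r ^ k <= K) -> Cmod z <= q * r ->
  Cmod (g z - psum c m z) <= K * q ^ m / (1 - q).
Proof.
  intros Hg Hc Hr HK Hq HB Hz.
  set (B := K * q ^ m / (1 - q)).
  assert (HB0 : 0 <= B).
  { unfold B, Rdiv; apply Rmult_le_pos; [apply Rmult_le_pos; [exact HK|apply pow_le; lra]|].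
    apply Rlt_le, Rinv_0_lt_compat; lra. }
  assert (T : forall l, (m <= l)%nat -> Cmod (psum c (S l) z - psum c m z) <= B).
  { intros l Hl; replace (S l) with (m + (S l - m))%nat by lia.
    apply csum_geometric_tail; [exact HK|exact Hq|].
    intros k Hk; rewrite Cmod_mult, Cmod_pow.
    apply (Rle_trans _ (Cmod (c k) * (q * r) ^ k)).
    - apply Rmult_le_compat_l; [apply Cmod_ge_0|]; apply pow_incr; split; [apply Cmod_ge_0|exact Hz].
    - rewrite Rpow_mult_distr; specialize (HB k Hk).
      pose proof (pow_le q k ltac:(lra)); nra. }
  destruct (Cmod_csum_eventually (fun l => psum c (S l) z - psum c m z)%C B m HB0 T) as [A1 H1].
  assert (E1 : forall N, csum (fun l => psum c (S l) z - psum c m z)%C N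
    = (cesaro c N z - RtoC (INR N) * psum c m z)%C).
  { intros N; unfold cesaro; induction N as [|N IH]; [simpl; ring|].
    cbn [csum]; rewrite IH, S_INR, RtoC_plus; ring. }
  (* Fejer's theorem is available on circles of positive radius; at the centre all nonempty partial
     sums equal [c 0 = g 0]. *)
  destruct (Req_dec (Cmod z) 0) as [Z0|Z0].
  { apply Cmod_eq_0 in Z0; subst z.
    assert (P0 : forall j, psum c (S j) 0 = c O).
    { induction j as [|j IH]; [unfold psum; simpl; ring|].
      change (psum c (S (S j)) 0) with (psum c (S j) 0 + c (S j) * 0 ^ S j)%C.
      rewrite IH, Cpow_S; ring. }
    rewrite <- (fourier_0 g c Hg Hc), <- (P0 m); apply T; lia. }
  assert (Hz1 : 0 < Cmod z) by (pose proof (Cmod_ge_0 z); lra).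
  assert (Hz2 : Cmod z < 1) by nra.
  destruct (polar z) as [t Et].
  apply le_epsilon; intros eps He.
  destruct (cesaro_convergence g c (Cmod z) t eps Hg Hc (conj Hz1 Hz2) He) as [A2 H2].
  rewrite <- Et in H2.
  apply (le_of_linear_bound _ _ (A1 + A2)); intros N.
  specialize (H1 N); specialize (H2 N); rewrite E1 in H1.
  rewrite <- (Rabs_right (INR N)) at 1 by (apply Rle_ge, pos_INR).
  rewrite <- Cmod_R, <- Cmod_mult.
  replace (RtoC (INR N) * (g z - psum c m z))%C
    with ((cesaro c N z - RtoC (INR N) * psum c m z) - (cesaro c N z - RtoC (INR N) * g z))%C by ring.
  unfold Cminus at 1; eapply Rle_trans; [apply Cmod_triangle|]; rewrite Cmod_opp; lra.
Qed.

Lemma geometric_small (K q eps : R) :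
  0 <= K -> 0 <= q < 1 -> 0 < eps -> exists N, forall m, (N <= m)%nat -> K * q ^ m / (1 - q) < eps.
Proof.
  intros HK Hq He.
  assert (Hp : 0 < eps * (1 - q) / (K + 1)) by (apply Rdiv_lt_0_compat; [apply Rmult_lt_0_compat|]; lra).
  destruct (pow_lt_1_zero q ltac:(rewrite Rabs_right; lra) _ Hp) as [N HN].
  exists N; intros m Hm; specialize (HN m Hm).
  rewrite Rabs_right in HN by (apply Rle_ge, pow_le; lra).
  apply (Rmult_lt_reg_r (1 - q)); [lra|].
  unfold Rdiv; rewrite Rmult_assoc, Rinv_l, Rmult_1_r by lra.
  apply (Rmult_lt_compat_r (K + 1)) in HN; [|lra].
  replace (eps * (1 - q) / (K + 1) * (K + 1)) with (eps * (1 - q)) in HN by (field; lra).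
  pose proof (pow_le q m ltac:(lra)); nra.
Qed.

Lemma taylor_uniform (g : C -> C) (c : nat -> C) (rho eps : R) :
  holo Disc g -> fourier g c -> rho < 1 -> 0 < eps ->
  exists N, forall m, (N <= m)%nat -> forall z, Cmod z <= rho -> Cmod (g z - psum c m z) < eps.
Proof.
  intros Hg Hc Hrho He.
  destruct (Rlt_dec rho 0) as [L|L].
  { exists O; intros m _ z Hz; pose proof (Cmod_ge_0 z); lra. }
  set (r := (1 + rho) / 2).
  assert (Hr : 0 < r < 1) by (unfold r; lra).
  destruct (coefficient_bound g c r Hg Hc Hr) as [K [HK HB]].
  assert (Hq : 0 <= rho / r < 1).
  { split; [apply Rmult_le_pos; [lra|apply Rlt_le, Rinv_0_lt_compat; lra]|].
    apply (Rmult_lt_reg_r r); [lra|]; unfold Rdiv; rewrite Rmult_assoc, Rinv_l by lra; unfold r; lra. }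
  destruct (geometric_small K (rho / r) eps HK Hq He) as [N HN].
  exists N; intros m Hm z Hz.
  eapply Rle_lt_trans; [|apply (HN m Hm)].
  apply (taylor_remainder g c K r); auto.
  replace (rho / r * r) with rho by (field; lra); exact Hz.
Qed.

(** * Cauchy estimates, Weierstrass' theorem, primitives *)

Lemma holo_rescale (g : C -> C) (w : C) (s : R) :
  0 < s -> holo (cball w s) g -> holo Disc (fun z => g (w + s * z)%C).
Proof.
  intros Hs Hg z Hz.
  destruct (Hg (w + s * z)%C) as [l Hl].
  { unfold cball; replace (w + s * z - w)%C with (s * z)%C by ring.
    rewrite Cmod_mult, Cmod_R, Rabs_right by lra; unfold Disc in Hz; nra. }
  eexists; apply (cderiv_comp g (fun z => w + s * z)%C); [exact Hl|].
  apply (cderiv_plus (fun _ => w) (fun z => s * z)%C); [apply cderiv_const|].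
  apply cderiv_scal, cderiv_id.
Qed.

Lemma cderiv_of_quadratic (g : C -> C) (w l : C) (B s : R) :
  0 < s -> (forall h, Cmod h <= s -> Cmod (g (w + h)%C - g w - l * h) <= B * Cmod h ^ 2) ->
  cderiv g w l.
Proof.
  intros Hs H eps He.
  assert (HB : 0 < Rabs B + 1) by (pose proof (Rabs_pos B); lra).
  exists (Rmin s (eps / (Rabs B + 1))); split.
  { apply Rmin_pos; [exact Hs|apply Rdiv_lt_0_compat; assumption]. }
  intros z Hz.
  assert (H1 := Rlt_le_trans _ _ _ Hz (Rmin_l _ _)).
  assert (H2 := Rlt_le_trans _ _ _ Hz (Rmin_r _ _)).
  specialize (H (z - w)%C (Rlt_le _ _ H1)).
  replace (w + (z - w))%C with z in H by ring.
  eapply Rle_trans; [exact H|].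
  apply (Rmult_lt_compat_r _ _ _ HB) in H2.
  replace (eps / (Rabs B + 1) * (Rabs B + 1)) with eps in H2 by (field; lra).
  pose proof (Cmod_ge_0 (z - w)); pose proof (Rle_abs B).
  simpl; nra.
Qed.

(** After rescaling to the unit disc, the coefficients satisfy [|c k| / 2^k <= 2 M] for [k >= 1].
    The case [k = 1] bounds the derivative by [4 M / s], and the remainder after two terms is the
    quadratic error. *)
Lemma cauchy_estimates (g : C -> C) (w : C) (s M : R) :
  0 < s -> holo (cball w s) g -> (forall z, cball w s z -> Rabs (Re (g z)) <= M) ->
  exists l, cderiv g w l /\ Cmod l <= 4 * M / s /\
    forall h, Cmod h <= s / 4 -> Cmod (g (w + h)%C - g w - l * h) <= 16 * M / s ^ 2 * Cmod h ^ 2.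
Proof.
  intros Hs Hg HM.
  pose proof (holo_rescale g w s Hs Hg) as Hf.
  set (f := fun z => g (w + s * z)%C) in *.
  destruct (fourier_exists f Hf) as [c Hc].
  assert (HM' : forall z, Disc z -> Rabs (Re (f z)) <= M).
  { intros z Hz; apply HM; unfold cball; replace (w + s * z - w)%C with (s * z)%C by ring.
    rewrite Cmod_mult, Cmod_R, Rabs_right by lra; unfold Disc in Hz; nra. }
  assert (HM0 : 0 <= M).
  { eapply Rle_trans; [apply Rabs_pos|apply (HM w)].
    unfold cball; replace (w - w)%C with (RtoC 0) by ring; rewrite Cmod_0; exact Hs. }
  assert (Hk : forall k, Cmod (c (S k)) * (1 / 2) ^ S k <= 2 * M).
  { intros k; apply (coefficient_re_bound f c (1 / 2) M k Hf Hc); [lra|exact HM']. }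
  assert (Hs0 : RtoC s <> 0) by (intros D; apply RtoC_inj in D; lra).
  assert (T : forall h, Cmod h <= s / 4 ->
    Cmod (g (w + h)%C - g w - c 1%nat / s * h) <= 16 * M / s ^ 2 * Cmod h ^ 2).
  { intros h Hh.
    (* The ratio of [|h| / s] to the radius [1 / 2]. From [|h| <= s / 4] one gets [q <= 1 / 2], so
       the remainder [2 M q^2 / (1 - q)] is at most [4 M q^2 = 16 M |h|^2 / s^2]. *)
    set (q := 2 * (Cmod h / s)).
    assert (Ez : Cmod (h / s) = Cmod h / s).
    { rewrite Cmod_div, Cmod_R, Rabs_right by (auto; lra); reflexivity. }
    assert (Hq : 0 <= q <= 1 / 2).
    { unfold q; split.
      - apply Rmult_le_pos; [lra|]; apply Rmult_le_pos; [apply Cmod_ge_0|apply Rlt_le, Rinv_0_lt_compat, Hs].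
      - assert (Cmod h / s <= 1 / 4); [|lra].
        apply (Rmult_le_reg_r s); [exact Hs|]; unfold Rdiv; rewrite (Rmult_assoc (Cmod h)), Rinv_l by lra; lra. }
    pose proof (taylor_remainder f c (2 * M) (1 / 2) q 2 (h / s)%C Hf Hc ltac:(lra) ltac:(lra) ltac:(lra)) as R.
    assert (P2 : psum c 2 (h / s) = (g w + c 1%nat / s * h)%C).
    { unfold psum; simpl; rewrite (fourier_0 f c Hf Hc); unfold f.
      replace (w + s * 0)%C with w by ring; field; exact Hs0. }
    rewrite P2 in R; unfold f in R.
    replace (w + s * (h / s))%C with (w + h)%C in R by (field; exact Hs0).
    replace (g (w + h)%C - g w - c 1%nat / s * h)%C with (g (w + h)%C - (g w + c 1%nat / s * h))%C by ring.
    eapply Rle_trans; [apply R|].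
    - intros k Hk2; destruct k as [|k]; [lia|apply Hk].
    - rewrite Ez; unfold q; lra.
    - replace (16 * M / s ^ 2 * Cmod h ^ 2) with (4 * M * q ^ 2) by (unfold q; field; lra).
      assert (Hi : / (1 - q) <= 2).
      { replace 2 with (/ (1 / 2)) by field; apply Rinv_le_contravar; lra. }
      unfold Rdiv; pose proof (pow2_ge_0 q).
      apply (Rle_trans _ (2 * M * q ^ 2 * 2)); [|lra].
      apply Rmult_le_compat_l; [apply Rmult_le_pos; lra|exact Hi]. }
  exists (c 1%nat / s)%C; split; [|split; [|exact T]].
  - apply (cderiv_of_quadratic g w _ (16 * M / s ^ 2) (s / 4)); [lra|exact T].
  - rewrite Cmod_div, Cmod_R, Rabs_right by (auto; lra).
    unfold Rdiv; apply Rmult_le_compat_r; [apply Rlt_le, Rinv_0_lt_compat, Hs|].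
    specialize (Hk O); simpl in Hk; lra.
Qed.

Lemma holo_minus (U : C -> Prop) (f g : C -> C) :
  holo U f -> holo U g -> holo U (fun z => f z - g z)%C.
Proof.
  intros Hf Hg z Hz; destruct (Hf z Hz) as [a Ha]; destruct (Hg z Hz) as [b Hb].
  exists (a - b)%C; apply cderiv_minus; assumption.
Qed.

Lemma holo_mult (U : C -> Prop) (f g : C -> C) :
  holo U f -> holo U g -> holo U (fun z => f z * g z)%C.
Proof.
  intros Hf Hg z Hz; destruct (Hf z Hz) as [a Ha]; destruct (Hg z Hz) as [b Hb].
  eexists; apply cderiv_mult; eassumption.
Qed.

Lemma holo_scal (U : C -> Prop) (c : C) (f : C -> C) :
  holo U f -> holo U (fun z => c * f z)%C.
Proof.
  intros Hf z Hz; destruct (Hf z Hz) as [a Ha]; eexists; apply cderiv_scal; eassumption.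
Qed.

Lemma holo_subset (U V : C -> Prop) (f : C -> C) :
  (forall z, V z -> U z) -> holo U f -> holo V f.
Proof. intros H Hf z Hz; apply Hf, H, Hz. Qed.

Lemma cball_center (w : C) (r : R) : 0 < r -> cball w r w.
Proof. intros H; unfold cball; replace (w - w)%C with (RtoC 0) by ring; rewrite Cmod_0; exact H. Qed.

Lemma cderiv_bound (g : C -> C) (w l : C) (s M : R) :
  0 < s -> holo (cball w s) g -> (forall z, cball w s z -> Cmod (g z) <= M) ->
  cderiv g w l -> Cmod l <= 4 * M / s.
Proof.
  intros Hs Hg HM Hl.
  destruct (cauchy_estimates g w s M Hs Hg) as [l' [H1 [H2 _]]].
  - intros z Hz; eapply Rle_trans; [apply re_le_Cmod|apply HM, Hz].
  - rewrite (cderiv_unique g w l l' Hl H1); exact H2.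
Qed.

Lemma C_cauchy_complete (u : nat -> C) :
  (forall eps, 0 < eps -> exists N, forall n m, (N <= n)%nat -> (N <= m)%nat -> Cmod (u n - u m) < eps) ->
  exists l, forall eps, 0 < eps -> exists N, forall n, (N <= n)%nat -> Cmod (u n - l) < eps.
Proof.
  intros H.
  assert (C1 : Cauchy_crit (fun n => Re (u n))).
  { intros eps He; destruct (H eps He) as [N HN]; exists N; intros n m Hn Hm.
    eapply Rle_lt_trans; [|apply (HN n m Hn Hm)]; exact (re_le_Cmod (u n - u m)). }
  assert (C2 : Cauchy_crit (fun n => Im (u n))).
  { intros eps He; destruct (H eps He) as [N HN]; exists N; intros n m Hn Hm.
    eapply Rle_lt_trans; [|apply (HN n m Hn Hm)]; exact (im_le_Cmod (u n - u m)). }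
  destruct (Rcomplete.R_complete _ C1) as [a Ha]; destruct (Rcomplete.R_complete _ C2) as [b Hb].
  exists (a, b); intros eps He.
  destruct (Ha (eps / 2) ltac:(lra)) as [N1 H1]; destruct (Hb (eps / 2) ltac:(lra)) as [N2 H2].
  exists (max N1 N2); intros n Hn.
  specialize (H1 n ltac:(lia)); specialize (H2 n ltac:(lia)).
  unfold Rdist in H1, H2.
  eapply Rle_lt_trans; [apply Cmod_le_abs|].
  change (Rabs (Re (u n) - a) + Rabs (Im (u n) - b) < eps); lra.
Qed.

(** Cauchy's estimate applied to differences makes the derivatives at [w] a Cauchy sequence. A
    quadratic remainder with a constant common to all large [n] then shows that their limit is the
    derivative of [g]. *)
Lemma weierstrass (G : nat -> C -> C) (g : C -> C) (w : C) (s : R) :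
  0 < s -> (forall n, holo (cball w s) (G n)) ->
  (forall eps, 0 < eps -> exists N, forall n, (N <= n)%nat ->
    forall z, cball w s z -> Cmod (G n z - g z) < eps) ->
  exists l, cderiv g w l /\
    forall L : nat -> C, (forall n, cderiv (G n) w (L n)) ->
    forall eps, 0 < eps -> exists N, forall n, (N <= n)%nat -> Cmod (L n - l) < eps.
Proof.
  intros Hs HG Hu.
  destruct (Hu 1 Rlt_0_1) as [N0 HN0].
  destruct (holo_ccont _ _ w (HG N0) (cball_center w s Hs) 1 Rlt_0_1) as [dl [Hd Hw]].
  (* On the smaller ball [G N0] stays within [1] of its value at [w]; two further errors below [1]
     link [G n] to [G N0] through [g], whence the [3] in [B]. *)
  set (s' := Rmin s dl).
  assert (Hs' : 0 < s') by (apply Rmin_pos; assumption).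
  assert (Hsub : forall z, cball w s' z -> cball w s z)
    by (intros z Hz; eapply Rlt_le_trans; [exact Hz|apply Rmin_l]).
  set (B := Cmod (G N0 w) + 3).
  assert (HB : forall n z, (N0 <= n)%nat -> cball w s' z -> Cmod (G n z) <= B).
  { intros n z Hn Hz.
    assert (H1 := HN0 n Hn z (Hsub z Hz)); assert (H2 := HN0 N0 (le_n _) z (Hsub z Hz)).
    assert (H3 := Hw z (Rlt_le_trans _ _ _ Hz (Rmin_r _ _))).
    rewrite Cmod_minus_sym in H2.
    replace (G n z) with ((G n z - g z) + ((g z - G N0 z) + ((G N0 z - G N0 w) + G N0 w)))%C by ring.
    pose proof (Cmod_triangle (G n z - g z) ((g z - G N0 z) + ((G N0 z - G N0 w) + G N0 w))).
    pose proof (Cmod_triangle (g z - G N0 z) ((G N0 z - G N0 w) + G N0 w)).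
    pose proof (Cmod_triangle (G N0 z - G N0 w) (G N0 w)).
    unfold B; lra. }
  assert (HL : forall n, exists l, cderiv (G n) w l) by (intros n; apply HG, cball_center, Hs).
  set (L := fun n => proj1_sig (constructive_indefinite_description _ (HL n))).
  assert (DL : forall n, cderiv (G n) w (L n))
    by (intros n; exact (proj2_sig (constructive_indefinite_description _ (HL n)))).
  assert (CL : forall eps, 0 < eps -> exists N, forall n m, (N <= n)%nat -> (N <= m)%nat -> Cmod (L n - L m) < eps).
  { intros eps He.
    (* Differences are at most [2 e] on the ball, so their derivatives are at most
       [4 (2 e) / s' = eps / 2]. *)
    set (e := eps * s' / 16).
    assert (Hep : 0 < e) by (unfold e; apply Rmult_lt_0_compat; [apply Rmult_lt_0_compat|]; lra).
    destruct (Hu e Hep) as [N HN]; exists N; intros n m Hn Hm.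
    eapply Rle_lt_trans.
    - apply (cderiv_bound (fun z => G n z - G m z)%C w (L n - L m)%C s' (2 * e) Hs').
      + apply holo_minus; apply (holo_subset _ _ _ Hsub), HG.
      + intros z Hz.
        assert (H1 := HN n Hn z (Hsub z Hz)); assert (H2 := HN m Hm z (Hsub z Hz)).
        rewrite Cmod_minus_sym in H2.
        replace (G n z - G m z)%C with ((G n z - g z) + (g z - G m z))%C by ring.
        pose proof (Cmod_triangle (G n z - g z) (g z - G m z)); lra.
      + apply cderiv_minus; apply DL.
    - unfold e; replace (4 * (2 * (eps * s' / 16)) / s') with (eps / 2) by (field; lra); lra. }
  destruct (C_cauchy_complete L CL) as [l Hl].
  exists l; split.
  (* The bound is inherited from a single large [G n]: replacing [G n (w + h)], [G n w] and [L n] by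
     their limits costs at most [eps / 4] each. *)
  - apply (cderiv_of_quadratic g w l (16 * B / s' ^ 2) (s' / 8)); [lra|].
    intros h Hh; apply le_epsilon; intros eps He.
    set (e := Rmin (eps / 4) (eps / (4 * (Cmod h + 1)))).
    assert (Hh0 : 0 < Cmod h + 1) by (pose proof (Cmod_ge_0 h); lra).
    assert (Hep : 0 < e) by (apply Rmin_pos; [lra|apply Rdiv_lt_0_compat; lra]).
    assert (He1 : e <= eps / 4) by apply Rmin_l.
    assert (He2 : e * (Cmod h + 1) <= eps / 4).
    { apply (Rle_trans _ (eps / (4 * (Cmod h + 1)) * (Cmod h + 1))).
      - apply Rmult_le_compat_r; [lra|apply Rmin_r].
      - apply Req_le; field; lra. }
    destruct (Hu e Hep) as [N1 HN1]; destruct (Hl e Hep) as [N2 HN2].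
    set (n := max N0 (max N1 N2)).
    assert (Hcb : cball w s' (w + h)%C).
    { unfold cball; replace (w + h - w)%C with h by ring; lra. }
    assert (H1 := HN1 n ltac:(lia) _ (Hsub _ Hcb)).
    assert (H2 := HN1 n ltac:(lia) _ (cball_center w s Hs)).
    assert (H3 := HN2 n ltac:(lia)).
    destruct (cauchy_estimates (G n) w s' B Hs') as [l' [D1 [_ D2]]].
    { apply (holo_subset _ _ _ Hsub), HG. }
    { intros z Hz; eapply Rle_trans; [apply re_le_Cmod|apply HB; [lia|exact Hz]]. }
    rewrite (cderiv_unique _ _ _ _ D1 (DL n)) in D2.
    specialize (D2 h ltac:(lra)).
    rewrite Cmod_minus_sym in H1.
    replace (g (w + h)%C - g w - l * h)%C
      with ((G n (w + h)%C - G n w - L n * h) + ((g (w + h)%C - G n (w + h)%C) + ((G n w - g w) + (L n - l) * h)))%C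
      by ring.
    eapply Rle_trans; [apply Cmod_triangle|].
    pose proof (Cmod_triangle (g (w + h)%C - G n (w + h)%C) ((G n w - g w) + (L n - l) * h)).
    pose proof (Cmod_triangle (G n w - g w) ((L n - l) * h)).
    rewrite Cmod_mult in H0.
    assert (Cmod (L n - l) * Cmod h <= e * (Cmod h + 1)).
    { apply Rmult_le_compat; try apply Cmod_ge_0; lra. }
    lra.
  - intros L' HL' eps He; destruct (Hl eps He) as [N HN]; exists N; intros n Hn.
    rewrite (cderiv_unique _ _ _ _ (HL' n) (DL n)); apply HN, Hn.
Qed.

Lemma Disc_cball (w : C) : Disc w -> forall z, cball w (1 - Cmod w) z -> Disc z.
Proof.
  unfold Disc, cball; intros Hw z Hz.
  replace z with ((z - w) + w)%C by ring.
  pose proof (Cmod_triangle (z - w) w); lra.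
Qed.

Definition dcoef (c : nat -> C) (k : nat) : C := (RtoC (INR (S k)) * c (S k))%C.
Definition icoef (c : nat -> C) (k : nat) : C :=
  match k with O => 0 | S j => (c j / RtoC (INR (S j)))%C end.

Lemma cderiv_pow (n : nat) (z : C) : cderiv (fun w => w ^ S n)%C z (RtoC (INR (S n)) * z ^ n)%C.
Proof.
  induction n as [|n IH].
  - refine (cderiv_eq _ _ _ _ (cderiv_ext (fun w => w) _ z 1 1 Rlt_0_1 _ (cderiv_id z)) _).
    + intros; simpl; ring.
    + simpl; ring.
  - refine (cderiv_eq _ _ _ _ (cderiv_mult (fun w => w) (fun w => w ^ S n)%C _ _ _ (cderiv_id z) IH) _).
    rewrite (S_INR (S n)), RtoC_plus, (Cpow_S z n); ring.
Qed.

(** Since [psum c m] has [m] terms, differentiation loses one: [S m] terms become [m]. *)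
Lemma cderiv_psum (c : nat -> C) (m : nat) (z : C) :
  cderiv (psum c (S m)) z (psum (dcoef c) m z).
Proof.
  induction m as [|m IH].
  - apply (cderiv_ext (fun _ => c O) _ z 0 1 Rlt_0_1).
    + intros w _; unfold psum; simpl; ring.
    + apply cderiv_const.
  - refine (cderiv_eq _ _ _ _ (cderiv_plus _ (fun w => c (S m) * w ^ S m)%C _ _ _ IH
      (cderiv_scal _ _ _ _ (cderiv_pow m z))) _).
    change (psum (dcoef c) (S m) z) with (psum (dcoef c) m z + dcoef c m * z ^ m)%C.
    unfold dcoef at 3; ring.
Qed.

Lemma dcoef_icoef (c : nat -> C) (k : nat) : dcoef (icoef c) k = c k.
Proof.
  unfold dcoef, icoef; field.
  intros D; apply RtoC_inj in D; revert D; apply not_0_INR; lia.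
Qed.

Lemma cderiv_psum_icoef (c : nat -> C) (m : nat) (z : C) :
  cderiv (psum (icoef c) (S m)) z (psum c m z).
Proof.
  refine (cderiv_eq _ _ _ _ (cderiv_psum (icoef c) m z) _).
  unfold psum; induction m as [|m IH]; [reflexivity|simpl; rewrite IH, dcoef_icoef; reflexivity].
Qed.

Lemma holo_psum (U : C -> Prop) (c : nat -> C) (m : nat) : holo U (psum c m).
Proof.
  intros z _; destruct m as [|m].
  - exists 0; apply cderiv_const.
  - eexists; apply cderiv_psum.
Qed.

Lemma cderiv_C_derive (g : C -> C) (z : C) : (exists l, cderiv g z l) -> cderiv g z (C_derive g z).
Proof.
  intros [l Hl]; apply cderiv_is_derive.
  apply C_derive_correct; [exact z|]; exists l; apply cderiv_is_derive; exact Hl.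
Qed.

(** [cderiv_bound] turns the locally uniform convergence of Taylor sums into that of their
    derivatives, which are polynomials; Weierstrass' theorem concludes. *)
Lemma holo_C_derive (g : C -> C) : holo Disc g -> holo Disc (C_derive g).
Proof.
  intros Hg w Hw.
  destruct (fourier_exists g Hg) as [c Hc].
  (* Two successive steps of length [s] from [w] stay inside the circle of radius [(1 + |w|) / 2],
     where the Taylor sums converge uniformly. *)
  set (s := (1 - Cmod w) / 4).
  assert (Hs : 0 < s) by (unfold Disc in Hw; unfold s; lra).
  assert (Hsub : forall z, cball w s z -> forall u, cball z s u -> Cmod u <= (1 + Cmod w) / 2).
  { intros z Hz u Hu.
    replace u with ((u - z) + (z - w) + w)%C by ring.
    pose proof (Cmod_triangle (u - z + (z - w)) w); pose proof (Cmod_triangle (u - z) (z - w)).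
    unfold cball in Hz, Hu; unfold s in Hz, Hu; lra. }
  destruct (weierstrass (fun m => psum (dcoef c) m) (C_derive g) w s Hs) as [l [Hl _]].
  - intros m; apply holo_psum.
  - intros eps He.
    assert (Hep : 0 < eps * s / 8) by (apply Rmult_lt_0_compat; [apply Rmult_lt_0_compat|]; lra).
    destruct (taylor_uniform g c ((1 + Cmod w) / 2) (eps * s / 8) Hg Hc) as [N HN];
      [unfold Disc in Hw; lra|exact Hep|].
    exists N; intros m Hm z Hz.
    rewrite Cmod_minus_sym.
    assert (Hz' : Disc z).
    { pose proof (Hsub z Hz z (cball_center z s Hs)); unfold Disc in *; lra. }
    eapply Rle_lt_trans.
    + apply (cderiv_bound (fun u => g u - psum c (S m) u)%C z _ s (eps * s / 8) Hs).
      * apply holo_minus; [|apply holo_psum].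
        apply (holo_subset Disc); [|exact Hg]; intros u Hu.
        pose proof (Hsub z Hz u Hu); unfold Disc in *; lra.
      * intros u Hu; apply Rlt_le, HN; [lia|apply (Hsub z Hz u Hu)].
      * apply cderiv_minus; [apply cderiv_C_derive, Hg, Hz'|apply cderiv_psum].
    + replace (4 * (eps * s / 8) / s) with (eps / 2) by (field; lra); lra.
  - exists l; exact Hl.
Qed.

(** The Taylor series is integrated term by term. Dividing [c k] by [S k] does not enlarge it, so
    the integrated series has the same geometric tails. *)
Lemma holo_primitive (g : C -> C) :
  holo Disc g -> exists P : C -> C, forall z, Disc z -> cderiv P z (g z).
Proof.
  intros Hg; destruct (fourier_exists g Hg) as [c Hc].
  assert (T : forall rho, 0 < rho < 1 -> exists K q, 0 <= K /\ 0 <= q < 1 /\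
    forall z, Cmod z <= rho -> forall m j, Cmod (psum (icoef c) (m + j) z - psum (icoef c) m z) <= K * q ^ m / (1 - q)).
  { intros rho Hrho; set (r := (1 + rho) / 2).
    assert (Hr : 0 < r < 1) by (unfold r; lra).
    destruct (coefficient_bound g c r Hg Hc Hr) as [K [HK HB]].
    exists K, (rho / r).
    assert (Hq : 0 <= rho / r < 1).
    { split; [apply Rmult_le_pos; [lra|apply Rlt_le, Rinv_0_lt_compat; lra]|].
      apply (Rmult_lt_reg_r r); [lra|]; unfold Rdiv; rewrite Rmult_assoc, Rinv_l by lra; unfold r; lra. }
    repeat split; [exact HK|apply Hq|apply Hq|].
    intros z Hz m j; apply csum_geometric_tail; [exact HK|exact Hq|].
    intros k _; destruct k as [|k].
    - simpl; replace (0 * 1)%C with (RtoC 0) by ring; rewrite Cmod_0; lra.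
    - unfold icoef; rewrite Cmod_mult, Cmod_pow.
      assert (Hn : 1 <= INR (S k)) by (rewrite S_INR; pose proof (pos_INR k); lra).
      rewrite Cmod_div, Cmod_R, Rabs_right by (try (intros D; apply RtoC_inj in D); lra).
      specialize (HB k).
      assert (H1 : Cmod (c k) / INR (S k) <= Cmod (c k)).
      { rewrite <- (Rdiv_1_r (Cmod (c k))) at 2; unfold Rdiv.
        apply Rmult_le_compat_l; [apply Cmod_ge_0|apply Rinv_le_contravar; lra]. }
      apply (Rle_trans _ (Cmod (c k) * ((rho / r) * r) ^ S k)).
      { apply Rmult_le_compat; [| |exact H1|].
        - apply Rmult_le_pos; [apply Cmod_ge_0|apply Rlt_le, Rinv_0_lt_compat; lra].
        - apply pow_le, Cmod_ge_0.
        - apply pow_incr; split; [apply Cmod_ge_0|].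
          replace (rho / r * r) with rho by (field; lra); exact Hz. }
      rewrite Rpow_mult_distr; simpl.
      assert (H3 : 0 <= rho / r * (rho / r) ^ k) by (apply Rmult_le_pos; [lra|apply pow_le; lra]).
      set (Q := rho / r * (rho / r) ^ k) in *.
      assert (Cmod (c k) * (r * r ^ k) <= K).
      { assert (0 <= Cmod (c k) * r ^ k) by (apply Rmult_le_pos; [apply Cmod_ge_0|apply pow_le; lra]).
        nra. }
      nra. }
  (* [Disc z] stands under the existential so that choice yields a function defined on all of
     [C]. *)
  assert (Lim : forall z, exists l, Disc z -> forall eps, 0 < eps -> exists N, forall n, (N <= n)%nat ->
    Cmod (psum (icoef c) n z - l) < eps).
  { intros z; destruct (Rlt_dec (Cmod z) 1) as [D|D].
    2: { exists 0; intros D'; contradiction. }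
    destruct (C_cauchy_complete (fun n => psum (icoef c) n z)) as [l Hl].
    - intros eps He.
      destruct (T ((1 + Cmod z) / 2)) as [K [q [HK [Hq HT]]]]; [pose proof (Cmod_ge_0 z); lra|].
      destruct (geometric_small K q (eps / 2) HK Hq ltac:(lra)) as [N HN].
      exists N; intros n m Hn Hm.
      specialize (HT z ltac:(lra) N).
      assert (Hn' := HT (n - N)%nat); assert (Hm' := HT (m - N)%nat); specialize (HN N (le_n N)).
      replace (N + (n - N))%nat with n in Hn' by lia.
      replace (N + (m - N))%nat with m in Hm' by lia.
      rewrite Cmod_minus_sym in Hm'.
      replace (psum (icoef c) n z - psum (icoef c) m z)%C
        with ((psum (icoef c) n z - psum (icoef c) N z) + (psum (icoef c) N z - psum (icoef c) m z))%C by ring.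
      eapply Rle_lt_trans; [apply Cmod_triangle|]; lra.
    - exists l; intros _; exact Hl. }
  set (P := fun z => proj1_sig (constructive_indefinite_description _ (Lim z))).
  assert (HP : forall z, Disc z -> forall eps, 0 < eps -> exists N, forall n, (N <= n)%nat ->
    Cmod (psum (icoef c) n z - P z) < eps)
    by (intros z; exact (proj2_sig (constructive_indefinite_description _ (Lim z)))).
  exists P; intros w Hw.
  set (s := (1 - Cmod w) / 2).
  assert (Hs : 0 < s) by (unfold Disc in Hw; unfold s; lra).
  destruct (weierstrass (fun m => psum (icoef c) (S m)) P w s Hs) as [l [Hl HL]].
  - intros m; apply holo_psum.
  - intros eps He.
    destruct (T ((1 + Cmod w) / 2)) as [K [q [HK [Hq HT]]]];
      [pose proof (Cmod_ge_0 w); unfold Disc in Hw; lra|].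
    destruct (geometric_small K q (eps / 2) HK Hq ltac:(lra)) as [N HN].
    exists N; intros n Hn z Hz.
    assert (Hz1 : Cmod z <= (1 + Cmod w) / 2).
    { replace z with ((z - w) + w)%C by ring; pose proof (Cmod_triangle (z - w) w).
      unfold cball, s in Hz; lra. }
    destruct (HP z) with (eps := eps / 2) as [N' HN']; [unfold Disc in *; lra|lra|].
    specialize (HN (S n) ltac:(lia)); specialize (HT z Hz1 (S n) N').
    specialize (HN' (S n + N')%nat ltac:(lia)).
    rewrite Cmod_minus_sym in HT.
    replace (psum (icoef c) (S n) z - P z)%C
      with ((psum (icoef c) (S n) z - psum (icoef c) (S n + N') z) + (psum (icoef c) (S n + N') z - P z))%C by ring.
    eapply Rle_lt_trans; [apply Cmod_triangle|]; lra.
  (* The derivatives of the integrated sums are the Taylor sums of [g], so their limit [l] at [w]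
     must be [g w]. *)
  - replace (g w) with l; [exact Hl|].
    specialize (HL (fun m => psum c m w) (fun m => cderiv_psum_icoef c m w)).
    apply Ceq_minus, Cmod_eq_0, Rle_antisym; [|apply Cmod_ge_0].
    apply le_epsilon; intros eps He; rewrite Rplus_0_l.
    destruct (HL (eps / 2) ltac:(lra)) as [N1 HN1].
    destruct (taylor_uniform g c (Cmod w) (eps / 2) Hg Hc Hw ltac:(lra)) as [N2 HN2].
    specialize (HN1 (max N1 N2) ltac:(lia)); specialize (HN2 (max N1 N2) ltac:(lia) w (Rle_refl _)).
    rewrite Cmod_minus_sym in HN1; rewrite Cmod_minus_sym in HN2.
    replace (l - g w)%C with ((l - psum c (max N1 N2) w) + (psum c (max N1 N2) w - g w))%C by ring.
    eapply Rle_trans; [apply Cmod_triangle|]; lra.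
Qed.

(** * Logarithms and Harnack's inequality *)

(** The bridge to one real variable: [u = 1] and [u = Ci] give the partial derivatives, and rays
    from [0] allow the mean value theorem. Dividing by [Cmod u + 1] covers [u = 0]. *)
Lemma is_derive_re_line (g : C -> C) (a u l : C) (t : R) :
  cderiv g (a + t * u)%C l -> is_derive (fun s : R => Re (g (a + s * u)%C)) t (Re (l * u)).
Proof.
  intros H; apply is_derive_Reals; intros eps He.
  assert (Hu : 0 < Cmod u + 1) by (pose proof (Cmod_ge_0 u); lra).
  destruct (H (eps / (Cmod u + 1))) as [dl [Hd Hw]]; [apply Rdiv_lt_0_compat; assumption|].
  assert (Hd' : 0 < dl / (Cmod u + 1)) by (apply Rdiv_lt_0_compat; assumption).
  exists (mkposreal _ Hd'); intros h Hh0 Hh; simpl in Hh.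
  assert (E : (a + RtoC (t + h) * u - (a + t * u) = h * u)%C) by (rewrite RtoC_plus; ring).
  assert (Hah : 0 < Rabs h) by (apply Rabs_pos_lt; exact Hh0).
  assert (Hhu : Rabs h * (Cmod u + 1) < dl).
  { apply (Rmult_lt_compat_r (Cmod u + 1)) in Hh; [|exact Hu].
    replace (dl / (Cmod u + 1) * (Cmod u + 1)) with dl in Hh by (field; lra); exact Hh. }
  specialize (Hw (a + RtoC (t + h) * u)%C).
  rewrite E, Cmod_mult, Cmod_R in Hw.
  specialize (Hw ltac:(nra)).
  apply (Rmult_lt_reg_r (Rabs h)); [exact Hah|].
  rewrite <- Rabs_mult.
  set (D := (g (a + RtoC (t + h) * u) - g (a + t * u) - l * (h * u))%C) in *.
  replace ((((Re (g (a + RtoC (t + h) * u)%C) - Re (g (a + t * u)%C)) / h) - Re (l * u)) * h) with (Re D).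
  - eapply Rle_lt_trans; [apply re_le_Cmod|].
    eapply Rle_lt_trans; [exact Hw|].
    replace (eps / (Cmod u + 1) * (Rabs h * Cmod u)) with (eps * Rabs h * (Cmod u / (Cmod u + 1)))
      by (field; lra).
    rewrite <- (Rmult_1_r (eps * Rabs h)) at 2.
    apply Rmult_lt_compat_l; [apply Rmult_lt_0_compat; assumption|].
    apply (Rmult_lt_reg_r (Cmod u + 1)); [exact Hu|].
    unfold Rdiv; rewrite Rmult_assoc, Rinv_l by lra; lra.
  - unfold D.
    replace (Re (g (a + RtoC (t + h) * u) - g (a + t * u) - l * (h * u))%C)
      with (Re (g (a + RtoC (t + h) * u)%C) - Re (g (a + t * u)%C) - h * Re (l * u))
      by (unfold Re; simpl; ring).
    field; exact Hh0.
Qed.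

Lemma re_mult_opp_Ci (z : C) : Re (- Ci * z) = Im z.
Proof. unfold Re, Im; simpl; ring. Qed.

Lemma is_derive_im_line (g : C -> C) (a u l : C) (t : R) :
  cderiv g (a + t * u)%C l -> is_derive (fun s : R => Im (g (a + s * u)%C)) t (Im (l * u)).
Proof.
  intros H.
  apply (is_derive_ext (fun s : R => Re (- Ci * g (a + s * u)%C))).
  - intros s; apply re_mult_opp_Ci.
  - rewrite <- re_mult_opp_Ci, Cmult_assoc.
    apply (is_derive_re_line (fun z => - Ci * g z)%C), cderiv_scal, H.
Qed.

Lemma Disc_segment (z : C) (t : R) : Disc z -> 0 <= t <= 1 -> Disc (0 + t * z)%C.
Proof.
  unfold Disc; intros Hz Ht; rewrite Cplus_0_l, Cmod_mult, Cmod_R, Rabs_right by lra.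
  pose proof (Cmod_ge_0 z); nra.
Qed.

Lemma constant_of_derive_0 (f : R -> R) :
  (forall t, 0 <= t <= 1 -> is_derive f t 0) -> f 1 = f 0.
Proof.
  intros H.
  destruct (MVT_gen f 0 1 (fun _ => 0)) as [c [_ E]].
  - intros x; rewrite Rmin_left, Rmax_right by lra; intros Hx; apply H; lra.
  - intros x; rewrite Rmin_left, Rmax_right by lra; intros Hx.
    apply continuity_pt_filterlim, (ex_derive_continuous (V := R_NormedModule)); exists 0; apply H; lra.
  - lra.
Qed.

Lemma constant_on_Disc (g : C -> C) :
  (forall z, Disc z -> cderiv g z 0) -> forall z, Disc z -> g z = g 0.
Proof.
  intros H z Hz.
  assert (E1 : Re (g (0 + RtoC 1 * z)%C) = Re (g (0 + RtoC 0 * z)%C)).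
  { apply (constant_of_derive_0 (fun t => Re (g (0 + RtoC t * z)%C))).
    intros t Ht; pose proof (is_derive_re_line g 0 z 0 t (H _ (Disc_segment z t Hz Ht))) as D.
    replace (Re (0 * z)) with 0 in D by (unfold Re; simpl; ring); exact D. }
  assert (E2 : Im (g (0 + RtoC 1 * z)%C) = Im (g (0 + RtoC 0 * z)%C)).
  { apply (constant_of_derive_0 (fun t => Im (g (0 + RtoC t * z)%C))).
    intros t Ht; pose proof (is_derive_im_line g 0 z 0 t (H _ (Disc_segment z t Hz Ht))) as D.
    replace (Im (0 * z)) with 0 in D by (unfold Im; simpl; ring); exact D. }
  replace (0 + RtoC 1 * z)%C with z in E1, E2 by ring.
  replace (0 + RtoC 0 * z)%C with (RtoC 0) in E1, E2 by ring.
  apply injective_projections; assumption.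
Qed.

Lemma Cexp_surjective (z : C) : z <> 0 -> exists w, Cexp w = z.
Proof.
  intros Hz; destruct (polar z) as [t Ht].
  exists (ln (Cmod z), t); rewrite Cexp_cis, exp_ln by (apply Cmod_gt_0; exact Hz).
  symmetry; exact Ht.
Qed.

(** With [H] a primitive of [p' / p], the function [p exp (- H)] has derivative [0], hence is a
    nonzero constant; a logarithm [k0] of that constant corrects [H]. *)
Lemma log_Disc (p : C -> C) :
  holo Disc p -> (forall z, Disc z -> p z <> 0) ->
  exists h, holo Disc h /\ forall z, Disc z -> Cexp (h z) = p z.
Proof.
  intros Hp Hn.
  assert (Hq : holo Disc (fun z => C_derive p z * / p z)%C).
  { apply holo_mult; [apply holo_C_derive, Hp|].
    intros z Hz; destruct (Hp z Hz) as [l Hl].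
    eexists; apply (cderiv_comp Cinv p); [apply cderiv_inv, Hn, Hz|exact Hl]. }
  destruct (holo_primitive _ Hq) as [H HH].
  assert (K : forall z, Disc z -> cderiv (fun w => p w * Cexp (- (1) * H w))%C z 0).
  { intros z Hz.
    refine (cderiv_eq _ _ _ _ (cderiv_mult p (fun w => Cexp (- (1) * H w)%C) z _ _
      (cderiv_C_derive p z (Hp z Hz))
      (cderiv_comp Cexp (fun w => - (1) * H w)%C z _ _ (cderiv_Cexp _) (cderiv_scal _ _ _ _ (HH z Hz)))) _).
    field; apply Hn, Hz. }
  assert (D0 : Disc 0) by (unfold Disc; rewrite Cmod_0; lra).
  destruct (Cexp_surjective (p 0 * Cexp (- (1) * H 0))%C) as [k0 Hk0].
  { apply Cmult_neq_0; [apply Hn, D0|apply Cexp_neq_0]. }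
  exists (fun z => k0 + H z)%C; split.
  - intros z Hz; eexists; apply (cderiv_plus (fun _ => k0) H); [apply cderiv_const|apply HH, Hz].
  - intros z Hz; rewrite Cexp_plus, Hk0, <- (constant_on_Disc _ K z Hz).
    rewrite <- Cmult_assoc, <- Cexp_plus.
    replace (- (1) * H z + H z)%C with (RtoC 0) by ring.
    replace (Cexp 0) with (RtoC 1); [ring|].
    change (RtoC 0) with ((0, 0) : C); rewrite Cexp_cis, exp_0, cis_0; ring.
Qed.

Lemma log_ball (p : C -> C) (w : C) (s : R) :
  0 < s -> holo (cball w s) p -> (forall z, cball w s z -> p z <> 0) ->
  exists h, holo (cball w s) h /\ forall z, cball w s z -> Cexp (h z) = p z.
Proof.
  intros Hs Hp Hn.
  assert (Hs0 : RtoC s <> 0) by (intros D; apply RtoC_inj in D; lra).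
  destruct (log_Disc (fun z => p (w + s * z)%C) (holo_rescale p w s Hs Hp)) as [h [Hh He]].
  { intros z Hz; apply Hn; unfold cball; replace (w + s * z - w)%C with (s * z)%C by ring.
    rewrite Cmod_mult, Cmod_R, Rabs_right by lra; unfold Disc in Hz; nra. }
  assert (HD : forall z, cball w s z -> Disc ((z - w) / s)%C).
  { intros z Hz; unfold Disc; rewrite Cmod_div, Cmod_R, Rabs_right by (auto; lra).
    apply (Rmult_lt_reg_r s); [exact Hs|]; unfold Rdiv; rewrite Rmult_assoc, Rinv_l by lra.
    unfold cball in Hz; lra. }
  exists (fun z => h ((z - w) / s)%C); split.
  - intros z Hz; destruct (Hh _ (HD z Hz)) as [l Hl].
    exists (l * (/ s))%C.
    apply (cderiv_comp h (fun z => (z - w) / s)%C); [exact Hl|].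
    refine (cderiv_eq _ _ _ _ (cderiv_mult (fun z => z - w)%C (fun _ => / s)%C z 1 0 _ (cderiv_const _ _)) _).
    + refine (cderiv_eq _ _ _ _ (cderiv_minus (fun z => z) (fun _ => w) z _ _ (cderiv_id z) (cderiv_const w z)) _); ring.
    + ring.
  - intros z Hz; rewrite He by (apply HD, Hz).
    f_equal; field; exact Hs0.
Qed.

(** By positivity the coefficients are controlled by [Re (h w)] alone. On radius [1 / 2] with ratio
    [1 / 5], that is for [|z - w| <= s / 10], the remainder after the constant term is at most
    [2 Re (h w) (1/5) / (4/5) = Re (h w) / 2]. *)
Lemma harnack (h : C -> C) (w : C) (s : R) :
  0 < s -> holo (cball w s) h -> (forall z, cball w s z -> 0 <= Re (h z)) ->
  forall z, Cmod (z - w) <= s / 10 -> Re (h w) / 2 <= Re (h z).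
Proof.
  intros Hs Hh Hpos z Hz.
  assert (Hs0 : RtoC s <> 0) by (intros D; apply RtoC_inj in D; lra).
  pose proof (holo_rescale h w s Hs Hh) as Hf; set (f := fun z => h (w + s * z)%C) in *.
  destruct (fourier_exists f Hf) as [c Hc].
  assert (F0 : f 0 = h w) by (unfold f; f_equal; ring).
  assert (Hf' : forall z, Disc z -> 0 <= Re (f z)).
  { intros u Hu; apply Hpos; unfold cball; replace (w + s * u - w)%C with (s * u)%C by ring.
    rewrite Cmod_mult, Cmod_R, Rabs_right by lra; unfold Disc in Hu; nra. }
  assert (P0 : 0 <= Re (h w)) by (apply Hpos, cball_center, Hs).
  pose proof (taylor_remainder f c (2 * Re (h w)) (1 / 2) (1 / 5) 1 ((z - w) / s)%C Hf Hc
    ltac:(lra) ltac:(lra) ltac:(lra)) as T.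
  assert (T1 : Cmod (f ((z - w) / s)%C - psum c 1 ((z - w) / s)%C) <= 2 * Re (h w) * (1 / 5) ^ 1 / (1 - 1 / 5)).
  { apply T.
    - intros k Hk; destruct k as [|k]; [lia|].
      rewrite <- F0; apply coefficient_re_positive; auto; lra.
    - rewrite Cmod_div, Cmod_R, Rabs_right by (auto; lra).
      apply (Rmult_le_reg_r s); [exact Hs|]; unfold Rdiv at 1; rewrite Rmult_assoc, Rinv_l by lra; lra. }
  unfold psum in T1; simpl in T1; rewrite (fourier_0 f c Hf Hc), F0 in T1.
  unfold f in T1; replace (w + s * ((z - w) / s))%C with z in T1 by (field; exact Hs0).
  replace (h z - (0 + h w * 1))%C with (h z - h w)%C in T1 by ring.
  pose proof (Rle_trans _ _ _ (re_le_Cmod (h z - h w)) T1) as A.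
  apply Rabs_le_between in A.
  change (Re (h z - h w)) with (Re (h z) - Re (h w)) in A; lra.
Qed.

(** * Functions in the class are limits of polynomials *)

(** Ordinary uniform approximation thus implies approximation for [d]. The difference splits into a
    change of numerator and a change of denominator, each costing at most [|z - w|]. *)
Lemma G_Fin_lipschitz (z w : C) : Cmod (G (Fin z) - G (Fin w)) <= 2 * Cmod (z - w).
Proof.
  simpl; pose proof (Cmod_ge_0 z) as Hz; pose proof (Cmod_ge_0 w) as Hw.
  assert (Nz : RtoC (1 + Cmod z) <> 0) by (intros D; apply RtoC_inj in D; lra).
  assert (Nw : RtoC (1 + Cmod w) <> 0) by (intros D; apply RtoC_inj in D; lra).
  replace (z / RtoC (1 + Cmod z) - w / RtoC (1 + Cmod w))%C
    with ((z - w) / RtoC (1 + Cmod z)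
          + w / RtoC (1 + Cmod w) * (RtoC (Cmod w - Cmod z) / RtoC (1 + Cmod z)))%C.
  2: { replace (Cmod w - Cmod z) with ((1 + Cmod w) - (1 + Cmod z)) by ring.
       rewrite (RtoC_minus (1 + Cmod w)); field; split; assumption. }
  eapply Rle_trans; [apply Cmod_triangle|].
  rewrite Cmod_mult, !Cmod_div, !Cmod_R, (Rabs_right (1 + Cmod z)), (Rabs_right (1 + Cmod w)) by (auto; lra).
  assert (I1 : / (1 + Cmod z) <= 1) by (rewrite <- Rinv_1; apply Rinv_le_contravar; lra).
  assert (I1' : 0 < / (1 + Cmod z)) by (apply Rinv_0_lt_compat; lra).
  assert (I2 : Cmod w / (1 + Cmod w) <= 1).
  { apply (Rmult_le_reg_r (1 + Cmod w)); [lra|]; unfold Rdiv; rewrite Rmult_assoc, Rinv_l by lra; lra. }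
  assert (I2' : 0 <= Cmod w / (1 + Cmod w)).
  { apply Rmult_le_pos; [lra|apply Rlt_le, Rinv_0_lt_compat; lra]. }
  assert (A : Rabs (Cmod w - Cmod z) <= Cmod (z - w)).
  { pose proof (Cmod_rev_triangle z w); pose proof (Cmod_rev_triangle w z) as H2.
    rewrite Cmod_minus_sym in H2; apply Rabs_le; lra. }
  pose proof (Cmod_ge_0 (z - w)) as P; pose proof (Rabs_pos (Cmod w - Cmod z)) as P2.
  unfold Rdiv at 1 3.
  assert (B1 : Cmod (z - w) * / (1 + Cmod z) <= Cmod (z - w)) by nra.
  assert (B2 : Rabs (Cmod w - Cmod z) * / (1 + Cmod z) <= Cmod (z - w)) by nra.
  assert (B3 : 0 <= Rabs (Cmod w - Cmod z) * / (1 + Cmod z)) by (apply Rmult_le_pos; lra).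
  nra.
Qed.

(** * Uniform continuity on the closed disc and approximation by dilation *)

Lemma continuous_on_Disc_bar {U : UniformSpace} (f : C -> U) :
  continuous_on Disc_bar f <->
  forall z, Disc_bar z -> forall eps : posreal, exists delta, 0 < delta /\
    forall w, Disc_bar w -> Cmod (w - z) < delta -> ball (f z) eps (f w).
Proof.
  split.
  - intros H z Hz eps.
    destruct (proj1 (filterlim_locally _ _) (H z Hz) eps) as [dl Hd].
    exists dl; split; [apply cond_pos|]; intros w Hw Hlt; apply Hd; [|exact Hw].
    exact (C_NormedModule_mixin_compat1 z w dl Hlt).
  - intros H z Hz; apply filterlim_locally; intros eps.
    destruct (H z Hz eps) as [dl [Hd Hw]].
    assert (Hd2 : 0 < dl / 2) by lra.
    exists (mkposreal _ Hd2); intros w Hb Dw; apply Hw; [exact Dw|].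
    apply Cmod_lt_of_ball in Hb; simpl in Hb; lra.
Qed.

(** Compactness of the square around the disc, with a gauge at each of its points. A point is within
    [2 delta] of some centre in [Cmod], and a point near it within [3 delta]; hence the factor [3]
    in [L]. *)
Lemma Disc_bar_uniform_continuity (F : C -> C) :
  (forall z, Disc_bar z -> forall eps, 0 < eps -> exists delta, 0 < delta /\
    forall w, Disc_bar w -> Cmod (w - z) < delta -> Cmod (F w - F z) < eps) ->
  forall eps, 0 < eps -> exists delta, 0 < delta /\
    forall z w, Disc_bar z -> Disc_bar w -> Cmod (w - z) < delta -> Cmod (F w - F z) < eps.
Proof.
  intros H eps He.
  assert (L : forall u v, exists dl : posreal, forall a b, Disc_bar a -> Disc_bar b ->
    Cmod (a - (u, v)) < 3 * dl -> Cmod (b - (u, v)) < 3 * dl -> Cmod (F a - F b) < eps).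
  { intros u v; destruct (Rle_dec (Cmod (u, v)) 1) as [D|D].
    - destruct (H (u, v) D (eps / 2) ltac:(lra)) as [dl [Hd Hw]].
      assert (Hd3 : 0 < dl / 3) by lra.
      exists (mkposreal _ Hd3); simpl; intros a b Ha Hb H1 H2.
      assert (K1 := Hw a Ha ltac:(lra)); assert (K2 := Hw b Hb ltac:(lra)).
      rewrite Cmod_minus_sym in K2.
      replace (F a - F b)%C with ((F a - F (u, v)) + (F (u, v) - F b))%C by ring.
      pose proof (Cmod_triangle (F a - F (u, v)) (F (u, v) - F b)); lra.
    (* For a centre in the square but off the disc, the gauge is so small that no point of the disc
       comes near, and the claim is vacuous. *)
    - assert (Hd3 : 0 < (Cmod (u, v) - 1) / 3) by lra.
      exists (mkposreal _ Hd3); simpl; intros a b Ha _ H1 _; exfalso.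
      rewrite Cmod_minus_sym in H1.
      pose proof (Cmod_rev_triangle (u, v) a); unfold Disc_bar in Ha; lra. }
  set (delta := fun u v => proj1_sig (constructive_indefinite_description _ (L u v))).
  destruct (compactness_value_2d (-1) 1 (-1) 1 delta) as [d Hd].
  exists d; split; [apply cond_pos|]; intros [x y] w Hz Hw Hlt.
  assert (Hx : -1 <= x <= 1).
  { apply Rabs_le_between; eapply Rle_trans; [exact (re_le_Cmod (x, y))|exact Hz]. }
  assert (Hy : -1 <= y <= 1).
  { apply Rabs_le_between; eapply Rle_trans; [exact (im_le_Cmod (x, y))|exact Hz]. }
  destruct (NNPP _ (Hd x y Hx Hy)) as [u [v [_ [_ [H1 [H2 H3]]]]]].
  pose proof (proj2_sig (constructive_indefinite_description _ (L u v))) as P.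
  change (forall a b, Disc_bar a -> Disc_bar b ->
    Cmod (a - (u, v)) < 3 * delta u v -> Cmod (b - (u, v)) < 3 * delta u v ->
    Cmod (F a - F b) < eps) in P.
  assert (Q : Cmod ((x, y) - (u, v)) < 2 * delta u v).
  { eapply Rle_lt_trans; [apply Cmod_le_abs|].
    change (Rabs (x - u) + Rabs (y - v) < 2 * delta u v); lra. }
  apply P; try assumption.
  - replace (w - (u, v))%C with ((w - (x, y)) + ((x, y) - (u, v)))%C by ring.
    pose proof (Cmod_triangle (w - (x, y)) ((x, y) - (u, v))); lra.
  - pose proof (cond_pos (delta u v)); lra.
Qed.

Lemma uniform_radial_limit (F : C -> C) :
  (forall z, Disc_bar z -> forall eps, 0 < eps -> exists delta, 0 < delta /\
    forall w, Disc_bar w -> Cmod (w - z) < delta -> Cmod (F w - F z) < eps) ->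
  forall eps, 0 < eps -> exists r, 0 < r < 1 /\
    forall z, Disc_bar z -> Cmod (F (r * z)%C - F z) < eps.
Proof.
  intros H eps He; destruct (Disc_bar_uniform_continuity F H eps He) as [dl [Hd Hw]].
  set (r := 1 - Rmin (1 / 2) (dl / 2)).
  assert (Hm : 0 < Rmin (1 / 2) (dl / 2)) by (apply Rmin_pos; lra).
  pose proof (Rmin_l (1 / 2) (dl / 2)); pose proof (Rmin_r (1 / 2) (dl / 2)).
  exists r; split; [unfold r; lra|]; intros z Hz; unfold Disc_bar in Hz.
  pose proof (Cmod_ge_0 z).
  apply Hw; unfold Disc_bar; [exact Hz| |].
  - rewrite Cmod_mult, Cmod_R, Rabs_right by (unfold r; lra); unfold r; nra.
  - replace (r * z - z)%C with (RtoC (r - 1) * z)%C by (rewrite RtoC_minus; ring).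
    rewrite Cmod_mult, Cmod_R, Rabs_left by (unfold r; lra); unfold r; nra.
Qed.

Lemma psum_sum_n (c : nat -> C) (n : nat) (z : C) :
  psum c (S n) z = sum_n (fun k => Cmult (c k) (Cpow z k)) n.
Proof.
  induction n as [|n IH].
  - rewrite sum_O; unfold psum; simpl; ring.
  - rewrite sum_Sn, <- IH; reflexivity.
Qed.

Lemma is_polynomial_psum (c : nat -> C) (n : nat) (r : C) :
  is_polynomial (fun z => psum c (S n) (r * z)%C).
Proof.
  exists n, (fun k => c k * r ^ k)%C; intros z; rewrite psum_sum_n.
  apply sum_n_ext; intros k.
  change ((c k * (r * z) ^ k)%C = (c k * r ^ k * z ^ k)%C); rewrite Cpow_mult_l; ring.
Qed.

Lemma polynomial_approximation (g : C -> C) (r eps : R) :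
  holo Disc g -> 0 <= r < 1 -> 0 < eps ->
  exists p, is_polynomial p /\ forall z, Disc_bar z -> Cmod (p z - g (r * z)%C) < eps.
Proof.
  intros Hg Hr He; destruct (fourier_exists g Hg) as [c Hc].
  destruct (taylor_uniform g c r eps Hg Hc) as [N HN]; [lra|lra|].
  exists (fun z => psum c (S N) (r * z)%C); split; [apply is_polynomial_psum|].
  intros z Hz; rewrite Cmod_minus_sym; apply HN; [lia|].
  rewrite Cmod_mult, Cmod_R, Rabs_right by lra; unfold Disc_bar in Hz.
  pose proof (Cmod_ge_0 z); nra.
Qed.

Lemma uniform_limit_of_approximation (f : C -> Cbar) :
  (forall eps, 0 < eps -> exists p, is_polynomial p /\
    forall z, Disc_bar z -> d (Fin (p z)) (f z) < eps) ->
  uniform_limit_of_polynomials f.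
Proof.
  intros H.
  assert (Hp : forall n, 0 < / (INR n + 1)) by (intros n; apply Rinv_0_lt_compat; pose proof (pos_INR n); lra).
  set (P := fun n => constructive_indefinite_description _ (H _ (Hp n))).
  exists (fun n => proj1_sig (P n)); split; [intros n; apply (proj2_sig (P n))|].
  intros eps He; destruct (INR_archimed eps 1 He) as [N HN].
  exists N; intros n Hn z Hz.
  eapply Rlt_le_trans; [apply (proj2 (proj2_sig (P n))), Hz|].
  apply le_INR in Hn; pose proof (pos_INR N).
  apply (Rmult_le_reg_r (INR n + 1)); [lra|]; rewrite Rinv_l by lra; nra.
Qed.

Lemma finite_type_limit (f : C -> Cbar) : finite_type f -> uniform_limit_of_polynomials f.
Proof.
  intros [Hf [g [Hfg Hg]]]; apply holo_holomorphic_on in Hg.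
  apply uniform_limit_of_approximation; intros eps He.
  destruct (uniform_radial_limit (fun z => G (f z))) with (eps := eps / 2) as [r [Hr Hrad]]; [|lra|].
  { intros z Hz e Hep.
    destruct (proj1 (continuous_on_Disc_bar f) Hf z Hz (mkposreal e Hep)) as [dl [Hd Hw]].
    exists dl; split; [exact Hd|]; intros w Dw Hlt; rewrite Cmod_minus_sym.
    exact (Hw w Dw Hlt). }
  (* [eps / 4] becomes [eps / 2] through the Lipschitz constant [2] of [G]. *)
  destruct (polynomial_approximation g r (eps / 4) Hg ltac:(lra) ltac:(lra)) as [p [Pp Hp]].
  exists p; split; [exact Pp|]; intros z Hz.
  assert (Hrz : Disc (r * z)%C).
  { unfold Disc; rewrite Cmod_mult, Cmod_R, Rabs_right by lra; unfold Disc_bar in Hz.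
    pose proof (Cmod_ge_0 z); nra. }
  specialize (Hrad z Hz); specialize (Hp z Hz); cbv beta in Hrad; rewrite (Hfg _ Hrz) in Hrad.
  pose proof (d_triangle (Fin (p z)) (Fin (g (r * z)%C)) (f z)) as T.
  pose proof (G_Fin_lipschitz (p z) (g (r * z)%C)) as L.
  unfold d in *; lra.
Qed.

(** * Harmonic functions approximated by real parts of polynomials *)

Lemma Disc_locally_2d (x y : R) : Disc (x, y) -> locally_2d (fun u v => Disc (u, v)) x y.
Proof.
  intros H; unfold Disc in H.
  assert (Hd : 0 < (1 - Cmod (x, y)) / 2) by lra.
  exists (mkposreal _ Hd); simpl; intros u v Hu Hv; unfold Disc.
  replace ((u, v) : C) with (((u, v) - (x, y)) + (x, y))%C by ring.
  pose proof (Cmod_triangle ((u, v) - (x, y)) (x, y)).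
  assert (Cmod ((u, v) - (x, y)) < 1 - Cmod (x, y)); [|lra].
  eapply Rle_lt_trans; [apply Cmod_le_abs|].
  change (Rabs (u - x) + Rabs (v - y) < 1 - Cmod (x, y)); lra.
Qed.

(** Shaped so that [dx (dx h)] and [dy (dy h)] are convertible to the terms of the Laplacian in
    [harmonic_on] and to the derivatives inside [ex_diff_n]. *)
Definition dx (h : R -> R -> R) (u v : R) : R := Derive (fun s => h s v) u.
Definition dy (h : R -> R -> R) (u v : R) : R := Derive (fun s => h u s) v.

Lemma differentiable_of_ex_derive (h : R -> R -> R) (x y : R) :
  Disc (x, y) ->
  (forall u v, Disc (u, v) -> ex_derive (fun s => h s v) u /\ ex_derive (fun s => h u s) v) ->
  continuity_2d_pt (dx h) x y -> differentiable_pt_lim h x y (dx h x y) (dy h x y).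
Proof.
  intros Hxy H Hc; apply differentiable_of_partials; [|apply Derive_correct, H, Hxy|exact Hc].
  destruct (Disc_locally_2d x y Hxy) as [dl Hd]; exists dl; intros u v Hu Hv.
  apply Derive_correct, H, Hd; assumption.
Qed.

Definition coords (theta : C -> R) (s t : R) : R := theta (s, t).

(** For the pair [theta_x, - theta_y], one Cauchy-Riemann equation is the vanishing of the Laplacian
    and the other is the symmetry of mixed derivatives, by Schwarz' theorem. *)
Lemma harmonic_gradient_holo (theta : C -> R) :
  harmonic_on Disc theta ->
  holo Disc (fun z => (dx (coords theta) (fst z) (snd z), - dy (coords theta) (fst z) (snd z))).
Proof.
  intros Htheta; set (h := coords theta).
  intros [x y] Hz.
  assert (H2 : forall u v, Disc (u, v) -> ex_diff_n h 2 u v) by (intros u v Huv; apply (Htheta u v Huv)).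
  assert (L := proj2 (Htheta x y Hz)).
  change (dx (dx h) x y + dy (dy h) x y = 0) in L.
  assert (Ex : forall u v, Disc (u, v) -> ex_derive (fun s => dx h s v) u /\ ex_derive (fun s => dx h u s) v)
    by (intros u v Huv; apply H2 in Huv; destruct Huv as [_ [_ [_ [[_ [A [B _]]] _]]]]; split; assumption).
  assert (Ey : forall u v, Disc (u, v) -> ex_derive (fun s => dy h s v) u /\ ex_derive (fun s => dy h u s) v)
    by (intros u v Huv; apply H2 in Huv; destruct Huv as [_ [_ [_ [_ [_ [A [B _]]]]]]]; split; assumption).
  assert (E0 : forall u v, Disc (u, v) -> ex_derive (fun s => h s v) u /\ ex_derive (fun s => h u s) v)
    by (intros u v Huv; apply H2 in Huv; destruct Huv as [_ [A [B _]]]; split; assumption).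
  destruct (H2 x y Hz) as [_ [_ [_ [[_ [_ [_ [[Cxx _] [Cyx _]]]]] [_ [_ [_ [[Cxy _] [Cyy _]]]]]]]]].
  change (continuity_2d_pt (dx (dx h)) x y) in Cxx.
  change (continuity_2d_pt (dy (dx h)) x y) in Cyx.
  change (continuity_2d_pt (dx (dy h)) x y) in Cxy.
  change (continuity_2d_pt (dy (dy h)) x y) in Cyy.
  assert (Sw : dx (dy h) x y = dy (dx h) x y).
  { apply (Schwarz h x y); [|exact Cxy|exact Cyx].
    destruct (Disc_locally_2d x y Hz) as [dl Hd]; exists dl; intros u v Hu Hv.
    specialize (Hd u v Hu Hv).
    exact (conj (proj1 (E0 u v Hd)) (conj (proj2 (E0 u v Hd)) (conj (proj1 (Ey u v Hd)) (proj2 (Ex u v Hd))))). }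
  exists (dx (dx h) x y, - dx (dy h) x y).
  apply (cderiv_of_CR (dx h) (fun u v => - dy h u v)).
  - rewrite Ropp_involutive, Sw; apply differentiable_of_ex_derive; assumption.
  - replace (dx (dx h) x y) with (- dy (dy h) x y) by lra.
    pose proof (differentiable_of_ex_derive (dy h) x y Hz Ey Cxy) as D.
    apply filterdiff_differentiable_pt_lim in D; apply filterdiff_differentiable_pt_lim.
    apply (filterdiff_ext_lin _ (fun u => opp (fst u * dx (dy h) x y + snd u * dy (dy h) x y))).
    + apply (filterdiff_opp_fct (fun u : R * R => dy h (fst u) (snd u))).
      exact D.
    + intros u; change (- (fst u * dx (dy h) x y + snd u * dy (dy h) x y)
        = fst u * - dx (dy h) x y + snd u * - dy (dy h) x y); ring.
Qed.

Lemma harmonic_line_derive (theta : C -> R) (z : C) (t : R) :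
  harmonic_on Disc theta -> Disc (0 + t * z)%C ->
  is_derive (fun s : R => theta (0 + s * z)%C) t
    (Re ((dx (coords theta) (fst (0 + t * z)%C) (snd (0 + t * z)%C),
          - dy (coords theta) (fst (0 + t * z)%C) (snd (0 + t * z)%C)) * z)).
Proof.
  intros Htheta Hz; set (h := coords theta); set (x := fst (0 + t * z)%C) in *; set (y := snd (0 + t * z)%C) in *.
  assert (Hz' : Disc (x, y)) by (unfold x, y; rewrite <- surjective_pairing; exact Hz).
  assert (D : differentiable_pt_lim h x y (dx h x y) (dy h x y)).
  { apply differentiable_of_ex_derive; [exact Hz'| |].
    - intros u v Huv; destruct (proj1 (Htheta u v Huv)) as [_ [A [B _]]]; split; assumption.
    - destruct (proj1 (Htheta x y Hz')) as [_ [_ [_ [[A _] _]]]]; exact A. }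
  apply is_derive_Reals.
  replace (Re _) with (dx h x y * fst z + dy h x y * snd z) by (unfold Re; simpl; ring).
  assert (D2 := derivable_pt_lim_comp_2d h (fun s => s * fst z) (fun s => s * snd z) t
    (dx h x y) (dy h x y) (fst z) (snd z)).
  assert (Ex : t * fst z = x) by (unfold x; simpl; ring).
  assert (Ey : t * snd z = y) by (unfold y; simpl; ring).
  cbv beta in D2; rewrite Ex, Ey in D2.
  apply is_derive_Reals.
  apply (is_derive_ext (fun s => h (s * fst z) (s * snd z))).
  { intros s; unfold h, coords; f_equal; apply injective_projections; simpl; ring. }
  apply is_derive_Reals, D2; [exact D| |];
    apply is_derive_Reals; auto_derive; trivial; ring.
Qed.

(** The derivative of [theta] along the ray to [z] is [Re (g z)] with [g] the holomorphic gradient.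
    The mean value theorem on the ray turns an [eps] approximation of [g] into one of [theta], as
    [|z| <= 1]. *)
Lemma harmonic_re_approximation (theta : C -> R) (r eps : R) :
  harmonic_on Disc theta -> 0 < r < 1 -> 0 < eps -> exists (c : nat -> C) (m : nat),
    forall z, Cmod z <= r -> Rabs (theta z - Re (psum c m z)) <= eps.
Proof.
  intros Htheta Hr He; set (h := coords theta).
  pose proof (harmonic_gradient_holo theta Htheta) as Hg; fold h in Hg.
  set (g := fun z : C => ((dx h (fst z) (snd z), - dy h (fst z) (snd z)) : C)) in *.
  destruct (fourier_exists g Hg) as [c Hc].
  destruct (taylor_uniform g c r eps Hg Hc) as [N HN]; [lra|lra|].
  set (Q := psum (icoef c) (S N)).
  (* The integrated sum vanishes at [0]; its constant coefficient is replaced by [theta 0] so that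
     both sides agree there. *)
  exists (fun k => match k with O => RtoC (theta 0) | S _ => icoef c k end), (S N).
  intros z Hz.
  assert (EQ : forall k w, psum (fun k => match k with O => RtoC (theta 0) | S _ => icoef c k end) (S k) w
    = (RtoC (theta 0) + psum (icoef c) (S k) w)%C).
  { intros k w; induction k as [|k IH]; [unfold psum; simpl; ring|].
    unfold psum in *; cbn [csum] in *; rewrite IH; ring. }
  rewrite EQ; fold Q.
  assert (Hzt : forall t, 0 <= t <= 1 -> Cmod (0 + t * z) <= r).
  { intros t Ht; rewrite Cplus_0_l, Cmod_mult, Cmod_R, Rabs_right by lra.
    pose proof (Cmod_ge_0 z); nra. }
  set (phi := fun t : R => theta (0 + t * z)%C - Re (Q (0 + t * z)%C)).
  set (dphi := fun t : R => Re ((g (0 + t * z) - psum c N (0 + t * z)) * z)%C).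
  assert (Dphi : forall t, 0 <= t <= 1 -> is_derive phi t (dphi t)).
  { intros t Ht.
    assert (D1 := harmonic_line_derive theta z t Htheta).
    assert (D2 := is_derive_re_line Q 0 z _ t (cderiv_psum_icoef c N (0 + t * z)%C)).
    assert (Hd : Disc (0 + t * z)%C) by (specialize (Hzt t Ht); unfold Disc; lra).
    specialize (D1 Hd).
    assert (E : dphi t = minus (Re (g (0 + t * z)%C * z)) (Re (psum c N (0 + t * z)%C * z))).
    { change (minus ?a ?b) with (a - b); unfold dphi, Re; simpl; ring. }
    rewrite E; exact (is_derive_minus _ _ _ _ _ D1 D2). }
  destruct (MVT_gen phi 0 1 dphi) as [t [Ht E]].
  - intros t; rewrite Rmin_left, Rmax_right by lra; intros Ht; apply Dphi; lra.
  - intros t; rewrite Rmin_left, Rmax_right by lra; intros Ht.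
    apply continuity_pt_filterlim, (ex_derive_continuous (V := R_NormedModule)); eexists; apply Dphi; lra.
  - rewrite Rmin_left, Rmax_right in Ht by lra.
    assert (E1 : phi 1 - phi 0 = theta z - Re (RtoC (theta 0) + Q z)).
    { unfold phi; replace (0 + RtoC 1 * z)%C with z by ring.
      replace (0 + RtoC 0 * z)%C with (RtoC 0) by ring.
      replace (Q 0) with (RtoC 0).
      - unfold Re; simpl; ring.
      - unfold Q; clear; induction N as [|N IH]; [unfold psum; simpl; ring|].
        change (psum (icoef c) (S (S N)) 0) with (psum (icoef c) (S N) 0 + icoef c (S N) * 0 ^ S N)%C.
        rewrite <- IH, Cpow_S; ring. }
    rewrite <- E1, E, Rminus_0_r, Rmult_1_r; unfold dphi.
    eapply Rle_trans; [apply re_le_Cmod|]; rewrite Cmod_mult.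
    specialize (HN N (le_n N) _ (Hzt t Ht)).
    pose proof (Cmod_ge_0 z); pose proof (Cmod_ge_0 (g (0 + t * z)%C - psum c N (0 + t * z))); nra.
Qed.

Lemma lipschitz_of_derive (f df : R -> R) (a b : R) :
  (forall t, is_derive f t (df t)) -> (forall t, Rabs (df t) <= 1) -> Rabs (f b - f a) <= Rabs (b - a).
Proof.
  intros H HB.
  destruct (MVT_gen f a b df) as [c [_ E]].
  - intros x _; apply H.
  - intros x _; apply continuity_pt_filterlim, (ex_derive_continuous (V := R_NormedModule)).
    eexists; apply H.
  - rewrite E, Rabs_mult; specialize (HB c); pose proof (Rabs_pos (b - a)); nra.
Qed.

Lemma cis_lipschitz (a b : R) : Cmod (cis a - cis b) <= 2 * Rabs (a - b).
Proof.
  eapply Rle_trans; [apply Cmod_le_abs|].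
  assert (Rabs (cos a - cos b) <= Rabs (a - b)).
  { apply (lipschitz_of_derive cos (fun x => - sin x)); intros t.
    - apply is_derive_Reals, derivable_pt_lim_cos.
    - rewrite Rabs_Ropp; apply Rabs_le; destruct (SIN_bound t); lra. }
  assert (Rabs (sin a - sin b) <= Rabs (a - b)).
  { apply (lipschitz_of_derive sin cos); intros t.
    - apply is_derive_Reals, derivable_pt_lim_sin.
    - apply Rabs_le; destruct (COS_bound t); lra. }
  change (Rabs (cos a - cos b) + Rabs (sin a - sin b) <= 2 * Rabs (a - b)); lra.
Qed.

Lemma psum_bounded (c : nat -> C) (m : nat) :
  exists B, forall z, Cmod z <= 1 -> Cmod (psum c m z) <= B.
Proof.
  induction m as [|m [B HB]].
  - exists 0; intros z _; unfold psum; simpl; rewrite Cmod_0; lra.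
  - exists (B + Cmod (c m)); intros z Hz.
    change (psum c (S m) z) with (psum c m z + c m * z ^ m)%C.
    eapply Rle_trans; [apply Cmod_triangle|].
    specialize (HB z Hz); rewrite Cmod_mult, Cmod_pow.
    assert (Cmod z ^ m <= 1) by (rewrite <- (pow1 m); apply pow_incr; split; [apply Cmod_ge_0|exact Hz]).
    pose proof (Cmod_ge_0 (c m)); nra.
Qed.

Lemma G_Fin_polar (rho t : R) : 0 <= rho -> Cmod (G (Fin (rho * cis t)) - cis t) = / (1 + rho).
Proof.
  intros Hr; simpl G; rewrite Cmod_circle by exact Hr.
  assert (N : RtoC (1 + rho) <> 0) by (intros D; apply RtoC_inj in D; lra).
  replace (rho * cis t / RtoC (1 + rho) - cis t)%C with (- (1) * / RtoC (1 + rho) * cis t)%C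
    by (rewrite RtoC_plus in *; field; exact N).
  rewrite !Cmod_mult, Cmod_opp, Cmod_1, Cmod_cis, Cmod_inv, Cmod_R, Rabs_right by (auto; lra); ring.
Qed.

Lemma holo_affine_comp (U : C -> Prop) (g : C -> C) (a : C) :
  (forall z, exists l, cderiv g z l) -> holo U (fun z => g (a * z)%C).
Proof.
  intros H z _; destruct (H (a * z)%C) as [l Hl]; eexists.
  apply (cderiv_comp g (fun z => a * z)%C); [exact Hl|apply cderiv_scal, cderiv_id].
Qed.

(* If [P] is a polynomial with [Re P] close to [theta], then [L exp (i P)] has modulus
   at least [L exp (- sup |P|)] and argument [Re P]; it is itself a limit of polynomials. *)
Lemma infinite_type_limit (f : C -> Cbar) : infinite_type f -> uniform_limit_of_polynomials f.
Proof.
  intros [_ [theta [Hf [Hc Hh]]]].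
  apply uniform_limit_of_approximation; intros eps He.
  (* In units of [eps / 12] the final error is [2] for the polynomial, [1] for the finite modulus
     and [4] for the argument, [7] in all. *)
  set (e := eps / 12).
  destruct (uniform_radial_limit (fun z => RtoC (theta z))) with (eps := e) as [r [Hr Hrad]];
    [|unfold e; lra|].
  { intros z Hz e' He'.
    destruct (proj1 (continuous_on_Disc_bar theta) Hc z Hz (mkposreal e' He')) as [dl [Hd Hw]].
    exists dl; split; [exact Hd|]; intros w Dw Hlt.
    rewrite <- RtoC_minus, Cmod_R; exact (Hw w Dw Hlt). }
  destruct (harmonic_re_approximation theta r e Hh Hr ltac:(unfold e; lra)) as [c [m Hcm]].
  set (P := fun z => psum c m (r * z)%C).
  destruct (psum_bounded c m) as [B HB].
  assert (Hrz : forall z, Disc_bar z -> Cmod (r * z) <= r).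
  { intros z Hz; rewrite Cmod_mult, Cmod_R, Rabs_right by lra; unfold Disc_bar in Hz; nra. }
  (* [exp B] offsets the factor [exp (- Im P)], which is at least [exp (- B)], so that
     [|E| >= 12 / eps] on the closed disc. *)
  set (L := 12 / eps * exp B).
  assert (HL : 0 < L) by (apply Rmult_lt_0_compat; [apply Rdiv_lt_0_compat; lra|apply exp_pos]).
  set (E := fun z => (RtoC L * Cexp (Ci * P z))%C).
  assert (EE : forall z, E z = (RtoC (L * exp (- Im (P z))) * cis (Re (P z)))%C).
  { intros z; unfold E.
    replace (Ci * P z)%C with ((- Im (P z), Re (P z)) : C)
      by (apply injective_projections; unfold Re, Im; simpl; ring).
    rewrite Cexp_cis, RtoC_mult; ring. }
  assert (HE : forall z, exists l, cderiv E z l).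
  { intros z.
    destruct (holo_psum (fun _ => True) c m (r * z)%C I) as [l Hl].
    eexists; apply (cderiv_scal (RtoC L) (fun z => Cexp (Ci * P z)%C)).
    apply (cderiv_comp Cexp (fun z => Ci * P z)%C); [apply cderiv_Cexp|].
    apply cderiv_scal, (cderiv_comp (psum c m) (fun z => r * z)%C); [exact Hl|].
    apply cderiv_scal, cderiv_id. }
  (* Approximation is available at [r z] with [r < 1] only. As [E] is entire, dilating it by [2] and
     taking [r = 1 / 2] reaches the whole closed disc. *)
  destruct (polynomial_approximation (fun z => E (2 * z)%C) (1 / 2) (eps / 12)
    (holo_affine_comp _ _ _ HE) ltac:(lra) ltac:(lra)) as [p [Pp Hp]].
  exists p; split; [exact Pp|]; intros z Hz.
  specialize (Hp z Hz); cbv beta in Hp.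
  replace (2 * (RtoC (1 / 2) * z))%C with z in Hp
    by (rewrite RtoC_div by lra; field; intros D; apply RtoC_inj in D; lra).
  set (rho := L * exp (- Im (P z))).
  assert (Hrho : 12 / eps <= rho).
  { unfold rho, L; rewrite Rmult_assoc, <- exp_plus.
    rewrite <- (Rmult_1_r (12 / eps)) at 1; apply Rmult_le_compat_l.
    - apply Rlt_le, Rdiv_lt_0_compat; lra.
    - assert (Im (P z) <= B).
      { eapply Rle_trans; [apply Rle_abs|]; eapply Rle_trans; [apply im_le_Cmod|].
        apply HB; specialize (Hrz z Hz); lra. }
      rewrite <- exp_0; destruct (Req_dec (Im (P z)) B) as [->|N].
      + replace (B + - B) with 0 by ring; lra.
      + apply Rlt_le, exp_increasing; lra. }
  assert (H12 : 0 < 12 / eps) by (apply Rdiv_lt_0_compat; lra).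
  assert (S1 : / (1 + rho) <= eps / 12).
  { replace (eps / 12) with (/ (12 / eps)) by (field; lra); apply Rinv_le_contravar; lra. }
  rewrite <- (G_Fin_polar rho (Re (P z))) in S1 by lra.
  assert (S2 := G_Fin_lipschitz (p z) (E z)).
  assert (S3 := cis_lipschitz (Re (P z)) (theta z)).
  assert (S4 := Hcm (r * z)%C (Hrz z Hz)); fold (P z) in S4.
  assert (S5 := Hrad z Hz); cbv beta in S5; rewrite <- RtoC_minus, Cmod_R in S5.
  assert (S6 : Rabs (Re (P z) - theta z) <= 2 * e).
  { replace (Re (P z) - theta z) with (- (theta (r * z)%C - Re (P z)) + (theta (r * z)%C - theta z)) by ring.
    eapply Rle_trans; [apply Rabs_triang|]; rewrite Rabs_Ropp; lra. }
  rewrite (Hf z Hz); unfold d; simpl (G (Infty _)).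
  change ((cos (theta z), sin (theta z)) : C) with (cis (theta z)).
  rewrite <- EE in S1 || (unfold rho in S1; rewrite <- EE in S1).
  replace (G (Fin (p z)) - cis (theta z))%C
    with ((G (Fin (p z)) - G (Fin (E z))) + ((G (Fin (E z)) - cis (Re (P z))) + (cis (Re (P z)) - cis (theta z))))%C by ring.
  eapply Rle_lt_trans; [apply Cmod_triangle|].
  pose proof (Cmod_triangle (G (Fin (E z)) - cis (Re (P z))) (cis (Re (P z)) - cis (theta z))).
  unfold e in S6; lra.
Qed.

(** * Limits of real parts *)

(** The principal logarithm on the right half-plane, the only region where the second component is
    known to be an argument. *)
Definition Log (w : C) : C := (ln (fst w * fst w + snd w * snd w) / 2, atan (snd w / fst w)).

Lemma continuity_2d_quotient (f : R -> R -> R) (x y : R) :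
  0 < x -> continuity_2d_pt f x y -> continuity_2d_pt (fun u v => f u v / (u * u + v * v)) x y.
Proof.
  intros Hx Hf; apply continuity_2d_pt_mult; [exact Hf|].
  apply continuity_2d_pt_inv; [|nra].
  apply continuity_2d_pt_plus; apply continuity_2d_pt_mult;
    (apply continuity_2d_pt_id1 || apply continuity_2d_pt_id2).
Qed.

Lemma cderiv_Log (z : C) : 0 < Re z -> exists l, cderiv Log z l.
Proof.
  destruct z as [x y]; unfold Re; cbn [fst]; intros Hx.
  assert (Loc : forall P : R -> R -> Prop, (forall u v, 0 < u -> P u v) -> locally_2d P x y).
  { intros P HP; exists (mkposreal x Hx); simpl; intros u v Hu _; apply HP.
    apply Rabs_lt_between in Hu; lra. }
  exists (x / (x * x + y * y), - (y / (x * x + y * y))).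
  apply (cderiv_of_CR (fun u v => ln (u * u + v * v) / 2) (fun u v => atan (v / u))).
  - rewrite Ropp_involutive.
    apply (differentiable_of_partials (fun u v => ln (u * u + v * v) / 2) (fun u v => u / (u * u + v * v))).
    + apply Loc; intros u v Hu; auto_derive; [nra|field; nra].
    + auto_derive; [nra|field; nra].
    + apply continuity_2d_quotient; [exact Hx|apply continuity_2d_pt_id1].
  - apply (differentiable_of_partials (fun u v => atan (v / u)) (fun u v => - (v / (u * u + v * v)))).
    + apply Loc; intros u v Hu; auto_derive; [lra|field; split; nra].
    + auto_derive; [lra|field; split; nra].
    + apply continuity_2d_pt_opp, continuity_2d_quotient; [exact Hx|apply continuity_2d_pt_id2].
Qed.

Lemma cis_atan (w : C) : 0 < Re w -> cis (atan (Im w / Re w)) = (w / RtoC (Cmod w))%C.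
Proof.
  intros Hx.
  assert (Hm : 0 < Cmod w) by (pose proof (re_le_Cmod w) as A; rewrite Rabs_right in A; lra).
  assert (Hm0 : RtoC (Cmod w) <> 0) by (intros D; apply RtoC_inj in D; lra).
  destruct (polar w) as [t Ht].
  pose proof (Cmod2_alt w) as E.
  set (x := Re w) in *; set (y := Im w) in *; set (m := Cmod w) in *.
  assert (Es : sqrt (1 + (y / x) ^ 2) = m / x).
  { replace (1 + (y / x) ^ 2) with ((m / x) ^ 2).
    - apply sqrt_pow2; apply Rmult_le_pos; [lra|apply Rlt_le, Rinv_0_lt_compat, Hx].
    - replace ((m / x) ^ 2) with (m ^ 2 / x ^ 2) by (field; lra); rewrite E; field; lra. }
  replace w with ((x, y) : C) by (symmetry; apply surjective_pairing).
  replace ((x, y) / m)%C with ((x / m, y / m) : C).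
  2: { unfold Cdiv; rewrite <- RtoC_inv by lra; apply injective_projections; simpl; unfold Rdiv; ring. }
  unfold cis; rewrite cos_atan, sin_atan.
  replace (1 + (y / x)²) with (1 + (y / x) ^ 2) by (unfold Rsqr; ring).
  rewrite Es; f_equal; field; lra.
Qed.

(** The supremum [m] of the times up to which [Q] holds throughout satisfies [Q], because the
    complement is open, and it cannot be below [1], because [Q] is open. *)
Lemma interval_connected (Q : R -> Prop) :
  Q 0 ->
  (forall t, 0 <= t <= 1 -> Q t -> exists dl, 0 < dl /\ forall s, 0 <= s <= 1 -> Rabs (s - t) < dl -> Q s) ->
  (forall t, 0 <= t <= 1 -> ~ Q t -> exists dl, 0 < dl /\ forall s, 0 <= s <= 1 -> Rabs (s - t) < dl -> ~ Q s) ->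
  Q 1.
Proof.
  intros H0 HO HC.
  set (E := fun t => 0 <= t <= 1 /\ forall s, 0 <= s <= t -> Q s).
  assert (E0 : E 0) by (split; [lra|]; intros s Hs; replace s with 0 by lra; exact H0).
  destruct (completeness E) as [m [Hm1 Hm2]].
  - exists 1; intros t [Ht _]; lra.
  - exists 0; exact E0.
  - assert (Hm : 0 <= m <= 1).
    { split; [apply Hm1, E0|]; apply Hm2; intros t [Ht _]; lra. }
    assert (Near : forall dl, 0 < dl -> exists t, E t /\ m - dl < t <= m).
    { intros dl Hd; apply NNPP; intros N.
      assert (m <= m - dl); [|lra].
      apply Hm2; intros t Ht; destruct (Rle_dec t (m - dl)) as [L|L]; [exact L|exfalso].
      apply N; exists t; split; [exact Ht|]; specialize (Hm1 t Ht); lra. }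
    assert (Qm : Q m).
    { apply NNPP; intros N; destruct (HC m Hm N) as [dl [Hd Hs]].
      destruct (Near dl Hd) as [t [[Ht Hq] Htm]].
      apply (Hs t Ht); [apply Rabs_lt_between; lra|apply Hq; lra]. }
    destruct (HO m Hm Qm) as [dl [Hd Hs]].
    destruct (Near dl Hd) as [t [[Ht Hq] Htm]].
    assert (Em : E (Rmin 1 (m + dl / 2))).
    { pose proof (Rmin_l 1 (m + dl / 2)); pose proof (Rmin_r 1 (m + dl / 2)).
      split; [split; [apply Rmin_glb; lra|lra]|].
      intros s Hs2; destruct (Rle_dec s t) as [L|L]; [apply Hq; lra|].
      apply Hs; [lra|apply Rabs_lt_between; lra]. }
    specialize (Hm1 _ Em).
    destruct (Rle_dec 1 (m + dl / 2)) as [L|L].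
    + rewrite Rmin_left in Em by exact L; apply Em; lra.
    + rewrite Rmin_right in Hm1 by lra; lra.
Qed.

(** The Borel-Caratheodory inequality; the point is that [K] depends on [rho] alone. *)
Lemma re_uniform_bound (rho : R) :
  0 < rho < 1 -> exists K, 0 < K /\ forall (g : C -> C) M, holo Disc g ->
    (forall z, Disc z -> Rabs (Re (g z)) <= M) ->
    forall z, Cmod z <= rho -> Cmod (g z - g 0) <= K * M.
Proof.
  intros Hrho; set (r := (1 + rho) / 2).
  assert (Hr : 0 < r < 1) by (unfold r; lra).
  assert (Hq : 0 < rho / r < 1).
  { split; [apply Rdiv_lt_0_compat; lra|].
    apply (Rmult_lt_reg_r r); [lra|]; unfold Rdiv; rewrite Rmult_assoc, Rinv_l by lra; unfold r; lra. }
  exists (2 * (rho / r) / (1 - rho / r)); split; [apply Rdiv_lt_0_compat; lra|].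
  intros g M Hg HM z Hz.
  destruct (fourier_exists g Hg) as [c Hc].
  assert (HM0 : 0 <= M).
  { eapply Rle_trans; [apply Rabs_pos|apply (HM 0)]; unfold Disc; rewrite Cmod_0; lra. }
  assert (T : Cmod (g z - psum c 1 z) <= 2 * M * (rho / r) ^ 1 / (1 - rho / r)).
  { apply (taylor_remainder g c (2 * M) r); auto; try lra.
    - intros k Hk; destruct k as [|k]; [lia|]; apply coefficient_re_bound with (g := g); auto.
    - replace (rho / r * r) with rho by (field; lra); exact Hz. }
  unfold psum in T; simpl in T; rewrite (fourier_0 g c Hg Hc) in T.
  replace (0 + g 0 * 1)%C with (g 0) in T by ring.
  eapply Rle_trans; [exact T|]; apply Req_le; field; split; unfold r; lra.
Qed.

(** Convergence of real parts leaves the imaginary constants free to drift. Once these are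
    normalised at [0], the Borel-Caratheodory inequality makes the functions locally uniformly
    Cauchy. *)
Lemma re_uniform_limit (G : nat -> C -> C) (theta : C -> R) :
  (forall n, holo Disc (G n)) ->
  (forall eps, 0 < eps -> exists N, forall n, (N <= n)%nat ->
    forall z, Disc z -> Rabs (Re (G n z) - theta z) < eps) ->
  exists g, holo Disc g /\ forall z, Disc z -> Re (g z) = theta z.
Proof.
  intros HG Hu.
  set (A := fun n z => (G n z - Ci * RtoC (Im (G n 0)))%C).
  assert (HA : forall n, holo Disc (A n)).
  { intros n; apply holo_minus; [apply HG|]; intros z _; eexists; apply cderiv_const. }
  assert (ReA : forall n z, Re (A n z) = Re (G n z)) by (intros; unfold A, Re; simpl; ring).
  assert (ImA : forall n, Im (A n 0) = 0) by (intros; unfold A, Im; simpl; ring).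
  assert (D0 : Disc 0) by (unfold Disc; rewrite Cmod_0; lra).
  assert (CA : forall rho, 0 < rho < 1 -> forall eps, 0 < eps -> exists N, forall n m, (N <= n)%nat -> (N <= m)%nat ->
    forall z, Cmod z <= rho -> Cmod (A n z - A m z) < eps).
  { intros rho Hrho eps He; destruct (re_uniform_bound rho Hrho) as [K [HK HB]].
    set (e := eps / (2 * (K + 1)) / 2).
    assert (Hep : 0 < e) by (unfold e; repeat apply Rdiv_lt_0_compat; lra).
    destruct (Hu e Hep) as [N HN]; exists N; intros n m Hn Hm z Hz.
    assert (HR : forall z, Disc z -> Rabs (Re (A n z - A m z)) <= 2 * e).
    { intros w Hw; specialize (HN n Hn w Hw) as H1; specialize (HN m Hm w Hw) as H2.
      change (Re (A n w - A m w)) with (Re (A n w) - Re (A m w)); rewrite !ReA.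
      replace (Re (G n w) - Re (G m w)) with ((Re (G n w) - theta w) + - (Re (G m w) - theta w)) by ring.
      eapply Rle_trans; [apply Rabs_triang|]; rewrite Rabs_Ropp; lra. }
    specialize (HB (fun z => A n z - A m z)%C (2 * e) (holo_minus _ _ _ (HA n) (HA m)) HR z Hz).
    assert (H0 : Cmod (A n 0 - A m 0) <= 2 * e).
    { eapply Rle_trans; [apply Cmod_le_abs|].
      change (Im (A n 0 - A m 0)) with (Im (A n 0) - Im (A m 0)); rewrite !ImA, Rminus_0_r, Rabs_R0.
      specialize (HR 0 D0); lra. }
    replace (A n z - A m z)%C with ((A n z - A m z - (A n 0 - A m 0)) + (A n 0 - A m 0))%C by ring.
    eapply Rle_lt_trans; [apply Cmod_triangle|].
    assert ((K + 1) * (2 * e) = eps / 2) by (unfold e; field; lra); lra. }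
  assert (Lim : forall z, exists l, Disc z -> forall eps, 0 < eps -> exists N, forall n, (N <= n)%nat -> Cmod (A n z - l) < eps).
  { intros z; destruct (Rlt_dec (Cmod z) 1) as [D|D].
    2: { exists 0; intros D'; contradiction. }
    destruct (C_cauchy_complete (fun n => A n z)) as [l Hl].
    - intros eps He; destruct (CA ((1 + Cmod z) / 2)) with (eps := eps) as [N HN];
        [pose proof (Cmod_ge_0 z); lra|exact He|].
      exists N; intros n m Hn Hm; apply HN; auto; lra.
    - exists l; intros _; exact Hl. }
  set (g := fun z => proj1_sig (constructive_indefinite_description _ (Lim z))).
  assert (Hg : forall z, Disc z -> forall eps, 0 < eps -> exists N, forall n, (N <= n)%nat -> Cmod (A n z - g z) < eps)
    by (intros z; exact (proj2_sig (constructive_indefinite_description _ (Lim z)))).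
  exists g; split.
  - intros w Hw; set (s := (1 - Cmod w) / 2).
    assert (Hs : 0 < s) by (unfold Disc in Hw; unfold s; lra).
    assert (Hsub : forall z, cball w s z -> Cmod z <= (1 + Cmod w) / 2).
    { intros z Hz; replace z with ((z - w) + w)%C by ring; pose proof (Cmod_triangle (z - w) w).
      unfold cball, s in Hz; lra. }
    assert (Hsub2 : forall z, cball w s z -> Disc z).
    { intros z Hz; specialize (Hsub z Hz); unfold Disc in *; lra. }
    destruct (weierstrass A g w s Hs) as [l [Hl _]]; [| |exists l; exact Hl].
    + intros n; apply (holo_subset Disc); [exact Hsub2|apply HA].
    + intros eps He.
      destruct (CA ((1 + Cmod w) / 2)) with (eps := eps / 2) as [N HN];
        [pose proof (Cmod_ge_0 w); unfold Disc in Hw; lra|lra|].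
      exists N; intros n Hn z Hz.
      destruct (Hg z (Hsub2 z Hz) (eps / 2) ltac:(lra)) as [N' HN'].
      specialize (HN' (max N N') ltac:(lia)); specialize (HN n (max N N') Hn ltac:(lia) z (Hsub z Hz)).
      replace (A n z - g z)%C with ((A n z - A (max N N') z) + (A (max N N') z - g z))%C by ring.
      eapply Rle_lt_trans; [apply Cmod_triangle|]; lra.
  - intros z Hz; apply Rminus_diag_uniq.
    destruct (Req_dec (Re (g z) - theta z) 0) as [E|E]; [exact E|exfalso].
    apply Rabs_pos_lt in E; set (a := Rabs (Re (g z) - theta z)) in *.
    destruct (Hg z Hz (a / 2) ltac:(lra)) as [N1 H1]; destruct (Hu (a / 2) ltac:(lra)) as [N2 H2].
    specialize (H1 (max N1 N2) ltac:(lia)); specialize (H2 (max N1 N2) ltac:(lia) z Hz).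
    rewrite Cmod_minus_sym in H1; set (n := max N1 N2) in *.
    pose proof (re_le_Cmod (g z - A n z)) as H3.
    change (Re (g z - A n z)) with (Re (g z) - Re (A n z)) in H3; rewrite ReA in H3.
    assert (a <= Rabs (Re (g z) - Re (G n z)) + Rabs (Re (G n z) - theta z)); [|lra].
    unfold a; replace (Re (g z) - theta z) with ((Re (g z) - Re (G n z)) + (Re (G n z) - theta z)) by ring.
    apply Rabs_triang.
Qed.

(** * Smoothness and harmonicity of real parts *)

Lemma partials_of_re (g : C -> C) (h : R -> R -> R) :
  holo Disc g -> (forall u v, Disc (u, v) -> h u v = Re (g (u, v))) ->
  forall x y, Disc (x, y) ->
    is_derive (fun s => h s y) x (Re (C_derive g (x, y))) /\
    is_derive (fun s => h x s) y (Re (Ci * C_derive g (x, y))).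
Proof.
  intros Hg E x y Hxy.
  destruct (Disc_locally_2d x y Hxy) as [dl Hd].
  pose proof (cderiv_C_derive g _ (Hg _ Hxy)) as D.
  split.
  - apply (is_derive_ext_loc (fun s => Re (g ((0, y) + RtoC s * 1)%C))).
    + exists dl; intros s Hs; rewrite E.
      * do 2 f_equal; apply injective_projections; simpl; ring.
      * apply Hd; [exact Hs|rewrite Rminus_eq_0, Rabs_R0; apply cond_pos].
    + replace (C_derive g (x, y)) with (C_derive g (x, y) * 1)%C by ring.
      apply (is_derive_re_line g (0, y) 1 (C_derive g (x, y)) x).
      replace ((0, y) + RtoC x * 1)%C with ((x, y) : C); [exact D|].
      apply injective_projections; simpl; ring.
  - apply (is_derive_ext_loc (fun s => Re (g ((x, 0) + RtoC s * Ci)%C))).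
    + exists dl; intros s Hs; rewrite E.
      * do 2 f_equal; apply injective_projections; simpl; ring.
      * apply Hd; [rewrite Rminus_eq_0, Rabs_R0; apply cond_pos|exact Hs].
    + rewrite Cmult_comm.
      apply (is_derive_re_line g (x, 0) Ci (C_derive g (x, y)) y).
      replace ((x, 0) + RtoC y * Ci)%C with ((x, y) : C); [exact D|].
      apply injective_projections; simpl; ring.
Qed.

Lemma continuity_2d_re (g : C -> C) (h : R -> R -> R) :
  holo Disc g -> (forall u v, Disc (u, v) -> h u v = Re (g (u, v))) ->
  forall x y, Disc (x, y) -> continuity_2d_pt h x y.
Proof.
  intros Hg E x y Hxy eps.
  destruct (holo_ccont Disc g _ Hg Hxy eps (cond_pos eps)) as [d1 [Hd1 Hw]].
  destruct (Disc_locally_2d x y Hxy) as [d2 Hd2].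
  assert (Hd : 0 < Rmin (d1 / 2) d2) by (apply Rmin_pos; [lra|apply cond_pos]).
  exists (mkposreal _ Hd); simpl; intros u v Hu Hv.
  pose proof (Rmin_l (d1 / 2) d2); pose proof (Rmin_r (d1 / 2) d2).
  rewrite !E by (auto; apply Hd2; lra).
  eapply Rle_lt_trans; [exact (re_le_Cmod (g (u, v) - g (x, y)))|].
  apply Hw; eapply Rle_lt_trans; [apply Cmod_le_abs|].
  change (Rabs (u - x) + Rabs (v - y) < d1); lra.
Qed.

(** The induction closes because both partials of [Re g] are again real parts of holomorphic
    functions, namely of [g'] and [Ci * g']. *)
Lemma ex_diff_n_re (n : nat) (g : C -> C) (h : R -> R -> R) :
  holo Disc g -> (forall u v, Disc (u, v) -> h u v = Re (g (u, v))) ->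
  forall x y, Disc (x, y) -> ex_diff_n h n x y.
Proof.
  revert g h; induction n as [|n IH]; intros g h Hg E x y Hxy;
    (split; [apply (continuity_2d_re g h Hg E x y Hxy)|]).
  - exact I.
  - destruct (partials_of_re g h Hg E x y Hxy) as [Px Py].
    split; [eexists; exact Px|split; [eexists; exact Py|split]].
    + apply (IH (C_derive g)); [apply holo_C_derive, Hg| |exact Hxy].
      intros u v Huv; apply is_derive_unique, (partials_of_re g h Hg E u v Huv).
    + apply (IH (fun z => Ci * C_derive g z)%C); [apply holo_scal, holo_C_derive, Hg| |exact Hxy].
      intros u v Huv; apply is_derive_unique, (partials_of_re g h Hg E u v Huv).
Qed.

Lemma harmonic_of_re (g : C -> C) (theta : C -> R) :
  holo Disc g -> (forall z, Disc z -> Re (g z) = theta z) -> harmonic_on Disc theta.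
Proof.
  intros Hg E x y Hxy; cbv zeta; set (h := fun s t => theta (s, t)).
  assert (Eh : forall u v, Disc (u, v) -> h u v = Re (g (u, v))) by (intros u v Huv; symmetry; apply E, Huv).
  split; [apply (ex_diff_n_re 2 g h Hg Eh x y Hxy)|].
  change (dx (dx h) x y + dy (dy h) x y = 0).
  pose proof (holo_C_derive g Hg) as Hg1.
  assert (E1 : forall u v, Disc (u, v) -> dx h u v = Re (C_derive g (u, v)))
    by (intros u v Huv; apply is_derive_unique, (partials_of_re g h Hg Eh u v Huv)).
  assert (E2 : forall u v, Disc (u, v) -> dy h u v = Re (Ci * C_derive g (u, v)))
    by (intros u v Huv; apply is_derive_unique, (partials_of_re g h Hg Eh u v Huv)).
  pose proof (holo_scal Disc Ci _ Hg1) as Hg2.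
  assert (F1 : dx (dx h) x y = Re (C_derive (C_derive g) (x, y)))
    by (apply is_derive_unique, (partials_of_re _ _ Hg1 E1 x y Hxy)).
  assert (F2 : dy (dy h) x y = Re (Ci * C_derive (fun z => Ci * C_derive g z)%C (x, y)))
    by (apply is_derive_unique, (partials_of_re _ _ Hg2 E2 x y Hxy)).
  assert (F3 : C_derive (fun z => Ci * C_derive g z)%C (x, y) = (Ci * C_derive (C_derive g) (x, y))%C).
  { apply is_C_derive_unique, cderiv_is_derive, cderiv_scal, cderiv_C_derive, Hg1, Hxy. }
  rewrite F1, F2, F3; unfold Re; simpl; ring.
Qed.

(** * Limits of polynomials are in the class *)

Lemma polynomial_entire (p : C -> C) : is_polynomial p -> forall z, exists l, cderiv p z l.
Proof.
  intros [n [a Ha]] z; exists (psum (dcoef a) n z).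
  apply (cderiv_ext (psum a (S n)) p z _ 1 Rlt_0_1); [|apply cderiv_psum].
  intros w _; rewrite Ha; apply psum_sum_n.
Qed.

(** * Closeness to infinity measured by [1 - |G|] *)

Lemma Cmod_G_Fin (z : C) : 1 - Cmod (G (Fin z)) = / (1 + Cmod z).
Proof.
  pose proof (Cmod_ge_0 z).
  simpl; rewrite Cmod_div, Cmod_R, Rabs_right; [field; lra|lra|].
  intros D; apply RtoC_inj in D; lra.
Qed.

Lemma Cmod_G_Fin_lt (z : C) : Cmod (G (Fin z)) < 1.
Proof.
  pose proof (Cmod_G_Fin z) as E; pose proof (Cmod_ge_0 z).
  assert (0 < / (1 + Cmod z)) by (apply Rinv_0_lt_compat; lra); lra.
Qed.

Lemma Cmod_G_le (q : Cbar) : Cmod (G q) <= 1.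
Proof.
  destruct q as [z|[u Hu]]; [apply Rlt_le, Cmod_G_Fin_lt|simpl; lra].
Qed.

Lemma Cmod_large_of_G (z : C) (A : R) : 0 <= A -> 1 - Cmod (G (Fin z)) < / (1 + A) -> A < Cmod z.
Proof.
  intros HA H; rewrite Cmod_G_Fin in H; pose proof (Cmod_ge_0 z).
  apply Rinv_lt_cancel in H; lra.
Qed.

Lemma Cmod_le_of_G (z : C) (A : R) : 0 <= A -> / (1 + A) <= 1 - Cmod (G (Fin z)) -> Cmod z <= A.
Proof.
  intros HA H; rewrite Cmod_G_Fin in H; pose proof (Cmod_ge_0 z).
  destruct (Rle_dec (Cmod z) A) as [L|L]; [exact L|].
  assert (/ (1 + Cmod z) < / (1 + A)) by (apply Rinv_lt_contravar; [apply Rmult_lt_0_compat|]; lra); lra.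
Qed.

(** On bounded sets [d] controls the ordinary distance: [z = G z (1 + |z|)], and
    [1 / (1 + |z|) = 1 - |G z|]. Each of the two terms costs [(1 + M)^2]. *)
Lemma G_Fin_inverse_lipschitz (z w : C) (M : R) :
  Cmod z <= M -> Cmod w <= M -> Cmod (z - w) <= 2 * (1 + M) ^ 2 * Cmod (G (Fin z) - G (Fin w)).
Proof.
  intros Hz Hw; pose proof (Cmod_ge_0 z) as Pz; pose proof (Cmod_ge_0 w) as Pw.
  set (A := G (Fin z)); set (B := G (Fin w)).
  assert (Ez : z = (A * RtoC (1 + Cmod z))%C)
    by (unfold A; simpl; field; intros D; apply RtoC_inj in D; lra).
  assert (Ew : w = (B * RtoC (1 + Cmod w))%C)
    by (unfold B; simpl; field; intros D; apply RtoC_inj in D; lra).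
  assert (Az : 1 - Cmod A = / (1 + Cmod z)) by apply Cmod_G_Fin.
  assert (Bw : 1 - Cmod B = / (1 + Cmod w)) by apply Cmod_G_Fin.
  assert (E : (z - w)%C = ((A - B) * RtoC (1 + Cmod z) + B * RtoC (Cmod z - Cmod w))%C).
  { rewrite Ez at 1; rewrite Ew at 1; replace (Cmod z - Cmod w) with ((1 + Cmod z) - (1 + Cmod w)) by ring.
    rewrite (RtoC_minus (1 + Cmod z)); ring. }
  rewrite E; eapply Rle_trans; [apply Cmod_triangle|].
  rewrite !Cmod_mult, !Cmod_R, (Rabs_right (1 + Cmod z)) by lra.
  assert (E2 : Cmod z - Cmod w = (Cmod A - Cmod B) * ((1 + Cmod z) * (1 + Cmod w))).
  { replace (Cmod A - Cmod B) with (/ (1 + Cmod w) - / (1 + Cmod z)) by lra; field; lra. }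
  assert (L : Rabs (Cmod A - Cmod B) <= Cmod (A - B)).
  { pose proof (Cmod_rev_triangle A B); pose proof (Cmod_rev_triangle B A) as H2.
    rewrite Cmod_minus_sym in H2; apply Rabs_le; lra. }
  rewrite E2, Rabs_mult, (Rabs_right ((1 + Cmod z) * (1 + Cmod w))) by nra.
  pose proof (Cmod_ge_0 (A - B)) as P; pose proof (Rabs_pos (Cmod A - Cmod B)) as P'.
  assert (B1 : Cmod B <= 1) by apply Cmod_G_le.
  pose proof (Cmod_ge_0 B).
  assert (Q : (1 + Cmod z) * (1 + Cmod w) <= (1 + M) ^ 2) by nra.
  assert (Q2 : 1 + Cmod z <= (1 + M) ^ 2) by nra.
  assert (T1 : Cmod (A - B) * (1 + Cmod z) <= Cmod (A - B) * (1 + M) ^ 2) by nra.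
  assert (T2 : Rabs (Cmod A - Cmod B) * ((1 + Cmod z) * (1 + Cmod w)) <= Cmod (A - B) * (1 + M) ^ 2)
    by (apply Rmult_le_compat; nra).
  assert (0 <= Rabs (Cmod A - Cmod B) * ((1 + Cmod z) * (1 + Cmod w))) by (apply Rmult_le_pos; nra).
  nra.
Qed.

Lemma uniform_limit_continuous (p : nat -> C -> C) (f : C -> Cbar) :
  (forall n, is_polynomial (p n)) -> uniform_limit_on Disc_bar (fun n z => Fin (p n z)) f ->
  forall z, Disc_bar z -> forall eps, 0 < eps -> exists delta, 0 < delta /\
    forall w, Disc_bar w -> Cmod (w - z) < delta -> d (f w) (f z) < eps.
Proof.
  intros Hp Hu z Hz eps He.
  destruct (Hu (eps / 4) ltac:(lra)) as [N HN].
  destruct (polynomial_entire _ (Hp N) z) as [l Hl].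
  destruct (cderiv_ccont _ _ _ Hl (eps / 8) ltac:(lra)) as [dl [Hd Hw]].
  exists dl; split; [exact Hd|]; intros w Dw Hlt.
  assert (H1 := HN N (le_n N) w Dw); assert (H2 := HN N (le_n N) z Hz).
  assert (H3 := G_Fin_lipschitz (p N w) (p N z)); specialize (Hw w Hlt).
  rewrite d_sym in H1.
  pose proof (d_triangle (f w) (Fin (p N w)) (f z)).
  pose proof (d_triangle (Fin (p N w)) (Fin (p N z)) (f z)).
  change (Cmod (G (Fin (p N w)) - G (Fin (p N z)))) with (d (Fin (p N w)) (Fin (p N z))) in H3.
  lra.
Qed.

Lemma Disc_subset_bar (z : C) : Disc z -> Disc_bar z.
Proof. unfold Disc, Disc_bar; lra. Qed.

Lemma Cmod_G_near (p q : Cbar) : Rabs (Cmod (G p) - Cmod (G q)) <= d p q.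
Proof.
  unfold d; pose proof (Cmod_rev_triangle (G p) (G q)); pose proof (Cmod_rev_triangle (G q) (G p)) as H2.
  rewrite Cmod_minus_sym in H2; apply Rabs_le; lra.
Qed.

(* Near an interior point where the limit is infinite, [ln |p n|] is eventually a positive
   harmonic function, large at the point; Harnack's inequality keeps it large nearby. *)
Lemma infinite_set_open (p : nat -> C -> C) (f : C -> Cbar) (z0 : C) :
  (forall n, is_polynomial (p n)) -> uniform_limit_on Disc_bar (fun n z => Fin (p n z)) f ->
  Disc z0 -> Cmod (G (f z0)) = 1 ->
  exists s, 0 < s /\ forall z, cball z0 s z -> Disc_bar z -> Cmod (G (f z)) = 1.
Proof.
  intros Hp Hu Hz0 H1.
  (* Two errors of [1 / 4] leave [|G (p n z)| > 1 / 2], that is [|p n z| > 1], so [ln |p n|] is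
     positive. *)
  destruct (uniform_limit_continuous p f Hp Hu z0 (Disc_subset_bar _ Hz0) (1 / 4) ltac:(lra)) as [dl [Hd Hw]].
  set (s := Rmin dl (1 - Cmod z0)).
  assert (Hs : 0 < s) by (apply Rmin_pos; unfold Disc in Hz0; lra).
  assert (HsD : forall z, cball z0 s z -> Disc z).
  { intros z Hz; apply (Disc_cball z0 Hz0); eapply Rlt_le_trans; [exact Hz|apply Rmin_r]. }
  destruct (Hu (1 / 4) ltac:(lra)) as [N1 HN1].
  assert (Big : forall n, (N1 <= n)%nat -> forall z, cball z0 s z -> 1 < Cmod (p n z)).
  { intros n Hn z Hz.
    assert (A := HN1 n Hn z (Disc_subset_bar _ (HsD z Hz))).
    assert (B := Hw z (Disc_subset_bar _ (HsD z Hz)) (Rlt_le_trans _ _ _ Hz (Rmin_l _ _))).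
    pose proof (Rle_lt_trans _ _ _ (Cmod_G_near (Fin (p n z)) (f z)) A) as A'.
    pose proof (Rle_lt_trans _ _ _ (Cmod_G_near (f z) (f z0)) B) as B'.
    apply Rabs_lt_between in A'; apply Rabs_lt_between in B'.
    apply Cmod_large_of_G; [lra|]; replace (/ (1 + 1)) with (1 / 2) by field; lra. }
  (* Harnack's inequality for a logarithm of [p n], exponentiated: its factor [1 / 2] becomes a
     square. *)
  assert (Har : forall n, (N1 <= n)%nat -> forall z, Cmod (z - z0) <= s / 10 -> Cmod (p n z0) <= Cmod (p n z) ^ 2).
  { intros n Hn z Hz.
    destruct (log_ball (p n) z0 s Hs) as [h [Hh Eh]].
    - intros w _; apply polynomial_entire, Hp.
    - intros w Hw'; apply Cmod_gt_0; specialize (Big n Hn w Hw'); lra.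
    - assert (HR : forall w, cball z0 s w -> exp (Re (h w)) = Cmod (p n w))
        by (intros w Hw'; rewrite <- Cmod_Cexp, Eh by exact Hw'; reflexivity).
      assert (Hz' : cball z0 s z) by (unfold cball; lra).
      pose proof (harnack h z0 s Hs Hh) as K.
      specialize (K (fun w Hw' => ltac:(
        apply Rlt_le, exp_lt_inv; rewrite exp_0, HR by exact Hw'; exact (Big n Hn w Hw'))) z Hz).
      rewrite <- (HR z Hz'), <- (HR z0 (cball_center z0 s Hs)).
      replace (exp (Re (h z)) ^ 2) with (exp (Re (h z) + Re (h z))) by (rewrite exp_plus; ring).
      destruct (Req_dec (Re (h z0)) (Re (h z) + Re (h z))) as [->|NE]; [lra|].
      apply Rlt_le, exp_increasing; lra. }
  exists (s / 10); split; [lra|]; intros z Hz Dz; unfold cball in Hz.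
  apply Rle_antisym; [apply Cmod_G_le|].
  apply le_epsilon; intros eps He.
  (* [|p n z| > A] brings [1 - |G (p n z)|] to at most [eps / 2]; by the square in [Har] this takes
     [|p n z0| > A^2]. The rest of [eps] pays for replacing [p n z] by [f z]. *)
  set (A := 2 / eps).
  assert (HA : 0 < A) by (apply Rdiv_lt_0_compat; lra).
  assert (HA2 : 0 < / (1 + A ^ 2)) by (apply Rinv_0_lt_compat; nra).
  destruct (Hu (Rmin (eps / 2) (/ (1 + A ^ 2)))) as [N2 HN2]; [apply Rmin_pos; lra|].
  set (n := max N1 N2).
  assert (K1 := HN2 n ltac:(lia) z Dz).
  assert (K2 := HN2 n ltac:(lia) z0 (Disc_subset_bar _ Hz0)).
  apply (Rle_lt_trans _ _ _ (Cmod_G_near _ _)) in K1, K2.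
  apply Rabs_lt_between in K1; apply Rabs_lt_between in K2.
  pose proof (Rmin_l (eps / 2) (/ (1 + A ^ 2))); pose proof (Rmin_r (eps / 2) (/ (1 + A ^ 2))).
  assert (L0 : A ^ 2 < Cmod (p n z0)) by (apply Cmod_large_of_G; [nra|lra]).
  specialize (Har n ltac:(lia) z ltac:(lra)).
  assert (L1 : A < Cmod (p n z)) by (pose proof (Cmod_ge_0 (p n z)); nra).
  pose proof (Cmod_G_Fin (p n z)) as E.
  assert (/ (1 + Cmod (p n z)) <= eps / 2); [|lra].
  replace (eps / 2) with (/ A) by (unfold A; field; lra).
  apply Rinv_le_contravar; lra.
Qed.

(** Along the segment from [z0] to [z1], being infinite is an open condition by [infinite_set_open],
    and being finite is open because [|G f| < 1] persists by continuity. *)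
Lemma infinite_set_connected (p : nat -> C -> C) (f : C -> Cbar) (z0 z1 : C) :
  (forall n, is_polynomial (p n)) -> uniform_limit_on Disc_bar (fun n z => Fin (p n z)) f ->
  Disc z0 -> Disc z1 -> Cmod (G (f z0)) = 1 -> Cmod (G (f z1)) = 1.
Proof.
  intros Hp Hu H0 H1 E0.
  set (z := fun t : R => (z0 + t * (z1 - z0))%C).
  assert (Dz : forall t, 0 <= t <= 1 -> Disc (z t)).
  { intros t Ht; unfold z, Disc.
    replace (z0 + t * (z1 - z0))%C with (RtoC (1 - t) * z0 + t * z1)%C by (rewrite RtoC_minus; ring).
    eapply Rle_lt_trans; [apply Cmod_triangle|].
    rewrite !Cmod_mult, !Cmod_R, !Rabs_right by lra; unfold Disc in H0, H1.
    destruct (Req_dec t 0) as [->|N]; [lra|nra]. }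
  assert (Zd : forall s t, Cmod (z s - z t) <= Rabs (s - t) * (Cmod (z1 - z0) + 1)).
  { intros s t; unfold z.
    replace (z0 + s * (z1 - z0) - (z0 + t * (z1 - z0)))%C with (RtoC (s - t) * (z1 - z0))%C
      by (rewrite RtoC_minus; ring).
    rewrite Cmod_mult, Cmod_R; apply Rmult_le_compat_l; [apply Rabs_pos|lra]. }
  assert (HK : 0 < Cmod (z1 - z0) + 1) by (pose proof (Cmod_ge_0 (z1 - z0)); lra).
  assert (Zn : forall r, 0 < r -> 0 < r / (Cmod (z1 - z0) + 1) /\
    forall s t, Rabs (s - t) < r / (Cmod (z1 - z0) + 1) -> Cmod (z s - z t) < r).
  { intros r Hr; split; [apply Rdiv_lt_0_compat; assumption|]; intros s t Hst.
    eapply Rle_lt_trans; [apply Zd|].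
    apply (Rmult_lt_compat_r _ _ _ HK) in Hst.
    replace (r / (Cmod (z1 - z0) + 1) * (Cmod (z1 - z0) + 1)) with r in Hst by (field; lra); exact Hst. }
  replace z1 with (z 1) by (unfold z; ring).
  apply (interval_connected (fun t => Cmod (G (f (z t))) = 1)).
  - replace (z 0) with z0 by (unfold z; ring); exact E0.
  - intros t Ht Et; destruct (infinite_set_open p f (z t) Hp Hu (Dz t Ht) Et) as [r [Hr Hopen]].
    destruct (Zn r Hr) as [Hr' Hn]; eexists; split; [exact Hr'|].
    intros s Hs Hst; apply Hopen; [apply Hn, Hst|apply Disc_subset_bar, Dz, Hs].
  - intros t Ht Et.
    assert (L : 0 < 1 - Cmod (G (f (z t)))) by (pose proof (Cmod_G_le (f (z t))); lra).
    destruct (uniform_limit_continuous p f Hp Hu (z t) (Disc_subset_bar _ (Dz t Ht)) _ L) as [r [Hr Hw]].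
    destruct (Zn r Hr) as [Hr' Hn]; eexists; split; [exact Hr'|].
    intros s Hs Hst Es.
    specialize (Hw (z s) (Disc_subset_bar _ (Dz s Hs)) (Hn s t Hst)).
    apply (Rle_lt_trans _ _ _ (Cmod_G_near _ _)), Rabs_lt_between in Hw; lra.
Qed.

Definition finite_part (q : Cbar) : C := match q with Fin z => z | Infty _ => RtoC 0 end.

Lemma finite_part_Fin (q : Cbar) : Cmod (G q) <> 1 -> q = Fin (finite_part q).
Proof. destruct q as [z|[u Hu]]; [reflexivity|simpl; contradiction]. Qed.

(** Near an interior point [|G f|] stays away from [1], so the [p n] are eventually bounded there,
    and convergence for [d] becomes ordinary uniform convergence. *)
Lemma limit_finite_type (p : nat -> C -> C) (f : C -> Cbar) :
  (forall n, is_polynomial (p n)) -> uniform_limit_on Disc_bar (fun n z => Fin (p n z)) f ->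
  (forall z, Disc z -> Cmod (G (f z)) <> 1) -> holo Disc (fun z => finite_part (f z)).
Proof.
  intros Hp Hu Hfin w Hw; set (g := fun z => finite_part (f z)).
  assert (Hfg : forall z, Disc z -> f z = Fin (g z)) by (intros z Hz; apply finite_part_Fin, Hfin, Hz).
  (* The gap [4 eta] at [w] is at least [3 eta] nearby and more than [2 eta] for [p n]; a gap of
     [eta] already keeps the modulus below [M = / eta]. *)
  set (eta := (1 - Cmod (G (f w))) / 4).
  assert (Heta : 0 < eta) by (pose proof (Cmod_G_le (f w)); specialize (Hfin w Hw); unfold eta; lra).
  assert (Heta1 : eta <= 1 / 4) by (pose proof (Cmod_ge_0 (G (f w))); unfold eta; lra).
  destruct (uniform_limit_continuous p f Hp Hu w (Disc_subset_bar _ Hw) eta Heta) as [dl [Hd Hc]].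
  set (s := Rmin dl (1 - Cmod w)).
  assert (Hs : 0 < s) by (apply Rmin_pos; unfold Disc in Hw; lra).
  assert (HsD : forall z, cball w s z -> Disc z).
  { intros z Hz; apply (Disc_cball w Hw); eapply Rlt_le_trans; [exact Hz|apply Rmin_r]. }
  destruct (Hu eta Heta) as [N0 HN0].
  set (M := / eta).
  assert (HM : 0 < M) by (apply Rinv_0_lt_compat, Heta).
  assert (HMe : / (1 + M) <= eta).
  { replace eta with (/ M) by (unfold M; apply Rinv_inv); apply Rinv_le_contravar; lra. }
  assert (Bg : forall z, cball w s z -> Cmod (G (f z)) <= 1 - 3 * eta).
  { intros z Hz.
    assert (B := Hc z (Disc_subset_bar _ (HsD z Hz)) (Rlt_le_trans _ _ _ Hz (Rmin_l _ _))).
    apply (Rle_lt_trans _ _ _ (Cmod_G_near _ _)), Rabs_lt_between in B; unfold eta in *; lra. }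
  destruct (weierstrass p g w s Hs) as [l [Hl _]]; [| |exists l; exact Hl].
  - intros n z _; apply polynomial_entire, Hp.
  - intros eps He.
    set (K := 2 * (1 + M) ^ 2).
    assert (HK : 0 < K) by (unfold K; nra).
    destruct (Hu (eps / K)) as [N1 HN1]; [apply Rdiv_lt_0_compat; assumption|].
    exists (max N0 N1); intros n Hn z Hz.
    specialize (Bg z Hz); specialize (HsD z Hz).
    assert (A := HN0 n ltac:(lia) z (Disc_subset_bar _ HsD)).
    assert (A1 := HN1 n ltac:(lia) z (Disc_subset_bar _ HsD)).
    pose proof (Rle_lt_trans _ _ _ (Cmod_G_near _ _) A) as A2; apply Rabs_lt_between in A2.
    rewrite (Hfg z HsD) in *; unfold d in A1.
    assert (P1 : Cmod (p n z) <= M) by (apply Cmod_le_of_G; lra).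
    assert (P2 : Cmod (g z) <= M) by (apply Cmod_le_of_G; lra).
    eapply Rle_lt_trans; [apply (G_Fin_inverse_lipschitz _ _ M P1 P2)|]; fold K.
    apply (Rmult_lt_compat_l _ _ _ HK) in A1.
    replace (K * (eps / K)) with eps in A1 by (field; lra); exact A1.
Qed.

(** The room beyond the closed disc makes a logarithm differentiable, hence continuous, at boundary
    points. Outside, [p z] is compared with [p u] at the radial projection [u], where
    [|p u| >= 1]. *)
Lemma nonvanishing_on_larger_disc (p : C -> C) :
  is_polynomial p -> (forall z, Disc_bar z -> 1 <= Cmod (p z)) ->
  exists R, 1 < R /\ forall z, cball 0 R z -> p z <> 0.
Proof.
  intros Hp H.
  destruct (Disc_bar_uniform_continuity (fun z => p (2 * z)%C)) with (eps := 1 / 2) as [dl [Hd Hw]]; [|lra|].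
  { intros z _ eps He; destruct (polynomial_entire p Hp (2 * z)%C) as [l Hl].
    destruct (cderiv_ccont _ _ _ Hl eps He) as [dl [Hd Hw]].
    exists (dl / 2); split; [lra|]; intros w _ Hlt; apply Hw.
    replace (2 * w - 2 * z)%C with (2 * (w - z))%C by ring.
    rewrite Cmod_mult, Cmod_R, Rabs_right by lra; lra. }
  (* Uniform continuity was taken for [p (2 z)] on the unit disc: the [1] keeps [z / 2] there, the
     [dl] keeps [u / 2] close to [z / 2]. *)
  exists (1 + Rmin 1 dl); split; [pose proof (Rmin_pos 1 dl); lra|].
  intros z Hz; unfold cball in Hz; replace (z - 0)%C with z in Hz by ring.
  pose proof (Rmin_l 1 dl); pose proof (Rmin_r 1 dl).
  apply Cmod_gt_0.
  destruct (Rle_dec (Cmod z) 1) as [L|L]; [specialize (H z L); lra|].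
  assert (N : RtoC (Cmod z) <> 0) by (intros D; apply RtoC_inj in D; lra).
  assert (N2 : RtoC 2 <> 0) by (intros D; apply RtoC_inj in D; lra).
  set (u := (z / Cmod z)%C).
  assert (Hu : Cmod u = 1).
  { unfold u; rewrite Cmod_div, Cmod_R, Rabs_right by (auto; lra); field; lra. }
  assert (Half : forall w, Cmod (w / 2) = Cmod w / 2).
  { intros w; rewrite Cmod_div, Cmod_R, Rabs_right by (auto; lra); reflexivity. }
  assert (Hk := Hw (z / 2)%C (u / 2)%C).
  replace (2 * (z / 2))%C with z in Hk by (field; exact N2).
  replace (2 * (u / 2))%C with u in Hk by (field; exact N2).
  replace (u / 2 - z / 2)%C with ((u - z) / 2)%C in Hk by (field; exact N2).
  replace (u - z)%C with (RtoC (1 - Cmod z) * u)%C in Hk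
    by (unfold u; rewrite RtoC_minus; field; exact N).
  unfold Disc_bar in Hk; rewrite !Half, Cmod_mult, Cmod_R, Hu, Rabs_left in Hk by lra.
  specialize (Hk ltac:(lra) ltac:(lra) ltac:(lra)).
  specialize (H u ltac:(unfold Disc_bar; lra)).
  pose proof (Cmod_rev_triangle (p u) (p z)); lra.
Qed.

(** * Arguments of polynomials and of an infinite limit *)

Lemma direction (z : C) :
  exists t, z = (RtoC (Cmod z) * cis t)%C /\ Cmod (G (Fin z) - cis t) = 1 - Cmod (G (Fin z)).
Proof.
  destruct (polar z) as [t Ht]; exists t; split; [exact Ht|].
  rewrite Cmod_G_Fin, <- (G_Fin_polar (Cmod z) t (Cmod_ge_0 z)), <- Ht; reflexivity.
Qed.

(** One distance moves from [G q] to [G (Fin z)]. The radial step on to the circle has length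
    [1 - |G (Fin z)|], again at most [d (Fin z) q] because [|G q| = 1]. *)
Lemma direction_near (z : C) (q : Cbar) :
  Cmod (G q) = 1 ->
  exists t, z = (RtoC (Cmod z) * cis t)%C /\ Cmod (cis t - G q) <= 2 * d (Fin z) q.
Proof.
  intros Hq; destruct (direction z) as [t [Ht E]]; exists t; split; [exact Ht|].
  replace (cis t - G q)%C with (- (G (Fin z) - cis t) + (G (Fin z) - G q))%C by ring.
  eapply Rle_trans; [apply Cmod_triangle|].
  rewrite Cmod_opp, E; pose proof (Cmod_G_near (Fin z) q) as A; rewrite Hq in A.
  apply Rabs_le_between in A; unfold d in *; lra.
Qed.

Lemma Im_Log_scal (r : R) (w : C) : 0 < r -> Im (Log (r * w)) = atan (Im w / Re w).
Proof.
  intros Hr; unfold Log, Im, Re; cbn [fst snd Cmult RtoC]; f_equal.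
  destruct (Req_dec (fst w) 0) as [E|E].
  - rewrite E; unfold Rdiv; replace (r * 0 - 0 * snd w) with 0 by ring; rewrite Rinv_0; ring.
  - field; split; [exact E|lra].
Qed.

Lemma atan_lipschitz (a b : R) : Rabs (atan b - atan a) <= Rabs (b - a).
Proof.
  apply (lipschitz_of_derive atan (fun x => / (1 + x ^ 2))).
  - intros t; auto_derive; [trivial|field; nra].
  - intros t; pose proof (pow2_ge_0 t).
    rewrite Rabs_right by (apply Rle_ge, Rlt_le, Rinv_0_lt_compat; lra).
    rewrite <- Rinv_1; apply Rinv_le_contravar; lra.
Qed.

(** Over the common denominator [x x' >= 1 / 4] the numerator of the difference of slopes is at most
    [2 |w - w'|], whence [8]. *)
Lemma argument_lipschitz (w w' : C) :
  1 / 2 <= Re w -> 1 / 2 <= Re w' -> Cmod w <= 1 -> Cmod w' <= 1 ->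
  Rabs (atan (Im w / Re w) - atan (Im w' / Re w')) <= 8 * Cmod (w - w').
Proof.
  intros H1 H2 M1 M2.
  eapply Rle_trans; [apply atan_lipschitz|].
  set (x := Re w) in *; set (y := Im w); set (x' := Re w') in *; set (y' := Im w').
  assert (Hx : Rabs (x' - x) <= Cmod (w - w')).
  { rewrite Rabs_minus_sym; exact (re_le_Cmod (w - w')). }
  assert (Hy : Rabs (y - y') <= Cmod (w - w')) by exact (im_le_Cmod (w - w')).
  assert (By : Rabs y <= 1) by (eapply Rle_trans; [apply im_le_Cmod|exact M1]).
  assert (Bx : Rabs x <= 1) by (eapply Rle_trans; [apply re_le_Cmod|exact M1]).
  assert (Hxx : 1 / 4 <= x * x') by nra.
  replace (y / x - y' / x') with ((y * (x' - x) + x * (y - y')) / (x * x')) by (field; lra).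
  unfold Rdiv; rewrite Rabs_mult, (Rabs_right (/ (x * x')))
    by (apply Rle_ge, Rlt_le, Rinv_0_lt_compat; lra).
  assert (I : / (x * x') <= 4).
  { replace 4 with (/ (1 / 4)) by field; apply Rinv_le_contravar; lra. }
  assert (I0 : 0 < / (x * x')) by (apply Rinv_0_lt_compat; lra).
  assert (T : Rabs (y * (x' - x) + x * (y - y')) <= 2 * Cmod (w - w')).
  { eapply Rle_trans; [apply Rabs_triang|]; rewrite !Rabs_mult.
    pose proof (Rabs_pos (x' - x)); pose proof (Rabs_pos (y - y')); nra. }
  pose proof (Rabs_pos (y * (x' - x) + x * (y - y'))); nra.
Qed.

Lemma Re_ge_of_near_1 (w : C) (e : R) : Cmod (w - 1) <= e -> 1 - e <= Re w.
Proof.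
  intros H; pose proof (Rle_trans _ _ _ (re_le_Cmod (w - 1)) H) as A.
  apply Rabs_le_between in A; change (Re (w - 1)) with (Re w - 1) in A; lra.
Qed.

(** Equality of reals is decidable, so proofs of [Cmod u = 1] are unique. *)
Lemma unit_circle_ext (u v : unit_circle) : proj1_sig u = proj1_sig v -> u = v.
Proof.
  destruct u as [u Hu], v as [v Hv]; simpl; intros <-; f_equal.
  apply UIP_dec, Req_EM_T.
Qed.

Lemma quotient_polar (rho t : R) (w : C) :
  0 < rho -> (w * / (RtoC rho * cis t))%C = (RtoC (/ rho) * (w * cis (- t)))%C.
Proof.
  intros Hr; assert (N : RtoC rho <> 0) by (intros D; apply RtoC_inj in D; lra).
  assert (N2 : cis t <> 0) by (apply Cmod_gt_0; rewrite Cmod_cis; lra).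
  replace (cis (- t)) with (/ cis t)%C.
  - rewrite RtoC_inv by lra; field; split; assumption.
  - rewrite <- (Cmult_1_r (/ cis t)), <- cis_0, <- (Rplus_opp_r t), cis_plus; field; exact N2.
Qed.

Lemma limit_infinite_type (p : nat -> C -> C) (f : C -> Cbar) :
  (forall n, is_polynomial (p n)) -> uniform_limit_on Disc_bar (fun n z => Fin (p n z)) f ->
  (forall z, Disc_bar z -> Cmod (G (f z)) = 1) ->
  exists theta, (forall z, Disc_bar z -> f z = Infty (expi (theta z))) /\
    continuous_on Disc_bar theta /\ harmonic_on Disc theta.
Proof.
  intros Hp Hu HF.
  (* By [direction_near], [1 / 8] puts the directions of [p N z] and [p n z] within [1 / 4] of
     [G (f z)]. Their quotient is then within [1 / 2] of [1], inside the right half-plane. *)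
  destruct (Hu (1 / 8) ltac:(lra)) as [N HN].
  set (P := p N).
  assert (Big : forall n z, (N <= n)%nat -> Disc_bar z -> 1 <= Cmod (p n z)).
  { intros n z Hn Hz; apply Rlt_le, Cmod_large_of_G; [lra|].
    pose proof (Rle_lt_trans _ _ _ (Cmod_G_near _ _) (HN n Hn z Hz)) as A.
    rewrite (HF z Hz) in A; apply Rabs_lt_between in A.
    replace (/ (1 + 1)) with (1 / 2) by field; lra. }
  destruct (nonvanishing_on_larger_disc P (Hp N)) as [R1 [HR1 HP]].
  { intros z Hz; exact (Big N z (le_n N) Hz). }
  destruct (log_ball P 0 R1 ltac:(lra)) as [h [Hh Eh]].
  { intros z _; apply polynomial_entire, Hp. }
  { exact HP. }
  assert (Dball : forall z, Disc_bar z -> cball 0 R1 z).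
  { intros z Hz; unfold cball; replace (z - 0)%C with z by ring; unfold Disc_bar in Hz; lra. }
  set (H := fun n z => (h z + Log (p n z * / P z))%C).
  (* An explicit formula for the limit: [p n z] in [H n] is replaced by its limiting direction
     [G (f z)], the imaginary part of [Log] being blind to positive factors. *)
  set (theta := fun z => Im (h z) + Im (Log (G (f z) * / P z))).
  assert (Key : forall z, Disc_bar z ->
    cis (theta z) = G (f z) /\
    forall n, (N <= n)%nat -> 0 < Re (p n z * / P z) /\
      Rabs (Im (H n z) - theta z) <= 16 * d (Fin (p n z)) (f z)).
  { intros z Hz.
    destruct (direction_near (P z) (f z) (HF z Hz)) as [t [Ht Et]].
    assert (HPz : 1 <= Cmod (P z)) by exact (Big N z (le_n N) Hz).
    set (rho := Cmod (P z)) in *.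
    assert (Hi : 0 < / rho) by (apply Rinv_0_lt_compat; lra).
    assert (H8 := HN N (le_n N) z Hz); fold P in H8.
    assert (Tri : forall u : C, Cmod (u * cis (- t) - 1) = Cmod (u - cis t)).
    { intros u; replace (u * cis (- t) - 1)%C with ((u - cis t) * cis (- t))%C.
      - rewrite Cmod_mult, Cmod_cis; ring.
      - replace (RtoC 1) with (cis t * cis (- t))%C; [ring|].
        rewrite <- cis_plus, Rplus_opp_r; apply cis_0. }
    (* The direction of [f z] relative to that of [P z]; likewise [w] below for [p n z]. *)
    set (W := (G (f z) * cis (- t))%C).
    assert (HW : 3 / 4 <= Re W).
    { replace (3 / 4) with (1 - 1 / 4) by field; apply Re_ge_of_near_1; unfold W; rewrite Tri.
      rewrite Cmod_minus_sym; lra. }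
    assert (MW : Cmod W = 1) by (unfold W; rewrite Cmod_mult, Cmod_cis, (HF z Hz); ring).
    assert (Eth : theta z = Im (h z) + atan (Im W / Re W)).
    { unfold theta; rewrite Ht, quotient_polar by lra; rewrite Im_Log_scal by exact Hi; reflexivity. }
    split.
    - rewrite Eth, cis_plus, cis_atan, MW by lra.
      (* [exp (h z) = P z] makes [Im (h z)] an argument of [P z], equal to [t] up to a period. *)
      assert (E1 : cis (Im (h z)) = cis t).
      { pose proof (Eh z (Dball z Hz)) as E; pose proof (Cmod_Cexp (h z)) as E2.
        rewrite E in E2; fold rho in E2; rewrite Ht in E.
        rewrite (surjective_pairing (h z)), Cexp_cis in E.
        change (fst (h z)) with (Re (h z)) in E; rewrite <- E2 in E.
        assert (N0 : RtoC rho <> 0) by (intros D; apply RtoC_inj in D; lra).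
        change (snd (h z)) with (Im (h z)) in E.
        replace (cis (Im (h z))) with (/ rho * (rho * cis (Im (h z))))%C by (field; exact N0).
        rewrite E; field; exact N0. }
      rewrite E1; unfold W.
      transitivity (G (f z) * (cis t * cis (- t)))%C.
      + field; intros D; apply RtoC_inj in D; lra.
      + rewrite <- cis_plus, Rplus_opp_r, cis_0; ring.
    - intros n Hn.
      destruct (direction_near (p n z) (f z) (HF z Hz)) as [s [Hs Es]].
      assert (Hpn : 1 <= Cmod (p n z)) by exact (Big n z Hn Hz).
      set (sigma := Cmod (p n z)) in *.
      assert (H8n := HN n Hn z Hz).
      set (w := (cis s * cis (- t))%C).
      assert (Eq : (p n z * / P z)%C = (RtoC (/ rho * sigma) * w)%C).
      { rewrite Ht, quotient_polar, Hs by lra; unfold w; rewrite RtoC_mult; ring. }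
      assert (Hw : 1 / 2 <= Re w).
      { replace (1 / 2) with (1 - 1 / 2) by field; apply Re_ge_of_near_1; unfold w; rewrite Tri.
        replace (cis s - cis t)%C with ((cis s - G (f z)) + (G (f z) - cis t))%C by ring.
        rewrite Cmod_minus_sym in Et.
        pose proof (Cmod_triangle (cis s - G (f z)) (G (f z) - cis t)); lra. }
      assert (Mw : Cmod w = 1) by (unfold w; rewrite Cmod_mult, !Cmod_cis; ring).
      assert (Hrs : 0 < / rho * sigma) by (apply Rmult_lt_0_compat; lra).
      split.
      + rewrite Eq, re_scal_l; apply Rmult_lt_0_compat; lra.
      + unfold H; rewrite im_plus, Eq, Im_Log_scal, Eth by exact Hrs.
        replace (Im (h z) + atan (Im w / Re w) - (Im (h z) + atan (Im W / Re W)))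
          with (atan (Im w / Re w) - atan (Im W / Re W)) by ring.
        (* The [16] is this Lipschitz constant [8] times the [2] of [direction_near]. *)
        eapply Rle_trans; [apply argument_lipschitz; lra|].
        replace (w - W)%C with ((cis s - G (f z)) * cis (- t))%C by (unfold w, W; ring).
        rewrite Cmod_mult, Cmod_cis; lra. }
  assert (HH : forall n z, (N <= n)%nat -> Disc_bar z -> exists l, cderiv (H n) z l).
  { intros n z Hn Hz.
    destruct (Hh z (Dball z Hz)) as [a Ha].
    destruct (polynomial_entire _ (Hp n) z) as [b Hb].
    destruct (polynomial_entire _ (Hp N) z) as [c Hc].
    destruct (cderiv_Log (p n z * / P z)%C) as [e He]; [apply (Key z Hz), Hn|].
    eexists; apply (cderiv_plus h (fun z => Log (p n z * / P z)%C)); [exact Ha|].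
    apply (cderiv_comp Log (fun z => p n z * / P z)%C); [exact He|].
    apply (cderiv_mult (p n) (fun z => / P z)%C); [exact Hb|].
    apply (cderiv_comp Cinv P); [apply cderiv_inv, HP, Dball, Hz|exact Hc]. }
  assert (Conv : forall eps, 0 < eps -> exists M, (N <= M)%nat /\ forall n, (M <= n)%nat ->
    forall z, Disc_bar z -> Rabs (Im (H n z) - theta z) < eps).
  { intros eps He; destruct (Hu (eps / 16) ltac:(lra)) as [M HM].
    exists (max N M); split; [lia|]; intros n Hn z Hz.
    specialize (HM n ltac:(lia) z Hz); destruct (Key z Hz) as [_ K].
    destruct (K n ltac:(lia)) as [_ K']; lra. }
  exists theta; split; [|split].
  - intros z Hz; destruct (Key z Hz) as [K _]; specialize (HF z Hz).
    destruct (f z) as [w|u]; [pose proof (Cmod_G_Fin_lt w); lra|].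
    f_equal; apply unit_circle_ext; symmetry; exact K.
  - apply continuous_on_Disc_bar; intros z Hz eps.
    pose proof (cond_pos eps) as He.
    destruct (Conv (eps / 3) ltac:(lra)) as [n [Hn Hc]]; specialize (Hc n (le_n n)).
    destruct (HH n z Hn Hz) as [l Hl].
    destruct (cderiv_ccont _ _ _ Hl (eps / 3) ltac:(lra)) as [dl [Hd Hw]].
    exists dl; split; [exact Hd|]; intros w Dw Hlt; specialize (Hw w Hlt).
    change (Rabs (theta w - theta z) < eps).
    pose proof (Hc z Hz) as A1; pose proof (Hc w Dw) as A2.
    pose proof (Rle_lt_trans _ _ _ (im_le_Cmod (H n w - H n z)) Hw) as A3.
    change (Im (H n w - H n z)) with (Im (H n w) - Im (H n z)) in A3.
    apply Rabs_lt_between in A1; apply Rabs_lt_between in A2; apply Rabs_lt_between in A3.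
    apply Rabs_lt_between; lra.
  (* The factor [- Ci] turns imaginary parts into real parts; the shift by [N] is there because
     [H n] is known to be holomorphic only from [N] on. *)
  - destruct (re_uniform_limit (fun n z => - Ci * H (N + n)%nat z)%C theta) as [g [Hg Eg]].
    + intros n; apply holo_scal; intros z Hz; apply HH; [lia|apply Disc_subset_bar, Hz].
    + intros eps He; destruct (Conv eps He) as [M [_ HM]]; exists M; intros n Hn z Hz.
      rewrite re_mult_opp_Ci; apply HM; [lia|apply Disc_subset_bar, Hz].
    + apply (harmonic_of_re g theta Hg Eg).
Qed.

Lemma limit_of_polynomials_class (f : C -> Cbar) : uniform_limit_of_polynomials f -> class_Abar f.
Proof.
  intros [p [Hp Hu]].
  pose proof (uniform_limit_continuous p f Hp Hu) as Hcont.
  assert (Hc : continuous_on Disc_bar f).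
  { apply continuous_on_Disc_bar; intros z Hz eps.
    destruct (Hcont z Hz eps (cond_pos eps)) as [dl [Hd Hw]].
    exists dl; split; [exact Hd|]; intros w Dw Hlt.
    specialize (Hw w Dw Hlt); rewrite d_sym in Hw; exact Hw. }
  destruct (classic (exists z0, Disc z0 /\ Cmod (G (f z0)) = 1)) as [[z0 [D0 E0]]|Fin0].
  - right; split; [exact Hc|].
    apply (limit_infinite_type p f Hp Hu).
    (* On the circle, infinity of [f] is inherited from the interior points [r z] by continuity of
       [G o f]. *)
    intros z Hz; apply Rle_antisym; [apply Cmod_G_le|].
    apply le_epsilon; intros eps He.
    destruct (uniform_radial_limit (fun z => G (f z))) with (eps := eps) as [r [Hr Hrad]]; [|exact He|].
    { intros w Dw e Hep; exact (Hcont w Dw e Hep). }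
    specialize (Hrad z Hz); cbv beta in Hrad.
    assert (Drz : Disc (r * z)%C).
    { unfold Disc; rewrite Cmod_mult, Cmod_R, Rabs_right by lra; unfold Disc_bar in Hz.
      pose proof (Cmod_ge_0 z); nra. }
    pose proof (infinite_set_connected p f z0 (r * z)%C Hp Hu D0 Drz E0) as E1.
    pose proof (Cmod_rev_triangle (G (f (r * z)%C)) (G (f z))); lra.
  - left; split; [exact Hc|].
    assert (Hfin : forall z, Disc z -> Cmod (G (f z)) <> 1).
    { intros z Hz E; apply Fin0; exists z; split; assumption. }
    exists (fun z => finite_part (f z)); split.
    + intros z Hz; apply finite_part_Fin, Hfin, Hz.
    + apply holo_holomorphic_on, (limit_finite_type p f Hp Hu Hfin).
Qed.

Theorem theorem3p1 :
  forall f : C -> Cbar, uniform_limit_of_polynomials f <-> class_Abar f.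
Proof.
  intros f; split; [apply limit_of_polynomials_class|].
  intros [Hf|Hf]; [apply finite_type_limit, Hf|apply infinite_type_limit, Hf].
Qed.
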